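(* Let $\Omega\subset\mathbb{R}^n$ be a bounded domain with smooth boundary $\Gamma$, let $d>0$ be a constant and $\delta\ge0$ a constant, $f,g\in C^\infty(\mathbb{R})$ with $|f'|\le c_f$, $p\in(n,\infty)$, and let $\lambda\ge\lambda_*$ be sufficiently large. Assume further that $$\frac{g(\xi)}{\xi^q}\to+\infty\qquad\text{as }\xi\to+\infty,$$ for some $q>1$. Then there is $C>0$ such that if $u_0\in\mathcal{X}_\delta$ satisfies $u_0\ge C$, then the solution of $$\lambda u-d\Delta u=f(u)\ \text{ in }(0,T)\times\Omega,\qquad \partial_tu_\Gamma-\delta\Delta_\Gamma u_\Gamma+d\,\partial_\nu u=g(u_\Gamma)\ \text{ on }(0,T)\times\Gamma,\qquad u_\Gamma|_{t=0}=u_0\ \text{ on }\Gamma$$ blows up in finite time.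
   Context: All function spaces are real; $H^{s,p}$ are Bessel-potential and $W^{s,p}$ Sobolev–Slobodetskij spaces; $u_\Gamma=u|_\Gamma$; $\Delta_\Gamma$ is the Laplace–Beltrami operator on $\Gamma$, $\partial_\nu$ the outer normal derivative. The phase space is $\mathcal{X}_\delta:=W^{2-2/p,p}(\Gamma)$ if $\delta>0$ and $\mathcal{X}_\delta:=W^{1-1/p,p}(\Gamma)$ if $\delta=0$. ''$\lambda\ge\lambda_*$ sufficiently large'': there is $\lambda_*$, depending only on $\Omega,d,\delta,p,f$, such that the assertion holds for every $\lambda\ge\lambda_*$. For such $\lambda$ the problem is locally well-posed: for each $u_0\in\mathcal{X}_\delta$ there is a unique maximal solution on $[0,t^+)$, $t^+=t^+(u_0)\in(0,\infty]$, with $u_\Gamma\in C([0,t^+);\mathcal{X}_\delta)$, smooth on $(0,t^+)\times\overline\Omega$, and $t^+<\infty$ implies $\|u_\Gamma(t)\|_{\mathcal{X}_\delta}\to\infty$ as $t\to t^+$. Blow-up in finite time means $t^+(u_0)<\infty$. *)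

(* Defs.v *)
From HB Require Import structures.
From mathcomp Require Export all_boot all_order all_algebra.
From mathcomp Require Export all_classical all_reals all_analysis.
Export Order.TTheory GRing.Theory Num.Theory.
Export numFieldNormedType.Exports.

Set Implicit Arguments.
Unset Strict Implicit.
Unset Printing Implicit Defensive.

Global Open Scope classical_set_scope.
Global Open Scope ring_scope.

(* The boundary of a domain of R^(m+1) is described by graphs of functions of
   m variables, so R^(m+1) is the ambient space throughout (m = 0 included). *)

(** * Smooth maps *)

Section Smoothness.
Context {R : realType} {V W : normedModType R}.

(* Meaningful for open [U]. *)
Fixpoint Ck (k : nat) (U : set V) (h : V -> W) : Prop :=
  (forall x, U x -> {for x, continuous h}) /\
  (if k is k'.+1 then
     forall v : V, (forall x, U x -> derivable h x v) /\ Ck k' U ('D_v h)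
   else True).

Definition Cinfty (U : set V) (h : V -> W) : Prop := forall k, Ck k U h.

(* Smoothness on an arbitrary set: locally the restriction of a smooth map on
   an open set; used for smoothness up to the boundary. *)
Definition smooth_on (S : set V) (h : V -> W) : Prop :=
  forall x, S x -> exists (U : set V) (h' : V -> W),
    [/\ open U, U x, Cinfty U h' & forall y, U y -> S y -> h y = h' y].

End Smoothness.

(** * Euclidean structure: the library norm on row vectors is the sup norm *)

Definition dotp {R : realType} {n : nat} (u v : 'rV[R]_n) : R :=
  \sum_(i < n) u ord0 i * v ord0 i.

Definition enorm {R : realType} {n : nat} (u : 'rV[R]_n) : R :=
  Num.sqrt (dotp u u).

Definition ebasis {R : realType} {n : nat} (i : 'I_n) : 'rV[R]_n :=
  delta_mx ord0 i.

Definition partial {R : realType} {n : nat} {W : normedModType R} (i : 'I_n)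
  (h : 'rV[R]_n -> W) : 'rV[R]_n -> W := 'D_(ebasis i) h.

Definition laplacian {R : realType} {n : nat} (w : 'rV[R]_n -> R^o)
    (x : 'rV[R]_n) : R :=
  \sum_(i < n) partial i (partial i w) x.

(** * Lebesgue measure on R^m, carried by m-tuples *)

Section TupleProduct.
Context {d : measure_display} {T : measurableType d} {R : realType}.
Variable mu1 : {sigma_finite_measure set T -> \bar R}.

Definition cons_pair n (x : T * n.-tuple T) : n.+1.-tuple T :=
  [the n.+1.-tuple T of x.1 :: x.2].

Lemma measurable_cons_pair n :
  measurable_fun [set: T * n.-tuple T] (@cons_pair n).
Proof. exact: measurable_cons. Qed.

Section Step.
Variables (n : nat) (mu : {sigma_finite_measure set (n.-tuple T) -> \bar R}).

Definition tuple_step : set (n.+1.-tuple T) -> \bar R :=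
  pushforward (mu1 \x mu)%E (@cons_pair n).

Let tuple_step0 : tuple_step set0 = 0%E.
Proof. by rewrite /tuple_step /pushforward preimage_set0 measure0. Qed.

Let tuple_step_ge0 A : (0 <= tuple_step A)%E.
Proof. by rewrite /tuple_step /pushforward measure_ge0. Qed.

Let tuple_step_sigma_additive : semi_sigma_additive tuple_step.
Proof.
exact: (@measure_semi_sigma_additive _ _ _
  (measure_function_pushforward__canonical__measure_function_Measure
     (mu1 \x mu)%E (@measurable_cons_pair n))).
Qed.

HB.instance Definition _ := isMeasure.Build _ _ _ tuple_step
  tuple_step0 tuple_step_ge0 tuple_step_sigma_additive.

Let tuple_step_sigma_finite : sigma_finite setT tuple_step.
Proof.
have /sigma_finiteP[F [FT ndF Foo]] := sigma_finiteT mu1.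
have /sigma_finiteP[G [GT ndG Goo]] := sigma_finiteT mu.
pose split_pair (t : n.+1.-tuple T) : T * n.-tuple T :=
  (thead t, [tuple of behead t]).
have msplit : measurable_fun setT split_pair.
  apply/measurable_fun_pair; first exact: measurable_tnth.
  exact: measurable_behead.
have consK : cancel (@cons_pair n) split_pair.
  by move=> [a t]; congr (_, _); apply/val_inj.
exists (fun k => split_pair @^-1` (F k `*` G k)).
  rewrite -preimage_bigcup; apply/seteqP; split=> // t _ /=.
  have [i _ Fi] : (\bigcup_i F i) (thead t) by rewrite -FT.
  have [j _ Gj] : (\bigcup_i G i) [tuple of behead t] by rewrite -GT.
  exists (maxn i j) => //; split=> /=.
  - by move: Fi; exact/subsetPset/ndF/leq_maxl.
  - by move: Gj; exact/subsetPset/ndG/leq_maxr.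
move=> k; have [mF Fk] := Foo k; have [mG Gk] := Goo k; split.
  by rewrite -[X in measurable X]setTI; apply: msplit => //; exact: measurableX.
rewrite /tuple_step /pushforward -comp_preimage.
rewrite (_ : split_pair \o @cons_pair n = id); last exact/funext.
by rewrite preimage_id product_measure1E// lte_mul_pinfty// ge0_fin_numE.
Qed.

HB.instance Definition _ := Measure_isSigmaFinite.Build _ _ _ tuple_step
  tuple_step_sigma_finite.

End Step.

Fixpoint tuple_measure (n : nat) :
    {sigma_finite_measure set (n.-tuple T) -> \bar R} :=
  if n is n'.+1
  then [the sigma_finite_measure _ _ of tuple_step (tuple_measure n')]
  else [the sigma_finite_measure _ _ of \d_([tuple] : 0.-tuple T)].

End TupleProduct.

Definition leb (R : realType) (m : nat) :
    {sigma_finite_measure set (m.-tuple (measurableTypeR R)) -> \bar R} :=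
  tuple_measure (@lebesgue_measure R) m.

Definition rowt {R : realType} {m : nat} (t : m.-tuple (measurableTypeR R)) :
    'rV[R]_m :=
  \row_i tnth t i.

(** * Sobolev--Slobodetskij spaces on R^m *)

Section Slobodetskij.
Context {R : realType} {m : nat}.
Implicit Types (h w : 'rV[R]_m -> R^o) (p s : R) (a : seq 'I_m).
Local Notation mu := (leb R m).

Definition Lp_norm p h : \bar R := ('N[mu]_(p%:E)[EFin \o (h \o rowt)])%E.

Definition in_Lp p h : Prop :=
  measurable_fun setT (h \o rowt : m.-tuple (measurableTypeR R) -> R) /\
  (Lp_norm p h < +oo)%E.

Definition test_fun (phi : 'rV[R]_m -> R^o) : Prop :=
  Cinfty setT phi /\ exists r : R, forall x, r < `|x| -> phi x = 0.

(* Iterated partial derivative along the list of directions [a]. *)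
Definition mpartial a (phi : 'rV[R]_m -> R^o) : 'rV[R]_m -> R^o :=
  foldr (fun i phi' => partial i phi') phi a.

(* [w] is the weak derivative of [h] along [a], and lies in L^p. *)
Definition weak_partial p a h w : Prop :=
  in_Lp p w /\
  forall phi, test_fun phi ->
    \int[mu]_t (h (rowt t) * mpartial a phi (rowt t)) =
    (-1) ^+ size a * \int[mu]_t (w (rowt t) * phi (rowt t)).

(* Chosen representative of the weak derivative, [h] itself in order 0. *)
Definition wpartial p a h : 'rV[R]_m -> R^o :=
  if a is [::] then h else xget (fun=> 0) [set w | weak_partial p a h w].

Definition slobodetskij_seminorm (sigma p : R) h : \bar R :=
  ((\int[mu]_t \int[mu]_t'
      ((`|h (rowt t) - h (rowt t')| `^ p) /
       (enorm (rowt t - rowt t') `^ (m%:R + sigma * p)))%:E) `^ p^-1)%E.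

(* W^{s,p} for s >= 0: with k the integer part of s, L^p norms of the weak
   derivatives of order <= k and, if s is not an integer, the Slobodetskij
   seminorms of exponent s - k of those of order k. *)
Definition Wsp_norm s p h : \bar R :=
  let k := Num.truncn s in
  (\sum_(j < k.+1) \sum_(a : j.-tuple 'I_m) Lp_norm p (wpartial p a h) +
   (if s == k%:R then 0
    else \sum_(a : k.-tuple 'I_m)
           slobodetskij_seminorm (s - k%:R) p (wpartial p a h)))%E.

Definition in_Wsp s p h : Prop :=
  [/\ in_Lp p h,
      forall a, (size a <= Num.truncn s)%N -> exists w, weak_partial p a h w &
      (Wsp_norm s p h < +oo)%E].

End Slobodetskij.

(** * Bounded smooth domains and their boundary *)

(* Up to the rigid motion [frame], the domain is, inside [dom], the strict
   epigraph of [height] over the last m coordinates. *)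
Record chart (R : realType) (m : nat) := Chart {
  dom : set 'rV[R]_m.+1 ;
  frame : 'M[R]_m.+1 ;
  height : 'rV[R]_m -> R^o }.

Section Boundary.
Context {R : realType} {m : nat}.
Implicit Types (Om : set 'rV[R]_m.+1) (c : chart R m) (y : 'rV[R]_m)
  (w : 'rV[R]_m.+1 -> R^o).

Definition point_at c (r : R) y : 'rV[R]_m.+1 :=
  (row_mx (r%:M : 'rV[R]_1) y : 'rV[R]_(1 + m)) *m frame c.

Definition param c y : 'rV[R]_m.+1 := point_at c (height c y) y.

Definition is_chart Om c : Prop :=
  [/\ open (dom c), frame c *m (frame c)^T = 1%:M, Cinfty setT (height c) &
      forall r y, dom c (point_at c r y) ->
        (Om (point_at c r y) <-> height c y < r)].

Definition boundary Om : set 'rV[R]_m.+1 := closure Om `\` interior Om.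

Definition bounded_smooth_domain Om : Prop :=
  [/\ open Om, connected Om, Om !=set0, bounded_set Om &
      forall x, boundary Om x -> exists2 c, is_chart Om c & dom c x].

(* The parameters of the boundary piece described by [c]. *)
Definition chart_params c : set 'rV[R]_m := [set y | dom c (param c y)].

(* Outer unit normal at [param c y]: the domain lies above the graph. *)
Definition normal c y : 'rV[R]_m.+1 :=
  let grad := \row_(i < m) partial i (height c) y in
  (Num.sqrt (1 + dotp grad grad))^-1 *:
  ((row_mx ((-1)%:M : 'rV[R]_1) grad : 'rV[R]_(1 + m)) *m frame c).

(* One-sided, hence only depending on the values of [w] on the closure of the
   domain. *)
Definition normal_derivative c w y : R :=
  let x := param c y in
  lim ((h^-1 * (w x - w (x - h *: normal c y)) : R^o) @[h --> (0 : R)^'+]).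

Definition metric c y : 'M[R]_m :=
  \matrix_(i, j) dotp (partial i (param c) y) (partial j (param c) y).

(* Laplace--Beltrami operator at [param c y], in the local coordinates given by
   [c]; it only depends on the values of [w] on the boundary. *)
Definition laplace_beltrami c w y : R :=
  let vol z : R^o := Num.sqrt (\det (metric c z)) in
  (vol y)^-1 *
  \sum_(i < m) partial i (fun z : 'rV[R]_m =>
    \sum_(j < m)
      (vol z * invmx (metric c z) i j * partial j (w \o param c) z : R^o)) y.

Definition ae_boundary Om (P : set 'rV[R]_m.+1) : Prop :=
  forall c, is_chart Om c ->
    {ae leb R m, forall t, chart_params c (rowt t) -> P (param c (rowt t))}.

(** * Sobolev--Slobodetskij spaces on the boundary *)

Definition cutoff c (chi : 'rV[R]_m.+1 -> R^o) : Prop :=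
  Cinfty setT chi /\
  exists K, [/\ compact K, K `<=` dom c & forall x, ~ K x -> chi x = 0].

(* The localization of [w] in the chart [c], extended by zero to R^m. *)
Definition localize c (chi w : 'rV[R]_m.+1 -> R^o) : 'rV[R]_m -> R^o :=
  fun y => chi (param c y) * w (param c y).

(* Membership and convergence in W^{s,p} of the (compact) boundary: all
   localizations belong to, resp. converge in, W^{s,p}(R^m).  This is the
   definition by a finite atlas and a partition of unity, without fixing
   one. *)
Definition in_Wsp_bd Om (s p : R) w : Prop :=
  forall c chi, is_chart Om c -> cutoff c chi -> in_Wsp s p (localize c chi w).

Definition continuous_Wsp_bd Om (s p : R) (J : set R)
    (u : R -> 'rV[R]_m.+1 -> R^o) : Prop :=
  (forall t, J t -> in_Wsp_bd Om s p (u t)) /\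
  forall t0, J t0 -> forall c chi, is_chart Om c -> cutoff c chi ->
    Wsp_norm s p (localize c chi (fun x => u t x - u t0 x))
      @[t --> within J (nbhs t0)] --> 0%E.

End Boundary.

(** * The elliptic problem with dynamic boundary condition *)

Section Problem.
Context {R : realType} {m : nat}.
Variables (Om : set 'rV[R]_m.+1) (d delta p : R) (f g : R -> R) (lambda : R).

Definition phase_exponent : R :=
  if 0 < delta then 2 - 2 / p else 1 - 1 / p.

Definition phase_space : set ('rV[R]_m.+1 -> R^o) :=
  [set w | in_Wsp_bd Om phase_exponent p w].

(* [u] solves the problem on [0, T).  For 0 < t < T only its values on the
   closure of the domain are relevant, for t = 0 only those on the boundary. *)
Definition is_solution (u0 : 'rV[R]_m.+1 -> R^o) (T : \bar R)
    (u : R -> 'rV[R]_m.+1 -> R^o) : Prop :=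
  [/\ (0 < T)%E,
      smooth_on [set z : R^o * 'rV[R]_m.+1 |
                  [/\ 0 < z.1, (z.1%:E < T)%E & closure Om z.2]]
                (fun z => u z.1 z.2),
      forall (t : R) x, 0 < t -> (t%:E < T)%E -> Om x ->
        lambda * u t x - d * laplacian (u t) x = f (u t x),
      forall (t : R) c y, 0 < t -> (t%:E < T)%E -> is_chart Om c ->
        chart_params c y ->
        derive1 (fun tau : R => u tau (param c y) : R^o) t
        - delta * laplace_beltrami c (u t) y
        + d * normal_derivative c (u t) y = g (u t (param c y)) &
      continuous_Wsp_bd Om phase_exponent p
        [set t | 0 <= t /\ (t%:E < T)%E] u /\
      (forall x, boundary Om x -> u 0 x = u0 x)].

(* A solution on [0, T) that cannot be continued beyond T. *)
Definition is_maximal_solution (u0 : 'rV[R]_m.+1 -> R^o) (T : \bar R)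
    (u : R -> 'rV[R]_m.+1 -> R^o) : Prop :=
  is_solution u0 T u /\
  forall (T' : \bar R) (v : R -> 'rV[R]_m.+1 -> R^o), is_solution u0 T' v ->
    (T <= T')%E ->
    (forall (t : R) x, 0 < t -> (t%:E < T)%E -> closure Om x ->
       v t x = u t x) ->
    T' = T.

(* t^+(u0) is finite. *)
Definition blows_up_in_finite_time (u0 : 'rV[R]_m.+1 -> R^o) : Prop :=
  forall T u, is_maximal_solution u0 T u -> (T < +oo)%E.

End Problem.

(* Main.v *)
Require Import Defs.
From mathcomp Require Import measurable_realfun ring lra.
Import Num.Def.

Set Implicit Arguments.
Unset Strict Implicit.
Unset Printing Implicit Defensive.

(** Suppose that the maximal solution is global, and let M(t) be the minimum of
    u(t) over the boundary.  The proof shows that M satisfies M' > M^q in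
    the sense of comparison, which no function defined for all times can satisfy
    from a large initial value on.

    Let u(t) attain the value M = M(t) at the boundary point x.  The smooth
    boundary has exterior balls of a common radius r; let ctr be the centre of
    the one that touches at x.  The function
      b(z) = (M + K) exp (- kappa (|z - ctr|^2 - r^2)) - K
    equals M at x and is at most M outside the ball.  For kappa large and K
    absorbing f(0) it is a subsolution of the elliptic equation, so b <= u(t)
    in the domain, by the maximum principle; this is where lambda has to exceed
    the Lipschitz constant of f.  Comparing difference quotients along the
    normal at x gives
      d_nu u <= 2 kappa r (M + K)             (normal_derivative_at_minimum).
    The Laplace-Beltrami operator of u(t) is nonnegative at the minimum
    (laplace_beltrami_ge0), so the boundary equation yields
      d_t u(t, x) >= g(M) - 2 d kappa r (M + K)      (boundary_minimum_rate),
    a lower bound that is linear in M up to the term g(M).  As g grows faster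
    than xi^q, the right-hand side exceeds M^q as soon as M is large
    (superlinear_threshold), and u stays above the solution of y' = y^q
    (comparison_blowup).

    The initial value needs a separate argument: u is classical only for
    positive times, u0 >= C holds almost everywhere, and u(t) tends to u0 only
    in W^(s,p) of the boundary, with s = 1 - 1/p or s = 2 - 2/p.  Since
    s p > m, the dimension of the boundary, the convergence is in fact uniform.
    The proof compares a function h of W^(s,p) on R^m with its averages A_k h
    against products of bumps of side 2^(-k): the difference of A_k h and
    A_(k+1) h is at most D theta^k with theta < 1, uniformly in the point and
    on bounded sets of W^(s,p) (dyadic_decay).  Each A_k is bounded on L^p,
    and A_k of the initial value is at least C, whence u(t) > C - 1 on the
    whole boundary for some small t (initial_layer).  In these estimates
    Hoelder's inequality is replaced by x <= a + a^(1-p) x^p for a free a > 0,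
    which the decay estimates choose as a power of 2^k (young_split). *)

(** * Directional derivatives and maps of class C^k *)

Section LineDerivative.
Context {R : realType} {V W : normedModType R}.

(** The difference quotients of [h] along [v] and those of its restriction to
    the line through [x] are the same functions, which transfers derivatives in
    both directions between several variables and one. *)
Lemma quotient_line (h : V -> W) (x v : V) (s : R) :
  (fun t : R => t^-1 *: (((fun a : R => h (x + a *: v)) \o shift s) (t *: 1) -
                        h (x + s *: v))) =
  (fun t : R => t^-1 *: ((h \o shift (x + s *: v)) (t *: v) - h (x + s *: v))).
Proof.
apply/funext => t /=; congr (_ *: (h _ - _)).
by rewrite scaler1 scalerDl addrCA addrA.
Qed.

Lemma is_derive_line (h : V -> W) (x v : V) (s : R) :
  derivable h (x + s *: v) v ->
  is_derive s (1 : R) (fun a : R => h (x + a *: v)) ('D_v h (x + s *: v)).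
Proof.
move=> hd; apply: DeriveDef; first by rewrite /derivable quotient_line.
by rewrite /derive quotient_line.
Qed.

Lemma is_derive_line0 (h : V -> W) (x v : V) (dh : W) :
  is_derive (0 : R) (1 : R) (fun a : R => h (x + a *: v)) dh ->
  is_derive x v h dh.
Proof.
case; rewrite /derivable /derive quotient_line scale0r addr0 => h1 h2.
exact: DeriveDef.
Qed.

End LineDerivative.

Section MeanValueLine.
Context {R : realType} {V : normedModType R}.

Lemma mean_value_line (h : V -> R^o) (x v : V) :
  (forall s : R, 0 <= s <= 1 -> derivable h (x + s *: v) v) ->
  exists2 c : R, 0 <= c <= 1 & h (x + v) - h x = 'D_v h (x + c *: v).
Proof.
move=> hd.
have ds (s : R) : 0 <= s <= 1 ->
    is_derive s (1 : R) (fun a : R => h (x + a *: v) : R) ('D_v h (x + s *: v)).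
  by move=> s01; apply: (@is_derive_line R V R^o); exact: hd.
have [||c cin] := @MVT_segment R (fun a : R => h (x + a *: v))
  (fun s => 'D_v h (x + s *: v)) 0 1 ler01.
- by move=> s; rewrite in_itv/= => /andP[? ?]; apply: ds; lra.
- apply: derivable_within_continuous => s; rewrite in_itv/= => s01.
  by have [] := ds _ s01.
rewrite scale1r scale0r addr0 subr0 mulr1 => e.
by exists c => //; move: cin; rewrite in_itv.
Qed.

End MeanValueLine.

Section CkBasics.
Context {R : realType} {V : normedModType R}.
Implicit Types (U : set V) (h g : V -> R^o).

Lemma Ck_continuous k U h x : Ck k U h -> U x -> {for x, continuous h}.
Proof. by case: k => [|k] [hc _]; exact: hc. Qed.

Lemma Ck_derivable k U h x v : Ck k.+1 U h -> U x -> derivable h x v.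
Proof. by move=> [_ /(_ v)[hd _]]; exact: hd. Qed.

Lemma Ck_derive k U h v : Ck k.+1 U h -> Ck k U ('D_v h).
Proof. by move=> [_ /(_ v)[]]. Qed.

Lemma Ck_pred k U h : Ck k.+1 U h -> Ck k U h.
Proof.
elim: k h => [|k ih] h [hc hd]; first by split.
split=> // v; split; first by case: (hd v).
by apply: ih; case: (hd v).
Qed.

Lemma Ck_le k l U h : (k <= l)%N -> Ck l U h -> Ck k U h.
Proof.
move=> /subnK <-; elim: (l - k)%N => // j ih hl.
by apply: ih; apply: Ck_pred.
Qed.

Lemma Ck_subset k U U' h : U' `<=` U -> Ck k U h -> Ck k U' h.
Proof.
move=> sub; elim: k h => [|k ih] h [hc hd]; first by split=> // x /sub/hc.
split=> [x /sub/hc //|v]; have [h1 h2] := hd v.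
by split=> [x /sub/h1 //|]; exact: ih.
Qed.

Lemma Ck_eq k U h g : open U -> {in U, h =1 g} -> Ck k U h -> Ck k U g.
Proof.
move=> oU; elim: k h g => [|k ih] h g hg [hc hd].
  split=> // x Ux; have nUx : nbhs x U by exact: open_nbhs_nbhs.
  rewrite /prop_for /continuous_at -hg ?inE//.
  apply: cvg_trans (hc x Ux); apply: near_eq_cvg.
  by near=> y; apply: hg; rewrite inE; near: y.
have nb x : U x -> {near x, h =1 g}.
  move=> Ux; have : nbhs x U by exact: open_nbhs_nbhs.
  by apply: filterS => y Uy; apply: hg; rewrite inE.
split=> [x Ux|v].
  rewrite /prop_for /continuous_at -hg ?inE//.
  by apply: cvg_trans (hc x Ux); apply: near_eq_cvg; exact: nb.
have [h1 h2] := hd v; split=> [x Ux|].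
  by apply: (near_eq_derivable (nb _ Ux)); exact: h1.
apply: ih h2 => x; rewrite inE => Ux; exact: near_eq_derive (nb _ Ux).
Unshelve. all: by end_near. Qed.

Lemma Ck_cst k U (a : R) : Ck k U (fun=> a : R^o).
Proof.
elim: k a => [|k ih] a; split=> //; try by move=> x _; exact: cvg_cst.
move=> v; split=> [x _|]; first exact: derivable_cst.
rewrite (_ : 'D_v _ = fun=> 0); first exact: ih.
by apply/funext => x; rewrite derive_cst.
Qed.

Lemma CkD k U h g : open U -> Ck k U h -> Ck k U g -> Ck k U (fun x => h x + g x).
Proof.
move=> oU; elim: k h g => [|k ih] h g [hc hd] [gc gd].
  by split=> // x Ux; apply: (@continuousD R R^o V h g x); [exact: hc|exact: gc].
split=> [x Ux|v].
  by apply: (@continuousD R R^o V h g x); [exact: hc|exact: gc].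
have [h1 h2] := hd v; have [g1 g2] := gd v; split=> [x Ux|].
  by apply: derivableD; [exact: h1|exact: g1].
apply: (Ck_eq oU (h := fun x => 'D_v h x + 'D_v g x)); last exact: ih.
move=> x; rewrite inE => Ux; rewrite -[RHS]/('D_v (h + g) x).
by rewrite deriveD//; [exact: h1|exact: g1].
Qed.

Lemma CkM k U h g : open U -> Ck k U h -> Ck k U g ->
  Ck k U (fun x => (h x : R) * g x).
Proof.
move=> oU; elim: k h g => [|k ih] h g hk gk.
  case: hk gk => [hc _] [gc _].
  by split=> // x Ux; apply: (@continuousM R V h g x); [exact: hc|exact: gc].
have [hc hd] := hk; have [gc gd] := gk.
split=> [x Ux|v].
  by apply: (@continuousM R V h g x); [exact: hc|exact: gc].
have [h1 h2] := hd v; have [g1 g2] := gd v; split=> [x Ux|].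
  by apply: (@derivableM R V h g); [exact: h1|exact: g1].
apply: (Ck_eq oU (h := fun x => (h x : R) * 'D_v g x + (g x : R) * 'D_v h x)).
  move=> x; rewrite inE => Ux; rewrite -[RHS]/('D_v ((h : V -> R) * g) x).
  by rewrite (@deriveM R V h g)//; [exact: h1|exact: g1].
by apply: CkD => //; apply: ih => //; exact: Ck_pred.
Qed.

Lemma Ck_sum k U (I : Type) (r : seq I) (h : I -> V -> R^o) :
  open U -> (forall i, Ck k U (h i)) -> Ck k U (fun x => \sum_(i <- r) h i x).
Proof.
move=> oU hk; elim: r => [|i r ih].
  by under eq_fun do rewrite big_nil; exact: Ck_cst.
by under eq_fun do rewrite big_cons; exact: CkD.
Qed.

Lemma Ck_prod k U (I : Type) (r : seq I) (h : I -> V -> R^o) :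
  open U -> (forall i, Ck k U (h i)) ->
  Ck k U (fun x => \prod_(i <- r) (h i x : R)).
Proof.
move=> oU hk; elim: r => [|i r ih].
  by under eq_fun do rewrite big_nil; exact: Ck_cst.
by under eq_fun do rewrite big_cons; exact: CkM.
Qed.

Lemma CkV k U h : open U -> (forall x, U x -> h x != 0 :> R) -> Ck k U h ->
  Ck k U (fun x => (h x : R)^-1).
Proof.
move=> oU h0; elim: k => [|k ih] hk.
  case: hk => [hc _]; split=> // x Ux.
  by apply: (@continuousV R V h x); [exact: h0|exact: hc].
have [hc hd] := hk.
split=> [x Ux|v].
  by apply: (@continuousV R V h x); [exact: h0|exact: hc].
have [h1 h2] := hd v; split=> [x Ux|].
  by apply: (@derivableV R V h); [exact: h0|exact: h1].
have ihk := ih (Ck_pred hk).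
apply: (Ck_eq oU
  (h := fun x => (-1 : R) * (((h x : R)^-1 * (h x : R)^-1) * 'D_v h x))).
  move=> x; rewrite inE => Ux; rewrite (@deriveV R V h)//.
  - by rewrite /GRing.scale/= -exprVn expr2; ring.
  - exact: h0.
  - exact: h1.
apply: CkM => //; first exact: Ck_cst.
by apply: CkM => //; apply: CkM.
Qed.

End CkBasics.

(** * Maps of class C^k on row vectors *)

Section RowNorm.
Context {R : realType} {n : nat}.
Implicit Types v : 'rV[R]_n.

Lemma normr_coord_le v i : `|v ord0 i| <= `|v|.
Proof.
rewrite [leRHS]/normr /= mx_normrE.
by apply/bigmax_geP; right => /=; exists (ord0, i).
Qed.

Lemma normr_row_le v (a : R) : 0 <= a -> (forall i, `|v ord0 i| <= a) ->
  `|v| <= a.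
Proof.
move=> a0 va; rewrite /normr /= mx_normrE; apply/bigmax_leP; split=> //.
by move=> [i j] _ /=; rewrite (ord1 i).
Qed.

Lemma row_sum_ebasis v : v = \sum_i v ord0 i *: ebasis i.
Proof. exact: row_sum_delta. Qed.

End RowNorm.

Section DeriveScale.
Context {R : realType} {V : normedModType R}.

Lemma is_derive_scale_dir (h : V -> R^o) (x v : V) (a : R) :
  derivable h x v -> is_derive x (a *: v) h (a * 'D_v h x).
Proof.
move=> hd; apply: is_derive_line0.
have h1 : is_derive (a * 0 : R) (1 : R) (fun t : R => h (x + t *: v) : R)
   ('D_v h x).
  rewrite mulr0; have := @is_derive_line R V R^o h x v 0.
  by rewrite scale0r addr0; apply.
have h2 : is_derive (0 : R) (1 : R) (fun t : R => a * t) a.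
  rewrite -[X in is_derive _ _ _ X]mulr1.
  exact: (@is_deriveZ R R R id a 0 1 1 (is_derive_id _ _)).
have := @is_derive1_comp R (fun t : R => h (x + t *: v) : R) (fun t => a * t)
  0 _ _ h1 h2.
rewrite [X in is_derive _ _ X _](_ : _ = (fun t : R => h (x + t *: (a *: v)))).
  by rewrite mulrC.
by apply/funext => t /=; rewrite scalerA mulrC.
Qed.

End DeriveScale.

Section CkCoord.
Context {R : realType} {n : nat}.

Lemma Ck_coord k (U : set 'rV[R]_n) i : Ck k U (fun y => y ord0 i : R^o).
Proof.
case: k => [|k].
  by split=> // w _; exact: (@coord_continuous R 1 n ord0 i w).
split=> [w _|v]; first exact: (@coord_continuous R 1 n ord0 i w).
have der x : is_derive x v (fun y : 'rV[R]_n => y ord0 i : R^o) (v ord0 i).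
  apply: is_derive_line0.
  have -> : (fun a : R => (x + a *: v) ord0 i : R^o) =
      (cst (x ord0 i : R^o) + v ord0 i \*: id).
    by apply/funext => a; rewrite !fctE !mxE /GRing.scale/= mulrC.
  rewrite -[X in is_derive _ _ _ X]add0r -[X in 0 + X]mulr1.
  apply: is_deriveD; exact: (@is_deriveZ R R R id (v ord0 i) 0 1 1 (is_derive_id _ _)).
split=> [x _|]; first by have [] := der x.
rewrite (_ : 'D_v _ = fun=> v ord0 i : R^o); first exact: Ck_cst.
by apply/funext => x; have [] := der x.
Qed.

End CkCoord.

Section C1Differentiable.
Context {R : realType} {n : nat}.

(** Continuous partial derivatives give differentiability: the increment is
    split along a path that changes one coordinate at a time, and the mean value
    theorem applies on each leg.  The cube around [x] is a ball for the norm of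
    row vectors, so the path does not leave it. *)
Lemma C1_increment (U : set 'rV[R]_n) (h : 'rV[R]_n -> R^o) x :
  open U -> Ck 1 U h -> U x -> forall e : R, 0 < e ->
  \forall v \near (0 : 'rV[R]_n),
    `|h (x + v) - h x - \sum_(i < n) v ord0 i * partial i h x| <= e * `|v|.
Proof.
move=> oU hk Ux e e0.
have n0 : 0 < n%:R + 1 :> R by rewrite ltr_wpDl.
pose e' := e / (n%:R + 1).
have e'0 : 0 < e' by rewrite divr_gt0.
have nearx : \forall y \near x, U y /\ forall i, `|partial i h y - partial i h x| <= e'.
  near=> y; split; first by near: y; exact: open_nbhs_nbhs.
  move=> i; move: i; near: y; apply: filter_forall => i.
  have /(_ _ Ux) := Ck_continuous (Ck_derive (ebasis i) hk).
  by move=> /cvgrPdist_le/(_ _ e'0); apply: filterS => y; rewrite distrC.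
move: nearx => /nbhs_ballP[r /= r0 rball].
have good y : `|y - x| < r ->
    U y /\ forall i, `|partial i h y - partial i h x| <= e'.
  by move=> yx; apply: rball; rewrite -ball_normE /= distrC.
near=> v.
have vr : `|v| < r.
  by near: v; exact: (@nbhs0_lt R 'rV[R]_n).
(* The corner of the path reached after the first k coordinates. *)
pose w k : 'rV[R]_n := \row_(i < n) (if (i < k)%N then v ord0 i else 0).
have w0 : w 0%N = 0 by apply/rowP => i; rewrite !mxE.
have wn : w n = v by apply/rowP => i; rewrite !mxE ltn_ord.
have wS (k : 'I_n) : w k.+1 = w k + v ord0 k *: ebasis k.
  apply/rowP => i; rewrite !mxE eqxx ltnS leq_eqVlt -val_eqE /=.
  case: (ltngtP i k) => //= ik; rewrite ?mulr0 ?addr0// mulr1 add0r.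
  by congr (v _ _); apply: val_inj.
have step (k : 'I_n) :
    `|h (x + w k.+1) - h (x + w k) - v ord0 k * partial k h x| <= e' * `|v|.
  have inr (s : R) : 0 <= s <= 1 -> `|(x + w k + s *: (v ord0 k *: ebasis k)) - x| < r.
    move=> /andP[s0 s1]; rewrite addrC addrA addKr.
    apply: le_lt_trans vr; apply: normr_row_le => // i.
    rewrite !mxE eqxx /= -val_eqE /=.
    case: (ltngtP i k) => //= ik; rewrite ?mulr0 ?addr0 ?normr0 ?normr_coord_le//.
    rewrite add0r mulr1 normrM (ger0_norm s0).
    by apply: le_trans (normr_coord_le v k); rewrite ler_piMl.
  have der (s : R) : 0 <= s <= 1 ->
      is_derive (x + w k + s *: (v ord0 k *: ebasis k)) (v ord0 k *: ebasis k) h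
       (v ord0 k * partial k h (x + w k + s *: (v ord0 k *: ebasis k))).
    move=> s01; apply: is_derive_scale_dir; apply: (Ck_derivable (v:=_) hk).
    by have [] := good _ (inr _ s01).
  have [|c c01] := @mean_value_line R _ h (x + w k) (v ord0 k *: ebasis k).
    by move=> s s01; have [] := der s s01.
  rewrite wS addrA => ->; rewrite (@derive_val _ _ _ _ _ _ _ (der _ c01)).
  rewrite -mulrBr normrM mulrC ler_pM ?normr_coord_le//.
  by have [_] := good _ (inr _ c01); exact.
have -> : h (x + v) - h x = \sum_(i < n) (h (x + w i.+1) - h (x + w i)).
  rewrite -(big_mkord xpredT (fun i => h (x + w i.+1) - h (x + w i))).
  by rewrite telescope_sumr// wn w0 addr0.
rewrite -sumrB; apply: le_trans (ler_norm_sum _ _ _) _.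
apply: le_trans (ler_sum _ (fun k _ => step k)) _.
rewrite sumr_const card_ord -[leLHS]mulr_natl mulrA ler_wpM2r//.
by rewrite /e' mulrCA ger_pMr// ler_pdivrMr// mul1r lerDl.
Unshelve. all: by end_near. Qed.

Lemma C1_differentiable (U : set 'rV[R]_n) (h : 'rV[R]_n -> R^o) x :
  open U -> Ck 1 U h -> U x -> differentiable h x.
Proof.
move=> oU hk Ux.
have [f fE] : exists f : {linear 'rV[R]_n -> R^o},
    forall v, f v = \sum_(i < n) v ord0 i * partial i h x.
  have @f : {linear 'rV[R]_n -> R^o}.
    exists (fun v : 'rV[R]_n => \sum_(i < n) v ord0 i * partial i h x).
    do 2![eexists]; do ?[constructor].
    - by rewrite big1// => i _; rewrite mxE mul0r.
    - move=> a b; rewrite -big_split/=; apply: eq_bigr => i _.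
      by rewrite !mxE -mulrDl.
    - move=> a b; rewrite scaler_sumr; apply: eq_bigr => i _.
      by rewrite !mxE -mulrA.
  by exists f.
have fc : continuous f.
  rewrite (_ : (f : _ -> _) = fun v => \sum_(i < n) v ord0 i * partial i h x); last first.
    by apply/funext.
  move=> v; apply: (@Ck_continuous R _ 0 setT) => //.
  apply: Ck_sum; first exact: openT.
  by move=> i; apply: CkM; [exact: openT|exact: Ck_coord|exact: Ck_cst].
have hf : h \o shift x = cst (h x) + f +o_ (0 : 'rV[R]_n) id.
  apply/eqaddoP => e e0.
  have := C1_increment oU hk Ux e0; apply: filterS => v.
  by rewrite !fctE /= opprD addrA (addrC v x) fE.
apply/diff_locallyP; rewrite (diff_unique fc hf).
by [].
Qed.

Lemma derive_sum_partial (U : set 'rV[R]_n) (h : 'rV[R]_n -> R^o) x v :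
  open U -> Ck 1 U h -> U x -> 'D_v h x = \sum_i v ord0 i * partial i h x.
Proof.
move=> oU hk Ux; have dh := C1_differentiable oU hk Ux.
rewrite deriveE// {1}[v]row_sum_ebasis linear_sum; apply: eq_bigr => i _.
by rewrite linearZ /= /partial deriveE.
Qed.

End C1Differentiable.

Section AffineChange.
Context {R : realType} {V V' : normedModType R}.
Variables (A A0 : V -> V').
Hypothesis Ac : continuous A.
Hypothesis Aaff : forall (t : R) v x, A (t *: v + x) = t *: A0 v + A x.

Let quotient_affine (h : V' -> R^o) x v :
  (fun t : R => t^-1 *: (((h \o A) \o shift x) (t *: v) - (h \o A) x)) =
  (fun t : R => t^-1 *: ((h \o shift (A x)) (t *: A0 v) - h (A x))).
Proof. by apply/funext => t /=; rewrite Aaff. Qed.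

Lemma derivable_affine (h : V' -> R^o) x v :
  derivable h (A x) (A0 v) -> derivable (h \o A) x v.
Proof. by rewrite /derivable quotient_affine. Qed.

Lemma derive_affine (h : V' -> R^o) x v :
  'D_v (h \o A) x = 'D_(A0 v) h (A x).
Proof. by rewrite /derive quotient_affine. Qed.

Lemma Ck_affine k (U : set V') (h : V' -> R^o) :
  Ck k U h -> Ck k (A @^-1` U) (h \o A).
Proof.
elim: k h => [|k ih] h [hc hd].
  by split=> // x Ux; apply: continuous_comp; [exact: Ac|exact: hc].
split=> [x Ux|v]; first by apply: continuous_comp; [exact: Ac|exact: hc].
have [h1 h2] := hd (A0 v); split=> [x Ux|].
  by apply: derivable_affine; exact: h1.
rewrite (_ : 'D_v _ = 'D_(A0 v) h \o A); first exact: ih.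
by apply/funext => x; rewrite derive_affine.
Qed.

End AffineChange.

Section Composition.
Context {R : realType} {V : normedModType R} {n : nat}.

Lemma continuous_row (phi : V -> 'rV[R]_n) x :
  (forall i, {for x, continuous (fun y => phi y ord0 i : R^o)}) ->
  {for x, continuous phi}.
Proof.
move=> hc; apply/cvgrPdist_le => e e0.
near=> y; apply: normr_row_le; first exact: ltW.
move=> i; rewrite !mxE; move: i; near: y; apply: filter_forall => i.
by have /cvgrPdist_le/(_ _ e0) := hc i.
Unshelve. all: by end_near. Qed.

Lemma is_derive_comp_row (phi : V -> 'rV[R]_n) (H : 'rV[R]_n -> R^o)
    (U' : set 'rV[R]_n) x v :
  open U' -> U' (phi x) -> Ck 1 U' H ->
  (forall i, derivable (fun y => phi y ord0 i : R^o) x v) ->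
  is_derive x v (H \o phi)
    (\sum_i partial i H (phi x) * 'D_v (fun y => phi y ord0 i : R^o) x).
Proof.
move=> oU' Ux HC hd; apply: is_derive_line0.
pose g (t : R) : 'rV[R]_n := phi (x + t *: v).
have g0 : g 0 = phi x by rewrite /g scale0r addr0.
have dgi i : is_derive (0 : R) (1 : R) (fun t => g t ord0 i : R^o)
    ('D_v (fun y => phi y ord0 i : R^o) x).
  have := @is_derive_line R V R^o (fun y => phi y ord0 i) x v 0.
  by rewrite scale0r addr0; apply; exact: hd.
have dg : derivable g 0 1.
  by apply/derivable_mxP => i j; rewrite (ord1 i); have [] := dgi j.
have Dg : differentiable g 0 by apply/derivable1_diffP.
have DH : differentiable H (g 0) by rewrite g0; exact: C1_differentiable HC Ux.
have DHg : differentiable (H \o g) 0 by exact: differentiable_comp.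
apply: DeriveDef; first exact: diff_derivable.
rewrite -[LHS]/('D_1 (H \o g) 0) deriveE// diff_comp//=.
rewrite -(deriveE _ Dg) derive_mx// [X in 'd H _ X]row_sum_ebasis linear_sum.
apply: eq_bigr => i _.
rewrite linearZ/= mxE (@derive_val _ _ _ _ _ _ _ (dgi i)) mulrC.
by rewrite /partial -g0 (deriveE _ DH).
Qed.

Lemma Ck_comp k (U : set V) (U' : set 'rV[R]_n) (phi : V -> 'rV[R]_n)
    (H : 'rV[R]_n -> R^o) :
  open U -> open U' -> (forall x, U x -> U' (phi x)) ->
  (forall i, Ck k U (fun x => phi x ord0 i)) -> Ck k U' H ->
  Ck k U (H \o phi).
Proof.
move=> oU oU' sub; elim: k H => [|k ih] H phik Hk.
  split=> // x Ux; apply: continuous_comp.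
    by apply: continuous_row => i; exact: Ck_continuous (phik i) Ux.
  by apply: Ck_continuous Hk _; exact: sub.
split=> [x Ux|v].
  apply: continuous_comp.
    by apply: continuous_row => i; exact: Ck_continuous (phik i) Ux.
  by apply: Ck_continuous Hk _; exact: sub.
have der x : U x -> is_derive x v (H \o phi)
    (\sum_i partial i H (phi x) * 'D_v (fun y => phi y ord0 i : R^o) x).
  move=> Ux; apply: is_derive_comp_row oU' (sub _ Ux) _ _; first exact: Ck_le Hk.
  by move=> i; exact: Ck_derivable (phik i) Ux.
split=> [x Ux|]; first by have [] := der x Ux.
apply: (Ck_eq oU (h := fun x =>
  \sum_i partial i H (phi x) * 'D_v (fun y => phi y ord0 i : R^o) x)).
  by move=> x; rewrite inE => /der[_ ->].
apply: Ck_sum => // i; apply: CkM => //.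
  apply: ih; first by move=> j; exact: Ck_pred.
  exact: Ck_derive.
exact: Ck_derive (phik i).
Qed.

End Composition.

(** * Second derivatives at a minimum *)

Section SecondDerivativeTest.
Context {R : realType}.

(** If [c] were negative, [dphi] would be negative just to the right of 0, and
    the mean value theorem would produce a value of [phi] below [phi 0]. *)
Lemma second_derivative_test (phi dphi : R -> R) (c : R) :
  (\forall s \near (0 : R), is_derive s (1 : R) phi (dphi s)) ->
  is_derive (0 : R) (1 : R) dphi c ->
  (\forall s \near (0 : R), phi 0 <= phi s) ->
  dphi 0 = 0 /\ 0 <= c.
Proof.
move=> hphi hdphi hmin.
have : \forall s \near (0 : R), is_derive s (1 : R) phi (dphi s) /\ phi 0 <= phi s.
  by near=> s; split; near: s.
move=> /nbhs_norm0P[e /= e0 he].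
have d0 : dphi 0 = 0.
  have [||||h1 h2] := @derive1_at_min R phi (- e) e 0.
  - by lra.
  - move=> t; rewrite in_itv/= => te.
    by have [|[]] := he t => //; rewrite /= ltr_norml.
  - by rewrite in_itv/=; lra.
  - move=> t; rewrite in_itv/= => te.
    by have [|_] := he t => //; rewrite /= ltr_norml.
  by have [|[_ <-]] := he 0 => //; rewrite /= normr0.
split=> //; rewrite leNgt; apply/negP => c0.
have [dd dE] := hdphi.
have : (fun t : R => t^-1 * dphi t) @ 0^' --> c.
  rewrite -dE; move: dd; rewrite /derivable /derive.
  rewrite (_ : (fun t : R => _) = (fun t => t^-1 * dphi t)) //.
  by apply/funext => t; rewrite /= d0 addr0 subr0 /GRing.scale/= mulr1.
move=> /cvgr_lt/(_ 0 c0).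
rewrite near_withinE => /nbhs_norm0P[e' /= e'0 he'].
pose s := minr e e' / 2.
have m0 : 0 < minr e e' by rewrite lt_min e0.
have s0 : 0 < s by rewrite divr_gt0.
have sm : s < minr e e' by rewrite /s; lra.
have se : s < e by apply: lt_le_trans sm _; rewrite ge_min lexx.
have se' : s < e' by apply: lt_le_trans sm _; rewrite ge_min lexx orbT.
have der t : 0 <= t <= s -> is_derive t (1 : R) phi (dphi t).
  by move=> ts; have [|] := he t => //; rewrite /= ltr_norml; lra.
have [||xi] := @MVT R phi dphi 0 s s0.
- by move=> t; rewrite in_itv/= => ts; apply: der; lra.
- apply: derivable_within_continuous => t; rewrite in_itv/= => ts.
  by have [] := der t ts.
rewrite in_itv/= subr0 => /andP[xi0 xis] e1.
have : phi s - phi 0 < 0.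
  rewrite e1 pmulr_llt0//.
  have := he' xi; rewrite pmulr_rlt0 ?invr_gt0//; apply.
    by rewrite /= ltr_norml; lra.
  by rewrite gt_eqF.
apply/negP; rewrite -leNgt subr_ge0.
by have [|_] := he s => //; rewrite /= ltr_norml; lra.
Unshelve. all: by end_near. Qed.

Context {V : normedModType R}.

Lemma near_line (P : set V) (x v : V) : nbhs x P ->
  \forall s \near (0 : R), P (x + s *: v).
Proof.
move=> Px; suff : (fun s : R => x + s *: v) @ (0 : R) --> x by exact.
rewrite -[X in _ --> X]addr0 -[X in _ + X](scale0r v).
apply: cvgD; first exact: cvg_cst.
by apply: cvgZr_tmp; exact: cvg_id.
Qed.

Lemma local_min_derive2 (U : set V) (h : V -> R^o) (x v : V) :
  open U -> Ck 2 U h -> U x -> (\forall y \near x, h x <= h y) ->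
  'D_v h x = 0 /\ 0 <= 'D_v ('D_v h) x.
Proof.
move=> oU hk Ux hmin.
have := @second_derivative_test (fun s : R => h (x + s *: v))
  (fun s : R => 'D_v h (x + s *: v)) ('D_v ('D_v h) x).
rewrite scale0r addr0; apply.
- have : \forall s \near (0 : R), U (x + s *: v).
    by apply: near_line; exact: open_nbhs_nbhs.
  apply: filterS => s Us; apply: (@is_derive_line R V R^o).
  exact: Ck_derivable hk Us.
- have := @is_derive_line R V R^o ('D_v h) x v 0.
  rewrite scale0r addr0; apply.
  exact: Ck_derivable (Ck_derive v hk) Ux.
- exact: near_line v hmin.
Qed.

End SecondDerivativeTest.

(** * Scalar products and chart coordinates *)

Section DotProduct.
Context {R : realType}.

Section Fixed.
Context {n : nat}.
Implicit Types u v w : 'rV[R]_n.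

Lemma dotpC u v : dotp u v = dotp v u.
Proof. by apply: eq_bigr => i _; rewrite mulrC. Qed.

Lemma dotpDl u v w : dotp (u + v) w = dotp u w + dotp v w.
Proof. by rewrite -big_split; apply: eq_bigr => i _; rewrite !mxE mulrDl. Qed.

Lemma dotpZl (a : R) u w : dotp (a *: u) w = a * dotp u w.
Proof. by rewrite mulr_sumr; apply: eq_bigr => i _; rewrite !mxE mulrA. Qed.

Lemma dotpNl u w : dotp (- u) w = - dotp u w.
Proof. by rewrite -scaleN1r dotpZl mulN1r. Qed.

Lemma dotpDr u v w : dotp w (u + v) = dotp w u + dotp w v.
Proof. by rewrite dotpC dotpDl !(dotpC w). Qed.

Lemma dotpZr (a : R) u w : dotp w (a *: u) = a * dotp w u.
Proof. by rewrite dotpC dotpZl dotpC. Qed.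

Lemma dotpNr u w : dotp w (- u) = - dotp w u.
Proof. by rewrite dotpC dotpNl dotpC. Qed.

Lemma dotp_sqrDZ u v (a : R) :
  dotp (u + a *: v) (u + a *: v) =
  dotp u u + 2 * a * dotp u v + a ^+ 2 * dotp v v.
Proof.
rewrite dotpDl !dotpDr !dotpZl !dotpZr (dotpC v u); ring.
Qed.

Lemma dotp_ge0 u : 0 <= dotp u u.
Proof. by apply: sumr_ge0 => i _; rewrite -expr2 sqr_ge0. Qed.

Lemma sqr_coord_le_dotp u i : u ord0 i ^+ 2 <= dotp u u.
Proof.
rewrite /dotp (bigD1 i)//= -expr2 lerDl.
by apply: sumr_ge0 => j _; rewrite -expr2 sqr_ge0.
Qed.

Lemma dotp_eq0 u : dotp u u = 0 -> u = 0.
Proof.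
move=> u0; apply/rowP => i; rewrite mxE; apply/eqP.
by rewrite -sqrf_eq0 eq_le sqr_ge0 -{1}u0 sqr_coord_le_dotp.
Qed.

Lemma sqr_norm_le_dotp u : `|u| ^+ 2 <= dotp u u.
Proof.
rewrite -[leRHS]sqr_sqrtr ?dotp_ge0// ler_pXn2r// ?nnegrE ?sqrtr_ge0//.
apply: normr_row_le; rewrite ?sqrtr_ge0// => i.
by rewrite -sqrtr_sqr ler_wsqrtr// sqr_coord_le_dotp.
Qed.

Lemma dotp_mulmx u v (F : 'M[R]_n) : F *m F^T = 1%:M ->
  dotp (u *m F) (v *m F) = dotp u v.
Proof.
move=> FF; have dE (a b : 'rV[R]_n) : dotp a b = (a *m b^T) ord0 ord0.
  by rewrite mxE; apply: eq_bigr => i _; rewrite mxE.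
by rewrite !dE trmx_mul -mulmxA (mulmxA F) FF mul1mx.
Qed.

End Fixed.

Lemma dotp_row_mx m (a b : R) (y z : 'rV[R]_m) :
  dotp (row_mx (a%:M : 'rV[R]_1) y : 'rV[R]_(1 + m))
    (row_mx (b%:M : 'rV[R]_1) z) = a * b + dotp y z.
Proof.
rewrite /dotp big_split_ord/= big_ord1 !row_mxEl !mxE; congr (_ + _).
by apply: eq_bigr => i _; rewrite !row_mxEr.
Qed.

End DotProduct.

Section ChartCoordinates.
Context {R : realType} {m : nat}.
Implicit Types (c : chart R m) (Om : set 'rV[R]_m.+1) (x : 'rV[R]_m.+1)
  (y : 'rV[R]_m).

(** The coordinates of [x] in the frame of [c]: [chart_height] is the one along
    which the boundary is a graph, [chart_base] holds the remaining ones. *)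
Definition chart_height c x : R := (x *m (frame c)^T) ord0 ord0.

Definition chart_base c x : 'rV[R]_m := rsubmx (x *m (frame c)^T : 'rV[R]_(1 + m)).

Lemma point_at_lin c (t r s : R) y z :
  point_at c (t * r + s) (t *: y + z) = t *: point_at c r y + point_at c s z.
Proof.
rewrite /point_at scalemxAl -mulmxDl; congr (_ *m _).
rewrite scale_row_mx add_row_mx; congr row_mx.
by apply/matrixP => i j; rewrite !ord1 !mxE.
Qed.

Lemma point_atB c (r s : R) y z :
  point_at c r y - point_at c s z = point_at c (r - s) (y - z).
Proof.
rewrite (_ : r - s = -1 * s + r); last by ring.
rewrite (_ : y - z = -1 *: z + y); last by rewrite scaleN1r addrC.
by rewrite point_at_lin scaleN1r addrC.
Qed.

Variable c : chart R m.
Hypothesis cF : frame c *m (frame c)^T = 1%:M.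

Lemma chart_coordK x : point_at c (chart_height c x) (chart_base c x) = x.
Proof.
have rowE : row_mx ((chart_height c x)%:M : 'rV[R]_1) (chart_base c x) =
    (x *m (frame c)^T : 'rV[R]_(1 + m)).
  rewrite -[RHS](@hsubmxK R 1 1 m); congr row_mx.
  apply/matrixP => i j; rewrite !ord1 !mxE eqxx mulr1n.
  rewrite /chart_height mxE.
  by apply: eq_bigr => k _; rewrite !mxE; congr (_ * frame c _ _); exact: val_inj.
by rewrite /point_at rowE -mulmxA (mulmx1C cF) mulmx1.
Qed.

Lemma point_at_row r y : point_at c r y *m (frame c)^T =
  (row_mx (r%:M : 'rV[R]_1) y : 'rV[R]_(1 + m)).
Proof. by rewrite /point_at -mulmxA cF mulmx1. Qed.

Lemma chart_base_point r y : chart_base c (point_at c r y) = y.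
Proof. by rewrite /chart_base point_at_row row_mxKr. Qed.

Lemma chart_height_point r y : chart_height c (point_at c r y) = r.
Proof.
rewrite /chart_height point_at_row.
have -> : ord0 = lshift m (ord0 : 'I_1) by apply: val_inj.
by rewrite (@row_mxEl R 1 1 m) mxE eqxx mulr1n.
Qed.

Lemma dotp_point_at r s y z :
  dotp (point_at c r y) (point_at c s z) = r * s + dotp y z.
Proof. by rewrite /point_at dotp_mulmx// dotp_row_mx. Qed.

Lemma continuous_mulmxr k (M : 'M[R]_(m.+1, k)) :
  continuous (fun x : 'rV[R]_m.+1 => x *m M).
Proof.
move=> x; apply: continuous_row => i.
have -> : (fun y : 'rV[R]_m.+1 => (y *m M) ord0 i : R^o) =
    (fun z => \sum_j z ord0 j * M j i) by apply/funext => z; rewrite mxE.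
apply: (@Ck_continuous R _ 0 setT) => //; apply: Ck_sum; first exact: openT.
by move=> j; apply: CkM; [exact: openT|exact: Ck_coord|exact: Ck_cst].
Qed.

Lemma continuous_chart_base : continuous (chart_base c).
Proof.
move=> x; apply: continuous_row => i.
have -> : (fun y : 'rV[R]_m.+1 => chart_base c y ord0 i : R^o) =
    (fun z : 'rV[R]_m.+1 => z ord0 (rshift 1 i) : R^o) \o
    (fun z => z *m (frame c)^T) by apply/funext => y; rewrite /chart_base mxE.
apply: continuous_comp; first exact: continuous_mulmxr.
exact: (@coord_continuous R 1 m.+1 ord0 (rshift 1 i)).
Qed.

Lemma continuous_chart_height : continuous (chart_height c : _ -> R^o).
Proof.
move=> x.
have -> : (chart_height c : _ -> R^o) = (fun z : 'rV[R]_m.+1 => z ord0 ord0 : R^o) \o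
    (fun z => z *m (frame c)^T) by [].
apply: continuous_comp; first exact: continuous_mulmxr.
exact: (@coord_continuous R 1 m.+1 ord0 ord0).
Qed.

End ChartCoordinates.

(** * Quadratic lower bounds *)

Section SecondOrder.
Context {R : realType} {n : nat}.
Implicit Types (h : 'rV[R]_n -> R^o).

Lemma is_derive_lincomb {V : normedModType R} (k : nat) (a : 'I_k -> R)
    (f : 'I_k -> V -> R^o) (x w : V) :
  (forall i, derivable (f i) x w) ->
  is_derive x w (fun z => \sum_i a i * f i z : R^o) (\sum_i a i * 'D_w (f i) x).
Proof.
move=> fd.
have := @is_derive_sum R V R^o k (fun i => a i \*: f i) x w
  (fun i => a i *: 'D_w (f i) x) (fun i => is_deriveZ _ (derivableP (fd i))).
by rewrite fct_sumE.
Qed.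

Lemma derive2_sum_partial (U : set 'rV[R]_n) h x v :
  open U -> Ck 2 U h -> U x ->
  'D_v ('D_v h) x =
  \sum_j \sum_i v ord0 i * v ord0 j * partial i (partial j h) x.
Proof.
move=> oU hk Ux.
have -> : 'D_v ('D_v h) x = 'D_v (fun z => \sum_j v ord0 j * partial j h z : R^o) x.
  apply: near_eq_derive; near=> z.
  apply: (derive_sum_partial v oU (Ck_pred hk)).
  by near: z; exact: open_nbhs_nbhs.
have dj j : derivable (partial j h) x v.
  exact: Ck_derivable (Ck_derive (ebasis j) hk) Ux.
rewrite (@derive_val _ _ _ _ _ _ _ (is_derive_lincomb _ dj)).
apply: eq_bigr => j _.
rewrite (derive_sum_partial v oU (Ck_derive (ebasis j) hk) Ux) mulr_sumr.
by apply: eq_bigr => i _; rewrite mulrA (mulrC (v ord0 j)).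
Unshelve. all: by end_near. Qed.

(** Taylor's formula with a locally uniform constant: near [y0] the second
    derivatives are at most their absolute values at [y0] plus 1. *)
Lemma quadratic_lower_bound h y0 : Ck 2 setT h ->
  exists A rho : R, [/\ 0 <= A, 0 < rho & forall y z,
    `|y - y0| < rho -> `|z - y0| < rho ->
    h y + 'D_(z - y) h y - A * dotp (z - y) (z - y) <= h z].
Proof.
move=> hk.
pose B i j : R := `|partial i (partial j h) y0| + 1.
have : \forall w \near y0, forall i j, `|partial i (partial j h) w| <= B i j.
  near=> w; move=> i; move: i; near: w; apply: filter_forall => i.
  near=> w; move=> j; move: j; near: w; apply: filter_forall => j.
  have := Ck_continuous (Ck_derive (ebasis i) (Ck_derive (ebasis j) hk)) (I : setT y0).
  move=> /cvgrPdist_le/(_ 1 ltr01); apply: filterS => w hw.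
  rewrite /B -lerBlDl; apply: le_trans (lerB_dist _ _) _.
  by rewrite distrC.
move=> /nbhs_ballP[rho /= rho0 hB].
exists (\sum_j \sum_i B i j), rho; split => //.
  by apply: sumr_ge0 => j _; apply: sumr_ge0 => i _; rewrite addr_ge0.
move=> y z yr zr.
have seg (s : R) : 0 <= s <= 1 -> `|y + s *: (z - y) - y0| < rho.
  move=> s01; rewrite (_ : _ - y0 = (1 - s) *: (y - y0) + s *: (z - y0)); last first.
    by apply/rowP => i; rewrite !mxE; ring.
  apply: le_lt_trans (ler_normD _ _) _; rewrite !normrZ.
  rewrite ger0_norm ?[`|s|]ger0_norm; [|lra|lra].
  have Mrho : maxr `|y - y0| `|z - y0| < rho by rewrite gt_max yr.
  apply: le_lt_trans Mrho; set M := maxr _ _.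
  have : `|y - y0| <= M by rewrite le_max lexx.
  have : `|z - y0| <= M by rewrite le_max lexx orbT.
  by move: (`|y - y0|) (`|z - y0|) => a b; nra.
have bnd (s : R) : 0 <= s <= 1 ->
    - ((\sum_j \sum_i B i j) * dotp (z - y) (z - y)) <=
    'D_(z - y) ('D_(z - y) h) (y + s *: (z - y)).
  move=> s01; rewrite (derive2_sum_partial _ openT hk)//.
  rewrite mulr_suml -sumrN; apply: ler_sum => j _.
  rewrite mulr_suml -sumrN; apply: ler_sum => i _.
  set v := z - y; apply: lerNnormlW; rewrite normrM mulrC.
  apply: ler_pM => //.
    by apply: hB; rewrite -ball_normE /= distrC seg.
  rewrite normrM.
  have := sqr_coord_le_dotp v i; have := sqr_coord_le_dotp v j.
  rewrite -(real_normK (num_real (v ord0 i))) -(real_normK (num_real (v ord0 j))).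
  have := normr_ge0 (v ord0 i); have := normr_ge0 (v ord0 j); nra.
set v := z - y in seg bnd *.
have vz : y + v = z by rewrite /v addrC subrK.
have [|c c01] := @mean_value_line R _ h y v.
  by move=> s _; exact: Ck_derivable hk I.
rewrite vz => e1.
have dc (s : R) : is_derive (y + s *: (c *: v)) (c *: v) ('D_v h)
    (c * 'D_v ('D_v h) (y + s *: (c *: v))).
  by apply: is_derive_scale_dir; exact: Ck_derivable (Ck_derive v hk) I.
have [|s s01] := @mean_value_line R _ ('D_v h) y (c *: v).
  by move=> s _; have [] := dc s.
rewrite (@derive_val _ _ _ _ _ _ _ (dc s)) scalerA => e2.
have sc01 : 0 <= s * c <= 1.
  by apply/andP; split; [rewrite mulr_ge0//; lra|rewrite mulr_ile1//; lra].
have := bnd _ sc01.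
have A0 : 0 <= (\sum_j \sum_i B i j) * dotp v v.
  rewrite mulr_ge0 ?dotp_ge0//.
  by apply: sumr_ge0 => j _; apply: sumr_ge0 => i _; rewrite addr_ge0.
move: e1 e2 A0; set a := (\sum_j _) * _; set b := 'D_v ('D_v h) _ => e1 e2 A0 ab.
have : - a <= c * b by nra.
lra.
Unshelve. all: by end_near. Qed.

End SecondOrder.

(** * The boundary inside a chart *)

Section BoundaryInChart.
Context {R : realType} {m : nat} (Om : set 'rV[R]_m.+1) (c : chart R m).
Hypotheses (oOm : open Om) (hc : is_chart Om c).
Implicit Types (x : 'rV[R]_m.+1) (y : 'rV[R]_m).

Let cF : frame c *m (frame c)^T = 1%:M. Proof. by case: hc. Qed.
Let odom : open (dom c). Proof. by case: hc. Qed.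

Lemma continuous_chart_graph :
  continuous (fun x => chart_height c x - height c (chart_base c x) : R^o).
Proof.
move=> x; apply: continuousB; first exact: continuous_chart_height.
apply: (@continuous_comp _ _ _ (chart_base c) (height c)).
  exact: continuous_chart_base.
by case: hc => _ _ /(_ 0%N) /Ck_continuous hh _; exact: hh.
Qed.

Lemma in_domain_chart x : dom c x ->
  Om x <-> height c (chart_base c x) < chart_height c x.
Proof.
move=> cx; rewrite -{1}(chart_coordK cF x).
by case: hc => _ _ _; apply; rewrite chart_coordK.
Qed.

Lemma boundary_not_domain x : boundary Om x -> ~ Om x.
Proof. by move=> [_ nx] Ox; apply: nx; rewrite (interior_id _).1. Qed.

(** Below the graph there is a neighbourhood free of points of the domain; on
    the graph, moving upwards enters the domain at once. *)
Lemma boundary_chartP x : dom c x ->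
  boundary Om x <-> chart_height c x = height c (chart_base c x).
Proof.
move=> cx; split.
  move=> bx; have /(in_domain_chart cx) nOx := boundary_not_domain bx.
  apply/eqP; rewrite eq_le; apply/andP; split; first by rewrite leNgt; apply/negP.
  rewrite leNgt; apply/negP => lt.
  have : nbhs x (fun z => dom c z /\ chart_height c z - height c (chart_base c z) < 0).
    near=> z; split; first by near: z; exact: open_nbhs_nbhs.
    near: z; have := @continuous_chart_graph x.
    by move=> /cvgr_lt; apply; rewrite subr_lt0.
  have [cl _] := bx.
  move=> /cl[z [Oz [cz]]]; rewrite subr_lt0 => zlt.
  by have /(in_domain_chart cz) := Oz; rewrite ltNge (ltW zlt).
move=> e; split; last first.
  by move=> /interior_subset /(in_domain_chart cx); rewrite e ltxx.
move=> B Bx.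
have nx : nbhs x (fun z => dom c z /\ B z).
  by near=> z; split; near: z => //; exact: open_nbhs_nbhs.
have /nbhs_norm0P[d /= d0 hd] := near_line (point_at c 1 0) nx.
have [|cz Bz] := hd (d / 2).
  by rewrite /= gtr0_norm; lra.
exists (x + (d / 2) *: point_at c 1 0); split => //.
apply/(in_domain_chart cz).
rewrite -[in X in _ < X](chart_coordK cF x) -[in X in X < _](chart_coordK cF x).
rewrite addrC -point_at_lin chart_base_point// chart_height_point//.
by rewrite scaler0 add0r mulr1 -e ltrDr divr_gt0.
Unshelve. all: by end_near. Qed.

Lemma param_chart_base x : boundary Om x -> dom c x ->
  param c (chart_base c x) = x.
Proof.
move=> bx cx; rewrite /param -((boundary_chartP cx).1 bx).
exact: chart_coordK.
Qed.

Lemma boundary_param y : chart_params c y -> boundary Om (param c y).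
Proof.
move=> cy; apply/(boundary_chartP cy).
by rewrite /param chart_height_point// chart_base_point.
Qed.

End BoundaryInChart.

Section Normal.
Context {R : realType} {m : nat}.
Implicit Types (c : chart R m).

Definition height_grad c (y : 'rV[R]_m) : 'rV[R]_m :=
  \row_(i < m) partial i (height c) y.

Definition grad_factor c (y : 'rV[R]_m) : R :=
  Num.sqrt (1 + dotp (height_grad c y) (height_grad c y)).

Lemma grad_factor_ge1 c y : 1 <= grad_factor c y.
Proof. by rewrite -{1}sqrtr1 ler_wsqrtr// lerDl dotp_ge0. Qed.

Lemma grad_factor_gt0 c y : 0 < grad_factor c y.
Proof. exact: lt_le_trans (grad_factor_ge1 c y). Qed.

Lemma sqr_grad_factor c y :
  grad_factor c y ^+ 2 = 1 + dotp (height_grad c y) (height_grad c y).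
Proof. by rewrite sqr_sqrtr// addr_ge0// dotp_ge0. Qed.

Lemma normalE c y : normal c y =
  (grad_factor c y)^-1 *: point_at c (-1) (height_grad c y).
Proof. by []. Qed.

Lemma derive_height_grad (c : chart R m) y v :
  Cinfty setT (height c) -> 'D_v (height c) y = dotp v (height_grad c y).
Proof.
move=> hh; rewrite (@derive_sum_partial R m setT _ y v openT (hh 1%N))//.
by apply: eq_bigr => i _; rewrite mxE.
Qed.

Variable c : chart R m.
Hypothesis cF : frame c *m (frame c)^T = 1%:M.

Lemma dotp_normal y : dotp (normal c y) (normal c y) = 1.
Proof.
rewrite normalE dotpZl dotpZr dotp_point_at// mulrA -expr2 exprVn.
rewrite sqr_grad_factor mulrNN mulr1 mulVf// gt_eqF// ltr_pwDl//.
exact: dotp_ge0.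
Qed.

Lemma dotp_diff_normal (r : R) (z y : 'rV[R]_m) :
  dotp (point_at c r z - param c y) (normal c y) =
  (grad_factor c y)^-1 *
  (height c y - r + dotp (z - y) (height_grad c y)).
Proof.
rewrite normalE dotpZr /param point_atB dotp_point_at//; congr (_ * (_ + _)).
by rewrite mulrN1 opprB.
Qed.

Lemma sqr_le_dotp_point_at (r s : R) (y z : 'rV[R]_m) :
  dotp (y - z) (y - z) <=
  dotp (point_at c r y - point_at c s z) (point_at c r y - point_at c s z).
Proof. by rewrite point_atB dotp_point_at// lerDr -expr2 sqr_ge0. Qed.

End Normal.

(** * Exterior balls and the normal derivative *)

Section ExteriorBall.
Context {R : realType} {m : nat} (Om : set 'rV[R]_m.+1).
Implicit Types (c : chart R m) (x z : 'rV[R]_m.+1).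

(** The centre lies on the outer normal at [x], so that the normal derivative at
    [x] of a function of the distance to the centre is explicit. *)
Definition exterior_ball c x (r : R) : Prop :=
  let ctr := x + r *: normal c (chart_base c x) in
  forall z, Om z -> r ^+ 2 <= dotp (z - ctr) (z - ctr).

(** By the quadratic lower bound for the height function, the points x + w of
    the domain near [x] satisfy w.nu <= A |w|^2 for the outer normal nu, that
    is, they lie outside a ball of radius 1/(2A) touching at [x].  Points of the
    domain far from [x] are outside the ball because its radius is small against
    the size of the chart. *)
Lemma exterior_ball_locally c xb :
  open Om -> is_chart Om c -> dom c xb ->
  exists2 e : R, 0 < e & forall x r, `|x - xb| < e -> 0 < r <= e ->
    boundary Om x -> dom c x /\ exterior_ball c x r.
Proof.
move=> oOm hc cxb; have [odom cF hh _] := hc.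
have [A [rho [A0 rho0 hA]]] := quadratic_lower_bound (chart_base c xb) (hh 2%N).
have : \forall x \near xb, dom c x /\ `|chart_base c x - chart_base c xb| < rho.
  near=> x; split; first by near: x; exact: open_nbhs_nbhs.
  near: x; have /cvgrPdist_lt/(_ _ rho0) := @continuous_chart_base R m c xb.
  by apply: filterS => x; rewrite distrC.
move=> /nbhs_ballP[e1 /= e10 he1].
have near1 x : `|x - xb| < e1 ->
    dom c x /\ `|chart_base c x - chart_base c xb| < rho.
  by move=> xe; apply: he1; rewrite -ball_normE /= distrC.
(* A quarter of e1 keeps far points out of the ball; the other bound gives
   2 A r <= 1, as needed for the near ones. *)
pose e := minr (e1 / 4) ((2 * A + 1)^-1).
have A1 : 0 < 2 * A + 1 by lra.
have e0 : 0 < e by rewrite lt_min divr_gt0// invr_gt0.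
have ee1 : e <= e1 / 4 by rewrite ge_min lexx.
have eA : e * (2 * A + 1) <= 1.
  by rewrite -ler_pdivlMr// mul1r ge_min lexx orbT.
exists e => // x r xe /andP[r0 re] bx.
have [cx xrho] : dom c x /\ `|chart_base c x - chart_base c xb| < rho.
  by apply: near1; apply: lt_trans xe _; lra.
split => //; rewrite /exterior_ball /= => z Oz; set nu := normal c _; set w := z - x.
have -> : z - (x + r *: nu) = w + (- r) *: nu by rewrite scaleNr opprD addrA.
have nn : dotp nu nu = 1 by exact: dotp_normal.
rewrite dotp_sqrDZ nn.
have [zx|zx] := ltP `|z - x| (e1 / 2).
  have [cz zrho] : dom c z /\ `|chart_base c z - chart_base c xb| < rho.
    apply: near1; rewrite (_ : z - xb = (z - x) + (x - xb)); last first.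
      by rewrite addrA subrK.
    by apply: le_lt_trans (ler_normD _ _) _; lra.
  have hz := (in_domain_chart hc cz).1 Oz.
  have ex := param_chart_base oOm hc bx cx.
  have wnu : dotp w nu <= A * dotp w w.
    rewrite /w -[in X in dotp X nu](chart_coordK cF z) -[in X in dotp X nu]ex.
    rewrite dotp_diff_normal//.
    have := hA _ _ xrho zrho; rewrite derive_height_grad//.
    set q := dotp (_ - _) (_ - _) => hq.
    have qw : q <= dotp w w.
      rewrite /w -[z](chart_coordK cF z) -[in X in _ <= X]ex.
      exact: sqr_le_dotp_point_at.
    have N1 := grad_factor_ge1 c (chart_base c x).
    have N0 := grad_factor_gt0 c (chart_base c x).
    rewrite -/w mulrC ler_pdivrMr//.
    have q0 : 0 <= q by exact: dotp_ge0.
    have AqD := ler_wpM2l A0 qw.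
    have := ler_peMr (mulr_ge0 A0 (dotp_ge0 w)) N1.
    lra.
  have D0 := dotp_ge0 w.
  move: (dotp w nu) (dotp w w) wnu D0 => a D aD D0.
  have : r * (2 * A) <= 1 by nra.
  by nra.
have wD : (e1 / 2) ^+ 2 <= dotp w w.
  apply: le_trans (sqr_norm_le_dotp w).
  by rewrite ler_pXn2r// nnegrE//; lra.
have := dotp_ge0 (w + (- (2 * r)) *: nu).
rewrite dotp_sqrDZ nn.
move: (dotp w nu) (dotp w w) wD => a D; nra.
Unshelve. all: by end_near. Qed.

Lemma compact_closure : bounded_set Om -> compact (closure Om).
Proof.
move=> bOm; apply: bounded_closed_compact; last exact: closed_closure.
have [M [Mr hM]] := bOm; exists (M + 1); split; first by rewrite realD.
move=> k Mk x cl /=.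
rewrite leNgt; apply/negP => kx.
have : nbhs x (fun z : 'rV[R]_m.+1 => k < `|z|).
  by have /cvgr_gt/(_ k kx) := @norm_continuous R 'rV[R]_m.+1 x.
move=> /cl[z [Oz]]; apply/negP; rewrite -leNgt.
by apply: hM => //; apply: lt_trans Mk; rewrite ltrDl.
Qed.

Lemma compact_boundary : open Om -> bounded_set Om -> compact (boundary Om).
Proof.
move=> oOm /compact_closure cpt; apply: subclosed_compact cpt _; last by move=> x [].
rewrite /boundary setDE; apply: closedI; first exact: closed_closure.
exact/open_closedC/open_interior.
Qed.

Lemma exterior_ball_uniform : bounded_smooth_domain Om ->
  exists2 r : R, 0 < r & forall x, boundary Om x ->
    exists c, [/\ is_chart Om c, dom c x & exterior_ball c x r].
Proof.
move=> [oOm _ _ bOm charts].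
have /compact_near_coveringP cov := compact_boundary oOm bOm.
have : \forall r \near (0 : R)^'+, boundary Om `<=` (fun x => boundary Om x ->
    exists c, [/\ is_chart Om c, dom c x & exterior_ball c x r]).
  apply: (cov R (0 : R)^'+ (fun r x => boundary Om x ->
    exists c, [/\ is_chart Om c, dom c x & exterior_ball c x r])).
  move=> xb bxb; have [c hc cxb] := charts _ bxb.
  have [e e0 he] := exterior_ball_locally oOm hc cxb.
  near=> x r => bx; exists c.
  have [||cx ebx] := he x r _ _ bx; last by split.
    near: x; have := @nbhsx_ballx _ 'rV[R]_m.+1 xb e e0.
    by apply: filterS => x; rewrite -ball_normE /= distrC.
  by apply/andP; split; near: r; [exact: nbhs_right_gt|exact: nbhs_right_le].
move=> hr; near (0 : R)^'+ => r; exists r => // x bx.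
have hr' : boundary Om `<=` (fun x => boundary Om x ->
    exists c, [/\ is_chart Om c, dom c x & exterior_ball c x r]).
  by near: r.
exact: hr'.
Unshelve. all: by end_near. Qed.

End ExteriorBall.

Section NormalDerivative.
Context {R : realType} {m : nat} (Om : set 'rV[R]_m.+1) (c : chart R m).
Hypotheses (oOm : open Om) (hc : is_chart Om c).

Lemma lt_right_of_derive_lt0 (phi : R -> R) (a : R) :
  is_derive (0 : R) (1 : R) phi a -> a < 0 ->
  \forall t \near (0 : R)^'+, phi t < phi 0.
Proof.
move=> [dd dE] a0.
have : (fun t : R => t^-1 * (phi t - phi 0)) @ 0^'+ --> a.
  rewrite -dE; apply: cvg_dnbhs_at_right.
  move: dd; rewrite /derivable /derive.
  have -> : (fun t : R => t^-1 *: ((phi \o shift 0) t%:A - phi 0)) =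
      (fun t => t^-1 * (phi t - phi 0)) by
    apply/funext => t; rewrite /= addr0 /GRing.scale/= mulr1.
  exact.
move=> /cvgr_lt/(_ 0 a0) h; near=> t.
have t0 : 0 < t by near: t; exact: nbhs_right_gt.
have : t^-1 * (phi t - phi 0) < 0 by near: t.
by rewrite pmulr_rlt0 ?invr_gt0// subr_lt0.
Unshelve. all: by end_near. Qed.

Lemma inward_points_in_domain y : chart_params c y ->
  \forall h \near (0 : R)^'+, Om (param c y - h *: normal c y).
Proof.
have [odom cF hh _] := hc => cy.
pose N := grad_factor c y; have N0 : 0 < N by exact: grad_factor_gt0.
pose v : 'rV[R]_m := - (N^-1 *: height_grad c y).
have ptE h : param c y - h *: normal c y =
    point_at c (height c y + h * N^-1) (y + h *: v).
  rewrite normalE scalerA -scaleNr addrC /param -point_at_lin -/N /v.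
  by congr point_at; [ring|rewrite scalerN addrC scaleNr scalerA].
pose phi (t : R) := height c (y + t *: v) - t * N^-1.
have dphi : is_derive (0 : R) (1 : R) phi (dotp v (height_grad c y) - N^-1).
  have d1 : is_derive (0 : R) (1 : R) (fun t : R => height c (y + t *: v) : R)
      (dotp v (height_grad c y)).
    rewrite -derive_height_grad//.
    have := @is_derive_line R _ R^o (height c) y v 0.
    rewrite scale0r addr0; apply; exact: Ck_derivable (hh 1%N) I.
  have d2 : is_derive (0 : R) (1 : R) (fun t : R => t * N^-1) (N^-1).
    have := @is_deriveZ R R R id N^-1 0 1 1 (is_derive_id _ _).
    rewrite [X in is_derive _ _ _ X]mulr1.
    have -> // : (fun t : R => t * N^-1) = N^-1 \*: id.
    by apply/funext => t; rewrite mulrC.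
  exact: is_deriveB.
have neg : dotp v (height_grad c y) - N^-1 < 0.
  rewrite /v dotpNl dotpZl; have := invr_gt0 N; rewrite N0 => Ni.
  have := dotp_ge0 (height_grad c y); nra.
have nd := near_line (- normal c y) (open_nbhs_nbhs (conj odom cy)).
have nd' : \forall h \near (0 : R)^'+, dom c (param c y + h *: - normal c y).
  exact: cvg_at_right_filter nd.
near=> h.
have ch : dom c (param c y - h *: normal c y).
  by rewrite -scalerN; near: h.
apply/(in_domain_chart hc ch); rewrite ptE chart_base_point// chart_height_point//.
have : phi h < phi 0 by near: h; exact: lt_right_of_derive_lt0 dphi neg.
by rewrite /phi scale0r addr0 mul0r; lra.
Unshelve. all: by end_near. Qed.

(** [b] lies below [w] and touches it at the boundary point, so its inward
    quotients are smaller there.  The limit defining [normal_derivative] exists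
    because [w] is the restriction of the C^1 function [w'] to the closure. *)
Lemma normal_derivative_le (U : set 'rV[R]_m.+1)
    (w w' b : 'rV[R]_m.+1 -> R^o) (y : 'rV[R]_m) (db : R) :
  chart_params c y -> open U -> U (param c y) -> Ck 1 U w' ->
  (forall z, U z -> closure Om z -> w z = w' z) ->
  is_derive (param c y) (- normal c y) b db ->
  b (param c y) = w (param c y) -> (forall z, Om z -> b z <= w z) ->
  normal_derivative c w y <= - db.
Proof.
move=> cy oU Ux w'k ww' hb bx bw; set x := param c y in Ux hb bx *.
have clx : closure Om x by have [] := boundary_param oOm hc cy.
have dw' : is_derive x (- normal c y) w' ('D_(- normal c y) w' x).
  by apply: derivableP; exact: Ck_derivable w'k Ux.
have quot (f : 'rV[R]_m.+1 -> R^o) df : is_derive x (- normal c y) f df ->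
    (fun h : R => h^-1 * (f x - f (x - h *: normal c y)) : R^o) @ 0^'+ --> - df.
  move=> [fd <-]; apply: cvg_dnbhs_at_right.
  have /(_ _) := @cvgN _ _ _ _ _ _ _ fd.
  have -> : - (fun h : R => h^-1 *: ((f \o shift x) (h *: - normal c y) - f x)) =
      (fun h : R => h^-1 * (f x - f (x - h *: normal c y))).
    apply/funext => h; rewrite fctE /= -[LHS]scalerN opprB; congr (_ * (_ - f _)).
    by rewrite scalerN addrC.
  by apply.
have cvgw : (fun h : R => h^-1 * (w x - w (x - h *: normal c y)) : R^o) @ 0^'+ -->
    - 'D_(- normal c y) w' x.
  apply: cvg_trans (quot _ _ dw'); apply: near_eq_cvg.
  have nU := near_line (- normal c y) (open_nbhs_nbhs (conj oU Ux)).
  have nU' : \forall h \near (0 : R)^'+, U (x + h *: - normal c y).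
    exact: cvg_at_right_filter nU.
  near=> h.
  have Oh : Om (x - h *: normal c y).
    by near: h; exact: inward_points_in_domain.
  rewrite ww'// [in RHS]ww'//; last exact: subset_closure.
  by rewrite -scalerN; near: h.
rewrite /normal_derivative -/x (cvg_lim _ cvgw)//.
apply: ler_cvg_to cvgw (quot _ _ hb) _.
near=> h.
have h0 : 0 < h by near: h; exact: nbhs_right_gt.
rewrite ler_pM2l ?invr_gt0// bx lerD2l lerN2 bw//.
by near: h; exact: inward_points_in_domain.
Unshelve. all: by end_near. Qed.

End NormalDerivative.

(** * The Laplace-Beltrami operator at a minimum *)

Section CkMatrix.
Context {R : realType} {V : normedModType R}.

Lemma Ck_det k (U : set V) n (A : V -> 'M[R]_n) :
  open U -> (forall i j, Ck k U (fun z => A z i j : R^o)) ->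
  Ck k U (fun z => \det (A z) : R^o).
Proof.
move=> oU hA; rewrite /determinant; apply: Ck_sum => // s.
by apply: CkM => //; [exact: Ck_cst|exact: Ck_prod].
Qed.

Lemma Ck_adj k (U : set V) n (A : V -> 'M[R]_n) :
  open U -> (forall i j, Ck k U (fun z => A z i j : R^o)) ->
  forall i j, Ck k U (fun z => (\adj (A z)) i j : R^o).
Proof.
move=> oU hA i j.
have -> : (fun z => (\adj (A z)) i j : R^o) =
   (fun z => (-1) ^+ (j + i) * \det (row' j (col' i (A z)))).
  by apply/funext => z; rewrite mxE.
apply: CkM => //; first exact: Ck_cst.
apply: Ck_det => // a b.
have -> : (fun z => row' j (col' i (A z)) a b : R^o) =
  (fun z => A z (lift j a) (lift i b)) by apply/funext => z; rewrite !mxE.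
exact: hA.
Qed.

(** A product rule that asks only for continuity of the first factor.  At a
    critical point it gives the derivative of the flux in the Laplace-Beltrami
    operator without differentiating the volume factor. *)
Lemma is_derive_mul_vanishing (a b : V -> R^o) (y e : V) :
  {for y, continuous a} -> derivable b y e -> b y = 0 ->
  is_derive y e (fun z => a z * b z : R^o) (a y * 'D_e b y).
Proof.
move=> ac bd b0.
have ca : (fun h : R => a (y + h *: e)) @ 0^' --> a y.
  by move=> P /ac /(near_line e) h; exact: nbhs_dnbhs.
have /(_ _) cab := @cvgM R _ _ _ _ _ _ _ ca bd.
have quot : (fun h : R =>
    h^-1 *: (((fun z => a z * b z : R^o) \o shift y) (h *: e) - a y * b y)) =
  (fun h : R => a (y + h *: e)) * (fun h : R => h^-1 *: ((b \o shift y) (h *: e) - b y)).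
  apply/funext => h.
  rewrite -[RHS]/(a (y + h *: e) * (h^-1 * (b (h *: e + y) - b y))).
  rewrite -[LHS]/(h^-1 * (a (h *: e + y) * b (h *: e + y) - a y * b y)).
  by rewrite b0 mulr0 !subr0 (addrC y) mulrCA.
by apply: DeriveDef; rewrite /derivable /derive /= quot;
  [apply/cvg_ex; eexists; exact: cab|exact: cvg_lim cab].
Qed.

End CkMatrix.

Section RankOneMetric.
Context {R : realType} {n : nat}.
Implicit Types (g : 'rV[R]_n) (H : 'M[R]_n).

Lemma rank_one_metric_unit g : 1%:M + g^T *m g \in unitmx.
Proof.
rewrite unitmxE unitfE; apply/det0P => -[v v0 hv].
have : dotp v v + (dotp v g) ^+ 2 = 0.
  have := congr1 (fun A => (A *m v^T) ord0 ord0) hv.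
  rewrite /= mul0mx [X in _ = X]mxE mulmxDr mulmx1 mulmxA mulmxDl => <-.
  rewrite [RHS]mxE; congr (_ + _).
    by rewrite mxE; apply: eq_bigr => i _; rewrite mxE.
  rewrite -mulmxA mxE big_ord1 expr2; congr (_ * _).
    by rewrite mxE; apply: eq_bigr => i _; rewrite mxE.
  by rewrite mxE; apply: eq_bigr => i _; rewrite mxE mulrC.
move=> e; move/eqP: v0; apply; apply: dotp_eq0.
by have := dotp_ge0 v; have := sqr_ge0 (dotp v g); lra.
Qed.

(** [B], the inverse of the metric [G], satisfies B = B G B = B B + v^T v for
    the row v = g B, so it is a sum of squares of row vectors and its trace
    against a positive semidefinite [H] is a sum of nonnegative terms. *)
Lemma rank_one_metric_trace_ge0 g H :
  (forall v : 'rV[R]_n, 0 <= \sum_j \sum_i v ord0 i * v ord0 j * H i j) ->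
  0 <= \sum_i \sum_j invmx (1%:M + g^T *m g) i j * H i j.
Proof.
move=> Hpsd; set G := _ + _; set B := invmx G.
have GU : G \in unitmx := rank_one_metric_unit g.
have Gs : G^T = G by rewrite /G linearD /= trmx1 trmx_mul trmxK.
have Bs : B^T = B by rewrite /B trmx_inv Gs.
pose v := g *m B.
have BE : B = B *m B + v^T *m v.
  have -> : v^T = B *m g^T by rewrite trmx_mul Bs.
  have BGB : B *m G *m B = B by rewrite mulVmx// mul1mx.
  by rewrite -[LHS]BGB /G /v mulmxDr mulmx1 mulmxDl !mulmxA.
have Bij i j : B i j = \sum_k row k B ord0 i * row k B ord0 j + v ord0 i * v ord0 j.
  rewrite {1}BE mxE; congr (_ + _).
    rewrite mxE; apply: eq_bigr => k _; rewrite !mxE -{1}Bs mxE //.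
  by rewrite mxE big_ord1 !mxE.
have -> : \sum_i \sum_j B i j * H i j =
   \sum_k \sum_j \sum_i row k B ord0 i * row k B ord0 j * H i j +
   \sum_j \sum_i v ord0 i * v ord0 j * H i j.
  rewrite exchange_big [X in _ = X + _]exchange_big -big_split.
  apply: eq_bigr => j _; rewrite exchange_big -big_split.
  apply: eq_bigr => i _; rewrite Bij mulrDl mulr_suml //.
rewrite addr_ge0//; apply: sumr_ge0 => k _; exact: Hpsd.
Qed.

End RankOneMetric.

Section LaplaceBeltrami.
Context {R : realType} {m : nat} (c : chart R m).
Hypotheses (cF : frame c *m (frame c)^T = 1%:M) (hh : Cinfty setT (height c)).
Implicit Types (y z v : 'rV[R]_m).

Lemma point_at_split r y : point_at c r y = r *: point_at c 1 0 + point_at c 0 y.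
Proof. by rewrite -point_at_lin mulr1 addr0 scaler0 add0r. Qed.

Lemma point_atZ (t r : R) y : point_at c (t * r) (t *: y) = t *: point_at c r y.
Proof.
have p0 : point_at c 0 0 = 0.
  by rewrite /point_at raddf0 row_mx0 mul0mx.
by rewrite -[t * r]addr0 -[t *: y]addr0 point_at_lin p0 addr0.
Qed.

Lemma is_derive_param y v :
  is_derive y v (param c) (point_at c ('D_v (height c) y) v).
Proof.
have hd : derivable (height c) y v by exact: Ck_derivable (hh 1%N) I.
have cvgq : (fun h : R => h^-1 *: ((param c \o shift y) (h *: v) - param c y)) @ 0^'
    --> point_at c ('D_v (height c) y) v.
  rewrite point_at_split.
  have /(_ _ _ _) := cvgD (cvgZr_tmp (a := point_at c 1 0) hd) (cvg_cst (point_at c 0 v)).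
  apply: cvg_trans; apply: near_eq_cvg; near=> h.
  have h0 : h != 0 by near: h; exact: nbhs_dnbhs_neq.
  set dh := height c (h *: v + y) - height c y.
  rewrite -[LHS]/((h^-1 * dh) *: point_at c 1 0 + point_at c 0 v) -point_at_split.
  rewrite -[RHS]/(h^-1 *: (param c (h *: v + y) - param c y)).
  by rewrite /param point_atB addrK -point_atZ scalerA mulVf// scale1r.
by apply: DeriveDef; [apply/cvg_ex; eexists; exact: cvgq|exact: cvg_lim cvgq].
Unshelve. all: by end_near. Qed.

Lemma metricE y : metric c y = 1%:M + (height_grad c y)^T *m height_grad c y.
Proof.
apply/matrixP => i j; rewrite !mxE big_ord1 !mxE.
rewrite /partial !(@derive_val _ _ _ _ _ _ _ (is_derive_param _ _)).
rewrite dotp_point_at// addrC; congr (_ + _).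
rewrite /dotp (bigD1 i)//= big1 ?addr0; last first.
  by move=> k ki; rewrite !mxE eqxx (negPf ki) /= mul0r.
by rewrite !mxE !eqxx /= mul1r eq_sym.
Qed.

Lemma Ck_metric k i j : Ck k setT (fun z => metric c z i j : R^o).
Proof.
have -> : (fun z => metric c z i j : R^o) =
    (fun z => (i == j)%:R + partial i (height c) z * partial j (height c) z).
  by apply/funext => z; rewrite metricE !mxE big_ord1 !mxE.
apply: CkD; [exact: openT|exact: Ck_cst|].
by apply: CkM; [exact: openT| |]; exact: Ck_derive (hh k.+1).
Qed.

Lemma Ck_invmx_metric k i j : Ck k setT (fun z => invmx (metric c z) i j : R^o).
Proof.
have -> : (fun z => invmx (metric c z) i j : R^o) =
    (fun z => (\det (metric c z))^-1 * (\adj (metric c z)) i j).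
  apply/funext => z; rewrite /invmx metricE rank_one_metric_unit.
  by rewrite mxE.
apply: CkM; [exact: openT| |].
  apply: CkV; [exact: openT| |apply: Ck_det; [exact: openT|]; exact: Ck_metric].
  by move=> z _; rewrite -unitfE -unitmxE metricE rank_one_metric_unit.
by apply: Ck_adj; [exact: openT|exact: Ck_metric].
Qed.

Lemma continuous_volume :
  continuous (fun z => Num.sqrt (\det (metric c z)) : R^o).
Proof.
move=> z; apply: (@continuous_comp _ _ _ (fun z => \det (metric c z) : R)).
  apply: (@Ck_continuous R _ 0 setT) => //.
  by apply: Ck_det; [exact: openT|exact: Ck_metric].
exact: sqrt_continuous.
Qed.

(** At a minimum the first derivatives of [w] in the chart vanish, so only the
    second derivatives, contracted with the inverse metric, survive. *)
Lemma laplace_beltrami_ge0 (w : 'rV[R]_m.+1 -> R^o) (U : set 'rV[R]_m) y :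
  open U -> U y -> Ck 2 U (w \o param c) ->
  (\forall z \near y, w (param c y) <= w (param c z)) ->
  0 <= laplace_beltrami c w y.
Proof.
move=> oU Uy wk ymin.
pose v := w \o param c.
have crit e : 'D_e v y = 0 /\ 0 <= 'D_e ('D_e v) y.
  exact: local_min_derive2 oU wk Uy ymin.
pose vol z := Num.sqrt (\det (metric c z)).
have der i : is_derive y (ebasis i) (fun z =>
    \sum_(j < m) (vol z * invmx (metric c z) i j * partial j v z : R^o) : R^o)
    (\sum_(j < m) vol y * invmx (metric c y) i j * partial i (partial j v) y).
  have dj j : is_derive y (ebasis i) (fun z =>
      (vol z * invmx (metric c z) i j * partial j v z : R^o))
      (vol y * invmx (metric c y) i j * partial i (partial j v) y).
    apply: (@is_derive_mul_vanishing R _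
      (fun z => vol z * invmx (metric c z) i j : R^o) (partial j v)).
    - apply: (@continuousM R _ vol (fun z => invmx (metric c z) i j)).
        exact: continuous_volume.
      by apply: (@Ck_continuous R _ 0 setT) => //; exact: Ck_invmx_metric.
    - exact: Ck_derivable (Ck_derive (ebasis j) wk) Uy.
    - by have [] := crit (ebasis j).
  by have := @is_derive_sum _ _ _ _ _ _ _ _ dj; rewrite fct_sumE.
rewrite /laplace_beltrami mulr_ge0// ?invr_ge0 ?sqrtr_ge0//.
rewrite (eq_bigr (fun i => vol y *
   \sum_j invmx (metric c y) i j * partial i (partial j v) y)); last first.
  move=> i _; rewrite /partial (@derive_val _ _ _ _ _ _ _ (der i)) mulr_sumr.
  by apply: eq_bigr => j _; rewrite mulrA.
rewrite -mulr_sumr mulr_ge0 ?sqrtr_ge0//.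
have := @rank_one_metric_trace_ge0 R m (height_grad c y)
  (\matrix_(i, j) partial i (partial j v) y).
rewrite -metricE; under eq_bigr do under eq_bigr do rewrite mxE.
apply => e; have [_] := crit e; rewrite (derive2_sum_partial _ oU wk)//.
by under [X in _ -> 0 <= X]eq_bigr do under eq_bigr do rewrite mxE.
Qed.

Lemma Ck_param k i : Ck k setT (fun y => param c y ord0 i : R^o).
Proof.
have -> : (fun y => param c y ord0 i : R^o) = (fun y =>
    height c y * frame c (lshift m (ord0 : 'I_1)) i +
    \sum_(j < m) y ord0 j * frame c (rshift 1 j) i).
  apply/funext => y; rewrite /param /point_at mxE (@big_split_ord _ _ _ 1 m)/=.
  rewrite big_ord1 (@row_mxEl R 1 1 m) mxE eqxx mulr1n; congr (_ + _).
  by apply: eq_bigr => j _; rewrite (@row_mxEr R 1 1 m).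
apply: CkD; [exact: openT| |].
  by apply: CkM; [exact: openT|exact: hh|exact: Ck_cst].
apply: Ck_sum => [|j]; first exact: openT.
apply: CkM; [exact: openT|exact: Ck_coord|exact: Ck_cst].
Qed.

Lemma continuous_param : continuous (param c).
Proof.
move=> y; apply: continuous_row => i.
by apply: (@Ck_continuous R _ 0 setT) => //; exact: Ck_param.
Qed.

End LaplaceBeltrami.

(** * The exponential barrier *)

Section Lipschitz.
Context {R : realType}.

Lemma lipschitz_of_derive1_bound (f : R -> R) (cf : R) :
  Ck 1 setT (f : R^o -> R^o) ->
  (forall x : R, `|derive1 (f : R -> R^o) x| <= cf) ->
  forall a b, `|f a - f b| <= cf * `|a - b|.
Proof.
move=> fk hf a b.
have fd (x : R) : derivable (f : R^o -> R^o) x 1 by exact: Ck_derivable fk I.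
have [|c _] := @mean_value_line R R^o (f : R^o -> R^o) b (a - b).
  by move=> s _; exact: Ck_derivable fk I.
rewrite (addrC b) subrK => ->.
have := is_derive_scale_dir (a - b) (fd (b + c *: (a - b))).
have -> : (a - b) *: (1 : R^o) = a - b by exact: mulr1.
move=> -[_ ->].
by rewrite normrM mulrC ler_wpM2r// -derive1E.
Qed.

End Lipschitz.

Section Barrier.
Context {R : realType} {n : nat} (kappa r M K : R) (ctr : 'rV[R]_n).
Implicit Types (x v : 'rV[R]_n).

(** Equal to [M] on the sphere of radius [r] about [ctr] and decreasing from
    there to [- K]; its derivatives are multiples of [barrier + K]. *)
Definition barrier x : R^o :=
  (M + K) * expR (- kappa * (dotp (x - ctr) (x - ctr) - r ^+ 2)) - K.

Lemma is_derive_barrier x v :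
  is_derive x v barrier (- (2 * kappa * dotp (x - ctr) v * (barrier x + K))).
Proof.
apply: is_derive_line0.
pose D := dotp (x - ctr) (x - ctr).
pose p := dotp (x - ctr) v.
pose q := dotp v v.
pose P : R -> R := cst (- kappa * (D - r ^+ 2)) + (- kappa * (2 * p)) \*: id +
  (- kappa * q) \*: (id * id).
have PE (a : R) : P a =
    - kappa * (dotp (x + a *: v - ctr) (x + a *: v - ctr) - r ^+ 2).
  rewrite (addrAC x) dotp_sqrDZ -/D -/p -/q.
  rewrite -[LHS]/(- kappa * (D - r ^+ 2) + (- kappa * (2 * p)) * a +
     (- kappa * q) * (a * a)); ring.
have -> : (fun a : R => barrier (x + a *: v)) =
    (fun a : R => (M + K) * expR (P a) - K : R^o).
  by apply/funext => a; rewrite PE.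
have dP : is_derive (0 : R) (1 : R) P (- kappa * (2 * p)).
  have did := @is_derive_id R R 0 1.
  apply: (is_derive_eq (is_deriveD (is_deriveD (is_derive_cst _ _ _)
    (is_deriveZ _ did)) (is_deriveZ _ (is_deriveM did did)))).
  rewrite /GRing.scale/=; ring.
have dE := @is_derive1_comp R expR P 0 _ _ (is_derive_expR _) dP.
have dZ := is_deriveB (is_deriveZ (M + K) dE) (is_derive_cst (K : R^o) (0 : R) (1 : R)).
apply: (is_derive_eq dZ); rewrite subr0 /GRing.scale/= PE scale0r addr0.
rewrite /barrier subrK /p; ring.
Qed.

Lemma is_derive2_barrier x (i : 'I_n) :
  is_derive x (ebasis i) (partial i barrier)
    ((4 * kappa ^+ 2 * (x ord0 i - ctr ord0 i) ^+ 2 - 2 * kappa) *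
     (barrier x + K)).
Proof.
have dotpe z : dotp z (ebasis i) = z ord0 i.
  rewrite /dotp (bigD1 i)//= big1 => [|j ji]; last by rewrite !mxE eqxx (negPf ji) mulr0.
  by rewrite !mxE !eqxx mulr1 addr0.
have -> : partial i barrier = (fun z => (z ord0 i - ctr ord0 i) *
    (- (2 * kappa) * (barrier z + K)) : R^o).
  apply/funext => z; rewrite /partial (@derive_val _ _ _ _ _ _ _ (is_derive_barrier _ _)).
  rewrite dotpe !mxE; ring.
have d1 : is_derive x (ebasis i) (fun z : 'rV[R]_n => z ord0 i - ctr ord0 i : R^o) 1.
  apply: is_derive_line0.
  have -> : (fun a : R => (x + a *: ebasis i) ord0 i - ctr ord0 i : R^o) =
      shift (x ord0 i - ctr ord0 i).
    by apply/funext => a; rewrite !mxE !eqxx /=; ring.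
  exact: is_derive_shift.
have d2 : is_derive x (ebasis i) (fun z => - (2 * kappa) * (barrier z + K) : R^o)
    (- (2 * kappa) * - (2 * kappa * (x ord0 i - ctr ord0 i) * (barrier x + K))).
  have := is_deriveZ (- (2 * kappa))
    (is_deriveD (is_derive_barrier x (ebasis i)) (is_derive_cst (K : R^o) x (ebasis i))).
  by rewrite addr0 dotpe !mxE.
apply: (is_derive_eq (is_deriveM d1 d2)); rewrite /GRing.scale/=; ring.
Qed.

Lemma laplacian_barrier x :
  laplacian barrier x =
  (4 * kappa ^+ 2 * dotp (x - ctr) (x - ctr) - 2 * kappa * n%:R) *
  (barrier x + K).
Proof.
rewrite /laplacian (eq_bigr (fun i => (4 * kappa ^+ 2 * (x ord0 i - ctr ord0 i) ^+ 2
    - 2 * kappa) * (barrier x + K))); last first.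
  by move=> i _; rewrite {1}/partial (@derive_val _ _ _ _ _ _ _ (is_derive2_barrier x i)).
rewrite -mulr_suml sumrB -mulr_sumr sumr_const card_ord.
congr ((_ * _ - _) * _); last by rewrite mulr_natr.
by apply: eq_bigr => i _; rewrite !mxE expr2.
Qed.

Let continuous_sqdist : Ck 0 setT (fun x => dotp (x - ctr) (x - ctr) : R^o).
Proof.
apply: Ck_sum; first exact: openT.
move=> i; have ck : Ck 0 setT (fun z : 'rV[R]_n => (z - ctr) ord0 i : R^o).
  have -> : (fun z : 'rV[R]_n => (z - ctr) ord0 i : R^o) =
     (fun z => z ord0 i + - ctr ord0 i) by apply/funext => z; rewrite !mxE.
  by apply: CkD; [exact: openT|exact: Ck_coord|exact: Ck_cst].
by apply: CkM; first exact: openT.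
Qed.

Lemma closed_outside_ball : closed [set x | r ^+ 2 <= dotp (x - ctr) (x - ctr)].
Proof.
apply: (@closed_comp _ _ (fun x => dotp (x - ctr) (x - ctr) : R^o)
  [set s : R^o | r ^+ 2 <= s]); last exact: closed_ge.
by move=> x _; exact: Ck_continuous continuous_sqdist I.
Qed.

Lemma continuous_barrier : continuous barrier.
Proof.
have cE : Ck 0 setT (fun x =>
    expR (- kappa * (dotp (x - ctr) (x - ctr) - r ^+ 2)) : R^o).
  split=> // x _; apply: (@continuous_comp _ _ _
    (fun x => - kappa * (dotp (x - ctr) (x - ctr) - r ^+ 2) : R) expR).
    apply: (@Ck_continuous R _ 0 setT) => //.
    apply: CkM; [exact: openT|exact: Ck_cst|].
    by apply: CkD; [exact: openT|exact: continuous_sqdist|exact: Ck_cst].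
  exact: continuous_expR.
move=> x; apply: (@Ck_continuous R _ 0 setT) => //.
apply: CkD; [exact: openT| |exact: Ck_cst].
by apply: CkM; [exact: openT|exact: Ck_cst|exact: cE].
Qed.

Hypotheses (kappa0 : 0 <= kappa) (MK0 : 0 <= M + K).

Lemma barrier_ge x : - K <= barrier x.
Proof. by rewrite lerDr mulr_ge0// expR_ge0. Qed.

Lemma barrier_le x : r ^+ 2 <= dotp (x - ctr) (x - ctr) -> barrier x <= M.
Proof.
move=> rx; rewrite lerBlDr ler_piMr// -expR0 ler_expR.
by rewrite mulNr oppr_le0 mulr_ge0// subr_ge0.
Qed.

Lemma barrier_sphere x : dotp (x - ctr) (x - ctr) = r ^+ 2 -> barrier x = M.
Proof. by move=> rx; rewrite /barrier rx subrr mulr0 expR0 mulr1 addrK. Qed.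

End Barrier.

Section EllipticComparison.
Context {R : realType} {m : nat} (Om : set 'rV[R]_m.+1).
Variables (d lambda cf : R) (f : R -> R) (w : 'rV[R]_m.+1 -> R^o).
Hypotheses (oOm : open Om) (bOm : bounded_set Om) (d0 : 0 < d).
Hypothesis f_lip : forall a b, `|f a - f b| <= cf * `|a - b|.
Hypothesis lambda_cf : cf < lambda.
Hypothesis cf0 : 0 <= cf.
Hypothesis w_cont : {within closure Om, continuous w}.
Hypothesis w_C2 : Ck 2 Om w.
Hypothesis w_eq : forall x, Om x -> lambda * w x - d * laplacian w x = f (w x).

(** At a negative interior minimum of [w - barrier] the Laplacians are ordered.
    Inserting this into the equation for [w] and estimating [f] by its Lipschitz
    constant gives (lambda - cf) (w - barrier) >= 0 there, a contradiction.  The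
    hypothesis on [kappa] makes the Laplacian of the barrier dominate
    (lambda + cf) (barrier + K), and [K] takes care of the size of [f 0]. *)
Lemma barrier_le_solution (kappa r M K : R) (ctr : 'rV[R]_m.+1) :
  0 <= kappa -> 0 <= M + K -> `|f 0| <= (lambda - cf) * K ->
  lambda + cf <= d * (4 * kappa ^+ 2 * r ^+ 2 - 2 * kappa * m.+1%:R) ->
  (forall x, boundary Om x -> M <= w x) ->
  (forall x, Om x -> r ^+ 2 <= dotp (x - ctr) (x - ctr)) ->
  forall x, Om x -> barrier kappa r M K ctr x <= w x.
Proof.
move=> k0 MK0 hK hk wM ball x Ox; pose b := barrier kappa r M K ctr.
have cpt : compact (closure Om) by exact: compact_closure.
have ballc z : closure Om z -> r ^+ 2 <= dotp (z - ctr) (z - ctr).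
  by move=> cz; apply: (@closed_outside_ball R _ r ctr); exact: closure_subset cz.
pose h z : R := w z - b z.
have hc : {within closure Om, continuous h}.
  move=> z; apply: cvgB; first exact: w_cont.
  apply: continuous_subspaceT; exact: continuous_barrier.
have [|x1 /set_mem cx1 hmin] := compact_EVT_min _ cpt hc.
  by exists x; exact: subset_closure.
suff : 0 <= h x1.
  move=> h0; rewrite -subr_ge0; apply: le_trans h0 _.
  by apply: hmin; rewrite inE; exact: subset_closure.
rewrite leNgt; apply/negP => h1.
have Ox1 : Om x1.
  apply: contrapT => nO; have bx1 : boundary Om x1.
    by split => // /interior_subset.
  move: h1; apply/negP; rewrite -leNgt subr_ge0.
  by apply: le_trans (wM _ bx1); apply: barrier_le => //; exact: ballc.
have lap : laplacian b x1 <= laplacian w x1.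
  rewrite -subr_ge0 /laplacian -sumrB; apply: sumr_ge0 => i _.
  have nO := near_line (ebasis i) (open_nbhs_nbhs (conj oOm Ox1)).
  have := @second_derivative_test R (fun s : R => h (x1 + s *: ebasis i))
    (fun s : R => partial i w (x1 + s *: ebasis i) - partial i b (x1 + s *: ebasis i))
    (partial i (partial i w) x1 - partial i (partial i b) x1).
  rewrite scale0r addr0 => -[|||//].
  - apply: filterS nO => s Os; apply: is_deriveB.
      by apply: (@is_derive_line R _ R^o); exact: Ck_derivable w_C2 Os.
    apply: (@is_derive_line R _ R^o).
    by have [] := is_derive_barrier kappa r M K ctr (x1 + s *: ebasis i) (ebasis i).
  - apply: is_deriveB.
      have := @is_derive_line R _ R^o (partial i w) x1 (ebasis i) 0.
      rewrite scale0r addr0; apply.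
      exact: Ck_derivable (Ck_derive (ebasis i) w_C2) Ox1.
    have := @is_derive_line R _ R^o (partial i b) x1 (ebasis i) 0.
    rewrite scale0r addr0; apply.
    by have [] := is_derive2_barrier kappa r M K ctr x1 i.
  - apply: filterS nO => s Os.
    by apply: hmin; rewrite inE; exact: subset_closure.
have := w_eq Ox1; have := ballc _ cx1; move: lap h1.
rewrite laplacian_barrier /h.
have := @barrier_ge R _ kappa r M K ctr MK0 x1; rewrite -/b.
set D := dotp _ _; set L := laplacian w x1.
move=> bK lap h1 rD eqw.
have bK0 : 0 <= b x1 + K by lra.
have lapd : (lambda + cf) * (b x1 + K) <= d * L.
  have h3 := ler_wpM2r bK0 hk; apply: (le_trans h3).
  rewrite -[leLHS]mulrA (ler_pM2l d0); apply: le_trans lap.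
  rewrite ler_wpM2r// lerB// ler_wpM2l//.
  by rewrite mulr_ge0// sqr_ge0.
have f1 : - (cf * (b x1 - w x1)) <= f (w x1) - f (b x1).
  have bw : `|w x1 - b x1| = b x1 - w x1 by rewrite ltr0_norm// opprB.
  by have := f_lip (w x1) (b x1); rewrite bw ler_norml => /andP[].
have K0 : 0 <= K.
  rewrite -(pmulr_rge0 _ (_ : 0 < lambda - cf)) ?subr_gt0//.
  exact: le_trans hK.
have f2 : - `|f 0| - cf * (b x1 + K + K) <= f (b x1).
  have := f_lip (b x1) 0; rewrite subr0.
  have nb : `|b x1| <= b x1 + K + K by rewrite ler_norml; lra.
  have := ler_wpM2l cf0 nb.
  have : - `|f 0| <= f 0 by rewrite lerNl -normrN ler_norm.
  move=> h2 h3 h4; have : `|f (b x1) - f 0| <= cf * (b x1 + K + K).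
    exact: le_trans h4 h3.
  by rewrite ler_norml; lra.
move: f1 f2 eqw lapd hK h1; move: (b x1) (w x1) (f (b x1)) (f (w x1)) `|f 0| => B W FB FW F0.
move=> f1 f2 eqw lapd hK h1.
have : 0 <= (lambda - cf) * (W - B) by lra.
by rewrite pmulr_rge0 ?subr_gt0//; lra.
Qed.

End EllipticComparison.

Section NormalDerivativeAtMinimum.
Context {R : realType} {m : nat} (Om : set 'rV[R]_m.+1).
Variables (d lambda cf : R) (f : R -> R).

(** The barrier with [M := w (param c y)], centred at the exterior ball, touches
    [w] from below at the minimum point, and 2 kappa r (M + K) is its outward
    normal derivative. *)
Lemma normal_derivative_at_minimum (c : chart R m) (y : 'rV[R]_m)
    (w w' : 'rV[R]_m.+1 -> R^o) (U : set 'rV[R]_m.+1) (kappa r K : R) :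
  open Om -> bounded_set Om -> 0 < d -> 0 <= cf -> cf < lambda ->
  (forall a b, `|f a - f b| <= cf * `|a - b|) ->
  {within closure Om, continuous w} -> Ck 2 Om w ->
  (forall x, Om x -> lambda * w x - d * laplacian w x = f (w x)) ->
  is_chart Om c -> chart_params c y -> exterior_ball Om c (param c y) r ->
  open U -> U (param c y) -> Ck 1 U w' ->
  (forall z, U z -> closure Om z -> w z = w' z) ->
  (forall x, boundary Om x -> w (param c y) <= w x) ->
  0 <= kappa -> `|f 0| <= (lambda - cf) * K -> 0 <= w (param c y) + K ->
  lambda + cf <= d * (4 * kappa ^+ 2 * r ^+ 2 - 2 * kappa * m.+1%:R) ->
  normal_derivative c w y <= 2 * kappa * r * (w (param c y) + K).
Proof.
move=> oOm bOm d0 cf0 cfl flip wc w2 weq hc cy eb oU Ux w'k ww' wmin k0 hK MK0 hk.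
have [_ cF _ _] := hc.
have base : chart_base c (param c y) = y by rewrite /param chart_base_point.
move: eb; rewrite /exterior_ball base; set x := param c y in Ux wmin MK0 *.
set ctr := x + r *: normal c y => eb.
have xctr : x - ctr = - (r *: normal c y) by rewrite /ctr opprD addrA subrr add0r.
set M := w x in wmin MK0 *.
have sph : dotp (x - ctr) (x - ctr) = r ^+ 2.
  by rewrite xctr dotpNl dotpNr opprK dotpZl dotpZr dotp_normal// mulr1 expr2.
have bx := barrier_sphere kappa M K sph.
have := is_derive_barrier kappa r M K ctr x (- normal c y).
rewrite bx xctr dotpNl dotpNr opprK dotpZl dotp_normal// mulr1 => db.
have := normal_derivative_le oOm hc cy oU Ux w'k ww' db _ _.
rewrite opprK; apply; first exact: bx.
exact: (barrier_le_solution oOm bOm d0 flip cfl cf0 wc w2 weq k0 MK0 hK hk wmin eb).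
Qed.

Lemma barrier_rate_exists (r : R) : 0 < d -> 0 < r -> 0 <= lambda + cf ->
  exists2 kappa : R, 0 <= kappa &
    lambda + cf <= d * (4 * kappa ^+ 2 * r ^+ 2 - 2 * kappa * m.+1%:R).
Proof.
move=> d0 r0 l0; pose L := (lambda + cf) / d.
have L0 : 0 <= L by rewrite divr_ge0// ltW.
have r20 : 0 < 4 * r ^+ 2 by rewrite mulr_gt0// exprn_gt0.
(* The value of kappa for which kappa (4 r^2) - 2 (m + 1) equals L. *)
pose k0 := (L + 2 * m.+1%:R) / (4 * r ^+ 2).
have k00 : 0 <= k0 by rewrite divr_ge0 ?(ltW r20)// addr_ge0// mulr_ge0.
have k0E : k0 * (4 * r ^+ 2) = L + 2 * m.+1%:R by rewrite divfK// gt_eqF.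
exists (1 + k0); first lra.
have -> : lambda + cf = d * L by rewrite /L mulrCA divff ?mulr1// gt_eqF.
rewrite ler_pM2l//.
have -> : 4 * (1 + k0) ^+ 2 * r ^+ 2 - 2 * (1 + k0) * m.+1%:R =
  (1 + k0) * ((1 + k0) * (4 * r ^+ 2) - 2 * m.+1%:R) by ring.
have -> : (1 + k0) * (4 * r ^+ 2) - 2 * m.+1%:R = 4 * r ^+ 2 + L.
  by rewrite mulrDl mul1r k0E; ring.
move: (4 * r ^+ 2) r20 => s s0; nra.
Qed.

End NormalDerivativeAtMinimum.

(** * The growth rate of the boundary minimum *)

Section SpaceTimeSlices.
Context {R : realType} {V : normedModType R}.

Lemma continuous_time_slice (x : V) : continuous (fun t : R^o => (t, x) : R^o * V).
Proof. by move=> t; apply: (cvg_pair (@cvg_id _ (nbhs t)) (cvg_cst x)). Qed.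

Lemma continuous_space_slice (t : R^o) : continuous (fun x : V => (t, x) : R^o * V).
Proof. by move=> x; apply: (cvg_pair (cvg_cst t) (@cvg_id _ (nbhs x))). Qed.

Lemma time_slice_affine (x : V) (a : R) (s t : R^o) :
  (a *: s + t, x) = a *: ((s, 0) : R^o * V) + (t, x).
Proof. by congr (_, _); rewrite /= scaler0 add0r. Qed.

Lemma space_slice_affine (t : R^o) (a : R) (v x : V) :
  (t, a *: v + x) = a *: ((0, v) : R^o * V) + (t, x).
Proof. by congr (_, _); rewrite /= scaler0 add0r. Qed.

End SpaceTimeSlices.

Section SpaceTimeRegularity.
Context {R : realType} {m : nat}.
Variables (Om : set 'rV[R]_m.+1) (u : R -> 'rV[R]_m.+1 -> R^o).
Hypothesis oOm : open Om.

Let S := [set z : R^o * 'rV[R]_m.+1 |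
  [/\ 0 < z.1, (z.1%:E < +oo)%E & closure Om z.2]].

Hypothesis u_smooth : smooth_on S (fun z => u z.1 z.2).

Let inS (t : R) x : 0 < t -> closure Om x -> S (t, x).
Proof. by move=> t0 cx; split=> //=; rewrite ltry. Qed.

Lemma near_space_time (t : R) x : 0 < t -> closure Om x ->
  forall e : R, 0 < e -> \forall z \near (t, x), 0 < z.1 -> closure Om z.2 ->
    `|u z.1 z.2 - u t x| < e.
Proof.
move=> t0 cx e e0.
have [U [h [oU Ux hk uh]]] := u_smooth (inS t0 cx).
have := Ck_continuous (hk 0%N) Ux.
move=> /cvgrPdist_lt/(_ _ e0) near_h.
near=> z => z0 cz.
have Uz : U z by near: z; exact: open_nbhs_nbhs.
have Sz : S z by split=> //; rewrite ltry.
have /= -> := uh _ Ux (inS t0 cx); have -> := uh _ Uz Sz.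
by rewrite distrC; near: z.
Unshelve. all: by end_near. Qed.

Lemma space_slice (t : R) x : 0 < t -> closure Om x ->
  exists (U : set 'rV[R]_m.+1) (w : 'rV[R]_m.+1 -> R^o),
  [/\ open U, U x, Cinfty U w & forall z, U z -> closure Om z -> u t z = w z].
Proof.
move=> t0 cx; have [U [h [oU Ux hk uh]]] := u_smooth (inS t0 cx).
exists ((fun z : 'rV[R]_m.+1 => (t, z) : R^o * _) @^-1` U),
  (h \o (fun z : 'rV[R]_m.+1 => (t, z) : R^o * _)); split => //.
- by apply: open_comp => // z _; exact: continuous_space_slice.
- move=> k; apply: (Ck_affine (A0 := fun v => (0, v) : R^o * _)) (hk k).
    exact: continuous_space_slice.
  by move=> a v z; exact: space_slice_affine.
- by move=> z Uz cz; exact: (uh _ Uz (inS t0 cz)).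
Qed.

Lemma Ck_local k (V : normedModType R) (U : set V) (h : V -> R^o) :
  (forall x, U x -> exists U', [/\ open U', U' x & Ck k U' h]) -> Ck k U h.
Proof.
elim: k h => [|k ih] h loc.
  by split=> // x /loc[U' [_ U'x]] /Ck_continuous; exact.
split=> [x /loc[U' [_ U'x]] /Ck_continuous|v]; first exact.
split=> [x /loc[U' [_ U'x]] /Ck_derivable|]; first exact.
by apply: ih => x /loc[U' [oU' U'x hk]]; exists U'; split => //; exact: Ck_derive.
Qed.

Lemma space_slice_Ck k (t : R) : 0 < t -> Ck k Om (u t).
Proof.
move=> t0; apply: Ck_local => x Ox.
have [U [w [oU Ux wk uw]]] := space_slice t0 (subset_closure Ox).
exists (U `&` Om); split => //; first exact: openI.
apply: (@Ck_eq _ _ k _ w); first exact: openI.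
  by move=> z; rewrite inE => -[Uz Oz]; rewrite uw//; exact: subset_closure.
by apply: (Ck_subset _ (wk k)) => z [].
Qed.

Lemma space_slice_continuous (t : R) : 0 < t ->
  {within closure Om, continuous (u t)}.
Proof.
move=> t0; apply/subspace_continuousP => x cx; apply/cvgrPdist_lt => e e0.
have near_u : \forall z \near x, 0 < t -> closure Om z -> `|u t z - u t x| < e.
  exact: (@continuous_space_slice R 'rV[R]_m.+1 t x _ (near_space_time t0 cx e0)).
suff : \forall z \near x, closure Om z -> `|u t x - u t z| < e by [].
by apply: filterS near_u => z zu cz; rewrite distrC; exact: zu.
Qed.

Lemma time_slice_derivable (t : R) x : 0 < t -> closure Om x ->
  is_derive t (1 : R) (fun tau : R => u tau x : R)
    (derive1 (fun tau : R => u tau x : R^o) t).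
Proof.
move=> t0 cx; have [U [h [oU Ux hk uh]]] := u_smooth (inS t0 cx).
rewrite derive1E; apply: derivableP.
pose A := fun tau : R^o => (tau, x) : R^o * 'rV[R]_m.+1.
have dhA : derivable (h \o A) t (1 : R^o).
  apply: (@derivable_affine _ _ _ A (fun s => (s, 0) : R^o * 'rV[R]_m.+1)).
    by move=> a s tau; exact: time_slice_affine.
  exact: Ck_derivable (hk 1%N) Ux.
apply: near_eq_derivable dhA.
have nU : nbhs (t : R^o) (A @^-1` U).
  apply: (@continuous_time_slice R 'rV[R]_m.+1 x t U).
  exact: open_nbhs_nbhs.
near=> tau.
have tau0 : 0 < tau by near: tau; exact: lt_nbhsr.
have Utau : U (A tau) by near: tau.
by rewrite /= -(uh _ Utau (inS tau0 cx)).
Unshelve. all: by end_near. Qed.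

End SpaceTimeRegularity.

Section MinimumPrinciple.
Context {R : realType} {m : nat}.
Variables (Om : set 'rV[R]_m.+1) (d delta p lambda cf : R) (f g : R -> R).
Hypotheses (oOm : open Om) (bOm : bounded_set Om) (d0 : 0 < d).
Hypotheses (delta0 : 0 <= delta) (cf0 : 0 <= cf) (cfl : cf < lambda).
Hypothesis flip : forall a b, `|f a - f b| <= cf * `|a - b|.

(** The boundary equation at a point where the spatial minimum is attained:
    there the tangential diffusion is nonnegative and the normal flux is bounded
    linearly in the minimal value. *)
Lemma boundary_minimum_rate (u : R -> 'rV[R]_m.+1 -> R^o) u0 kappa r K t c x :
  is_solution Om d delta p f g lambda u0 +oo%E u ->
  0 <= kappa -> `|f 0| <= (lambda - cf) * K ->
  lambda + cf <= d * (4 * kappa ^+ 2 * r ^+ 2 - 2 * kappa * m.+1%:R) ->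
  0 < t -> is_chart Om c -> dom c x -> exterior_ball Om c x r ->
  boundary Om x -> (forall z, boundary Om z -> u t x <= u t z) ->
  0 <= u t x + K ->
  g (u t x) - d * (2 * kappa * r * (u t x + K)) <=
  derive1 (fun tau : R => u tau x : R^o) t.
Proof.
move=> [_ us eqin eqbd _] k0 hK hk t0 hc cx eb bx xmin MK0.
have ty : (t%:E < +oo)%E by rewrite ltry.
pose y := chart_base c x.
have xy : param c y = x by exact: param_chart_base bx cx.
have cy : chart_params c y by rewrite /chart_params /= xy.
have clx : closure Om x by have [] := bx.
have [U [w [oU Ux wk uw]]] := space_slice us t0 clx.
have nd : normal_derivative c (u t) y <= 2 * kappa * r * (u t (param c y) + K).
  have wc := space_slice_continuous us t0.
  have w2 := space_slice_Ck oOm us 2 t0.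
  have weq z : Om z -> lambda * u t z - d * laplacian (u t) z = f (u t z).
    exact: eqin.
  rewrite -xy in Ux eb xmin MK0.
  exact: (normal_derivative_at_minimum oOm bOm d0 cf0 cfl flip wc w2 weq hc cy
    eb oU Ux (wk 1%N) uw xmin k0 hK MK0 hk).
have [odom cF hh _] := hc.
have pc := continuous_param hh.
pose V : set 'rV[R]_m := param c @^-1` (U `&` dom c).
have oV : open V by apply: open_comp; [move=> z _; exact: pc|exact: openI].
have Vy : V y by split; rewrite xy.
have lb : 0 <= laplace_beltrami c (u t) y.
  apply: (laplace_beltrami_ge0 cF hh oV Vy).
    apply: (@Ck_eq _ _ 2 V (w \o param c)); first exact: oV.
      move=> z; rewrite inE => -[Uz cz] /=.
      by rewrite uw//; have [] := boundary_param oOm hc cz.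
    apply: (Ck_comp oV oU _ _ (wk 2%N)); first by move=> z [].
    by move=> i; apply: Ck_subset (Ck_param hh 2 i).
  have : nbhs y V by exact: open_nbhs_nbhs.
  apply: filterS => z [_ cz]; rewrite xy; apply: xmin.
  exact: (boundary_param oOm hc cz).
have := eqbd t c y t0 ty hc cy; rewrite xy.
have := ler_wpM2l (ltW d0) nd; rewrite xy.
have := mulr_ge0 delta0 lb.
lra.
Qed.

End MinimumPrinciple.

(** * Comparison with the equation y' = y^q *)

Section PowerODE.
Context {R : realType}.
Variables (q y0 : R).
Hypotheses (q1 : 1 < q) (y00 : 0 < y0).

(** The solution of y' = y^q with y(0) = y0, which exists up to
    [power_blowup_time]. *)
Definition power_blowup (s : R) : R :=
  (y0 `^ (- (q - 1)) - (q - 1) * s) `^ (- (q - 1)^-1).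

Definition power_blowup_time : R := y0 `^ (- (q - 1)) / (q - 1).

Let q10 : 0 < q - 1. Proof. by rewrite subr_gt0. Qed.

Lemma power_blowup_time_gt0 : 0 < power_blowup_time.
Proof. by rewrite divr_gt0// powR_gt0. Qed.

Lemma power_blowup_base_gt0 s : s < power_blowup_time ->
  0 < y0 `^ (- (q - 1)) - (q - 1) * s.
Proof. by rewrite /power_blowup_time ltr_pdivlMr// subr_gt0 mulrC. Qed.

Lemma power_blowup_init : power_blowup 0 = y0.
Proof.
by rewrite /power_blowup mulr0 subr0 -powRrM mulrNN divff ?gt_eqF// powRr1// ltW.
Qed.

Lemma is_derive_power_blowup s : s < power_blowup_time ->
  is_derive s (1 : R) power_blowup (power_blowup s `^ q).
Proof.
move=> sS; have b0 := power_blowup_base_gt0 sS.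
have d1 : is_derive s (1 : R) (fun s : R => y0 `^ (- (q - 1)) - (q - 1) * s)
    (- (q - 1)).
  have did := @is_derive_id R R s 1.
  apply: (is_derive_eq (is_deriveB (is_derive_cst _ _ _) (is_deriveZ (q - 1) did))).
  by rewrite sub0r /GRing.scale/= mulr1.
have d2 := @is_derive1_powR R (- (q - 1)^-1) _ b0.
have d3 := @is_derive1_comp R _ _ s _ _ d2 d1.
apply: (is_derive_eq d3); rewrite /power_blowup -powRrM mulrAC mulrNN mulVf ?gt_eqF// mul1r.
congr (_ `^ _); rewrite mulNr -opprD; congr (- _).
by rewrite -{3}(subrK 1 q) mulrDr mulVf ?gt_eqF// mulr1 addrC.
Qed.

Lemma power_blowup_ge s : 0 <= s -> s < power_blowup_time -> y0 <= power_blowup s.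
Proof.
move=> s0 sS; rewrite -{1}power_blowup_init /power_blowup mulr0 subr0.
have := power_blowup_base_gt0 sS; set a := y0 `^ (- (q - 1)) => b0.
have a0 : 0 < a by rewrite powR_gt0.
rewrite !powRN lef_pV2 ?posrE ?powR_gt0//.
have le_a : a - (q - 1) * s <= a by rewrite gerBl mulr_ge0// ltW.
have i0 : 0 <= (q - 1)^-1 by rewrite invr_ge0 ltW.
by apply: (ge0_ler_powR i0); rewrite ?nnegrE// ltW.
Qed.

Lemma power_blowup_unbounded (A : R) :
  \forall h \near (0 : R)^'+, A < power_blowup (power_blowup_time - h).
Proof.
pose B : R := `|A| + 1; have B0 : 0 < B by rewrite ltr_wpDl.
have b0 : 0 < (q - 1)^-1 by rewrite invr_gt0.
have /cvgr_lt/(_ B^-1) : (a : R) `^ (q - 1)^-1 @[a --> 0^'+] --> (0 : R) by exact: powR_cvg0.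
rewrite invr_gt0 => /(_ B0) [e /= e0 he].
near=> h.
have h0 : 0 < h by near: h; exact: nbhs_right_gt.
have qh : (q - 1) * h < e.
  by rewrite mulrC -ltr_pdivlMr//; near: h; apply: nbhs_right_lt; rewrite divr_gt0.
have := he ((q - 1) * h).
rewrite /ball /= sub0r normrN gtr0_norm ?mulr_gt0// => /(_ qh isT).
have -> : (q - 1) * h =
    y0 `^ (- (q - 1)) - (q - 1) * (power_blowup_time - h).
  by rewrite /power_blowup_time mulrBr mulrCA divff ?gt_eqF// mulr1; ring.
rewrite /power_blowup.
have := @power_blowup_base_gt0 (power_blowup_time - h); rewrite gtrBl => /(_ h0).
move: (_ - (q - 1) * _) => z z0 hB; rewrite (powRN z).
apply: (@lt_trans _ _ B); first by rewrite /B; have := ler_norm A; lra.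
by rewrite -[ltLHS]invrK ltf_pV2 ?posrE ?invr_gt0// powR_gt0.
Unshelve. all: by end_near. Qed.

End PowerODE.

Section ComparisonBlowup.
Context {R : realType} {n : nat}.
Variables (G : set 'rV[R]_n) (u D : R -> 'rV[R]_n -> R) (q y0 t1 : R).
Hypotheses (cG : compact G) (G0 : G !=set0) (q1 : 1 < q) (y00 : 0 < y0) (t10 : 0 < t1).
Hypothesis u_cont : forall (t : R) x, 0 < t -> G x -> forall e : R, 0 < e ->
  \forall z \near (t : R^o, x), 0 < z.1 -> G z.2 -> `|u z.1 z.2 - u t x| < e.
Hypothesis u_der : forall (t : R) x, 0 < t -> G x ->
  is_derive t (1 : R) (fun tau => u tau x) (D t x).
Hypothesis u_min : forall (t : R) x, 0 < t -> G x ->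
  (forall z, G z -> u t x <= u t z) -> y0 <= u t x -> u t x `^ q < D t x.
Hypothesis u_init : forall x, G x -> y0 < u t1 x.

Let Y := power_blowup q y0.
Let Tb := power_blowup_time q y0.

(** The excess over the solution of the ordinary differential equation started
    at time t1; it is shown to stay positive up to the blow-up time. *)
Let phi x (s : R) := u (t1 + s) x - Y s.

Let phi_der x (s : R) : 0 <= s -> s < Tb -> G x ->
  is_derive s (1 : R) (phi x) (D (t1 + s) x - Y s `^ q).
Proof.
move=> s0 sS Gx; apply: is_deriveB; last exact: is_derive_power_blowup.
have t1s : 0 < t1 + s by rewrite ltr_pwDl.
have d1 : is_derive s (1 : R) (fun s : R => t1 + s) 1.
  have := is_deriveD (is_derive_cst t1 s 1) (@is_derive_id R R s 1).
  by rewrite add0r.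
have := @is_derive1_comp R (fun tau => u tau x) (fun s : R => t1 + s) s _ _
  (u_der t1s Gx) d1.
by rewrite mulr1.
Qed.

(** At the first time where the excess vanishes, it does so at a minimum point
    of [u] over [G], with value [Y si]; there the time derivative of the excess
    is positive, so the excess was negative shortly before. *)
Let phi_pos x (s : R) : 0 <= s -> s < Tb -> G x -> 0 < phi x s.
Proof.
move=> s0 sS Gx; rewrite ltNge; apply/negP => phis.
pose E := [set s | [/\ 0 <= s, s < Tb & exists2 x, G x & phi x s <= 0]].
have Es : E s by split=> //; exists x.
have hE : has_inf E by split; [exists s|exists 0 => z []].
pose si := inf E.
have si0 : 0 <= si by apply: lb_le_inf; [exists s|move=> z []].
have siE z : E z -> si <= z by move=> Ez; apply: inf_lbound => //; case: hE.
have siS : si < Tb by apply: le_lt_trans sS; exact: siE.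
have t1si : 0 < t1 + si by rewrite ltr_pwDl.
have Esi : E si.
  apply: contrapT => nE.
  have pos z : G z -> 0 < phi z si.
    by move=> Gz; rewrite ltNge; apply/negP => pz; apply: nE; split=> //; exists z.
  have /compact_near_coveringP cov := cG.
  have : \forall s \near si, G `<=` (fun z => G z -> 0 <= s -> 0 < phi z s).
    apply: (cov R (nbhs si) (fun s z => G z -> 0 <= s -> 0 < phi z s)) => z Gz.
    pose e := phi z si / 2.
    have e0 : 0 < e by rewrite divr_gt0// pos.
    have hu := u_cont t1si Gz e0.
    have nY : \forall s \near si, `|Y si - Y s| < e.
      have [dY _] := is_derive_power_blowup q1 siS.
      have /differentiable_continuous := (derivable1_diffP _ _).1 dY.
      by move=> /cvgrPdist_lt/(_ _ e0).
    move: hu => [[A B] /= [nA nB] AB].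
    have nA' : \forall s \near si, A (t1 + s).
      have : (fun s : R => t1 + s) @ si --> t1 + si.
        by apply: cvgD; [exact: cvg_cst|exact: cvg_id].
      exact.
    near=> z' s' => /= Gz' s'0.
    have := AB (t1 + s', z'); rewrite /= => /(_ _ _ Gz') h1.
    have h2 : `|u (t1 + s') z' - u (t1 + si) z| < e.
      apply: h1; last by rewrite ltr_pwDl.
      by split; [near: s'|near: z'].
    have h3 : `|Y si - Y s'| < e by near: s'.
    move: h2 h3; rewrite !ltr_norml /e /phi; lra.
  move=> /nbhs_ballP[e /= e0 he].
  have [z Ez zlt] := inf_adherent e0 hE.
  have zi := siE _ Ez; have [z0 zS [x' Gx']] := Ez.
  apply/negP; rewrite -ltNge; apply: he => //.
  by rewrite /ball /= distrC ger0_norm ?subr_ge0//; rewrite -/si in zlt; lra.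
have [_ _ [x' Gx' px']] := Esi.
have uc : {within G, continuous (u (t1 + si))}.
  apply/subspace_continuousP => z Gz; apply/cvgrPdist_lt => e e0.
  have near_u : \forall z' \near z, 0 < t1 + si -> G z' ->
      `|u (t1 + si) z' - u (t1 + si) z| < e.
    exact: (@continuous_space_slice R 'rV[R]_n (t1 + si) z _ (u_cont t1si Gz e0)).
  suff : \forall z' \near z, G z' -> `|u (t1 + si) z - u (t1 + si) z'| < e by [].
  by apply: filterS near_u => z' zu cz; rewrite distrC; exact: zu.
have [x0 /set_mem Gx0 x0min] := compact_EVT_min G0 cG uc.
have x0min' z : G z -> u (t1 + si) x0 <= u (t1 + si) z.
  by move=> Gz; apply: x0min; rewrite inE.
have px0 : phi x0 si <= 0.
  by apply: le_trans px'; rewrite lerD2r x0min'.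
have si_gt0 : 0 < si.
  rewrite lt_neqAle si0 andbT; apply/eqP => e; move: px0; apply/negP.
  by rewrite -ltNge -e /phi addr0 /Y power_blowup_init// subr_gt0 u_init.
have before z : 0 <= z < si -> 0 < phi x0 z.
  move=> /andP[z0 zs]; rewrite ltNge; apply/negP => pz.
  have : E z by split=> //; [exact: lt_trans siS|exists x0].
  by move=> /siE; rewrite leNgt zs.
have dphi := phi_der si0 siS Gx0.
have rev : is_derive (0 : R) (1 : R) (fun h => phi x0 (si - h))
    (- (D (t1 + si) x0 - Y si `^ q)).
  have dphi' : is_derive (si - 0) (1 : R) (phi x0) (D (t1 + si) x0 - Y si `^ q).
    by rewrite subr0.
  have d1 : is_derive (0 : R) (1 : R) (fun h : R => si - h) (- 1).
    have := is_deriveB (is_derive_cst si (0 : R) 1) (@is_derive_id R R 0 1).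
    by rewrite sub0r.
  by have := @is_derive1_comp R (phi x0) (fun h => si - h) 0 _ _ dphi' d1; rewrite mulrN1.
have before_near : \forall h \near (0 : R)^'+, 0 < phi x0 (si - h).
  near=> h; apply: before.
  have h0 : 0 < h by near: h; exact: nbhs_right_gt.
  have : h <= si by near: h; exact: nbhs_right_le.
  lra.
have px0' : 0 <= phi x0 si.
  have [drev _] := rev.
  have /differentiable_continuous crev := (derivable1_diffP _ _).1 drev.
  have crev' : (fun h => phi x0 (si - h)) @ (0 : R)^'+ --> phi x0 (si - 0).
    exact: cvg_at_right_filter crev.
  rewrite subr0 in crev'.
  apply: (cvgr_to_ge crev'); apply: filterS before_near => h; exact: ltW.
have eqY : u (t1 + si) x0 = Y si.
  by apply/eqP; rewrite -subr_eq0 eq_le px0 px0'.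
have Yy0 : y0 <= Y si by exact: power_blowup_ge.
have := u_min t1si Gx0 x0min'; rewrite eqY => /(_ Yy0) Dgt.
have neg : - (D (t1 + si) x0 - Y si `^ q) < 0 by rewrite oppr_lt0 subr_gt0.
have lt0 := lt_right_of_derive_lt0 rev neg.
near (0 : R)^'+ => h.
have h1 : 0 < phi x0 (si - h) by near: h.
have : phi x0 (si - h) < phi x0 (si - 0) by near: h.
by rewrite subr0; lra.
Unshelve. all: by end_near. Qed.

(** [u] would have to be infinite at the blow-up time of [Y], but it is
    continuous there. *)
Lemma comparison_blowup : False.
Proof.
have [x Gx] := G0; have S0 : 0 < Tb by exact: power_blowup_time_gt0.
have t1S : 0 < t1 + Tb by rewrite addr_gt0.
have [du _] := u_der t1S Gx.
have /differentiable_continuous := (derivable1_diffP _ _).1 du.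
move=> /cvgrPdist_lt/(_ 1 ltr01) /nbhs_ballP[e /= e0 he].
near (0 : R)^'+ => h.
have h0 : 0 < h by near: h; exact: nbhs_right_gt.
have hS : h <= Tb by near: h; exact: nbhs_right_le.
have hlt : h < e by near: h; exact: nbhs_right_lt.
have big : u (t1 + Tb) x + 1 < Y (Tb - h) by near: h; exact: power_blowup_unbounded.
have := @phi_pos x (Tb - h); rewrite /phi => /(_ _ _ Gx) pos.
have : 0 < u (t1 + (Tb - h)) x - Y (Tb - h) by apply: pos; lra.
have near_Tb : ball (t1 + Tb) e (t1 + (Tb - h)).
  by rewrite /ball /= (_ : _ - _ = h); [rewrite gtr0_norm|ring].
by have := he _ near_Tb; rewrite /= ltr_norml; lra.
Unshelve. all: by end_near. Qed.

End ComparisonBlowup.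

(** * A smooth step and its derivative *)

Section FlatFunctions.
Context {R : realType}.
Implicit Types (P : {poly R}) (x : R).

(** The polynomial factor makes the family closed under differentiation, so
    that one formula for the derivative gives smoothness of all orders. *)
Definition flat P x : R :=
  if 0 < x then P.[x^-1] * expR (- x^-1) else 0.

(** One term of the exponential series beats each monomial of [P]. *)
Lemma flat_bound P : exists2 A : R, 0 <= A &
  forall x, 0 < x -> `|P.[x^-1] * expR (- x^-1)| <= A * x.
Proof.
exists (\sum_(i < size P) `|P`_i| * (i.+1)`!%:R).
  by apply: sumr_ge0 => i _; rewrite mulr_ge0.
move=> x x0; rewrite normrM (ger0_norm (expR_ge0 _)) horner_coef.
apply: le_trans (ler_wpM2r (expR_ge0 _) (ler_norm_sum _ _ _)) _.
rewrite !mulr_suml; apply: ler_sum => i _.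
rewrite normrM -!mulrA ler_wpM2l// normrX ger0_norm; last by rewrite invr_ge0 ltW.
have y0 : 0 <= x^-1 by rewrite invr_ge0 ltW.
have := @expR_ge1Dxn R x^-1 i y0; set E := expR x^-1 => hE.
have E0 : 0 < E by exact: expR_gt0.
rewrite expRN -/E ler_pdivrMr//.
have fact0 : 0 < (i.+1)`!%:R :> R by rewrite ltr0n fact_gt0.
have : x^-1 ^+ i.+1 <= (i.+1)`!%:R * E.
  rewrite mulrC -ler_pdivrMr//; apply: le_trans hE; lra.
rewrite exprS mulrC -ler_pdivlMr ?invr_gt0// invrK => /le_trans; apply.
by rewrite -!mulrA (mulrC E).
Qed.

Lemma is_derive_flat P x :
  is_derive x (1 : R) (flat P) (flat ('X^2 * (P - P^`())) x).
Proof.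
have [x0|x0|->] := ltgtP x 0.
- have -> : flat ('X^2 * (P - P^`())) x = 0 by rewrite /flat ltNge (ltW x0).
  apply: (near_eq_is_derive _ (is_derive_cst (0 : R^o) x (1 : R))).
  near=> z; rewrite /flat ltNge [_ <= _](_ : _ = true)//.
  by apply: ltW; near: z; exact: lt_nbhsl.
- have xn0 : x != 0 by rewrite gt_eqF.
  have dinv : is_derive x (1 : R) (fun z : R => z^-1) (- x ^- 2).
    have := @deriveV R R id x 1 xn0 (@derivable_id _ _ _ _).
    rewrite derive_id /GRing.scale/= mulr1 => dE.
    by apply: (DeriveDef (derivableV xn0 (@derivable_id _ _ _ _))).
  have dexp : is_derive x (1 : R) (fun z : R => expR (- z^-1)) (expR (- x^-1) * x ^- 2).
    have := @is_derive1_comp R expR (fun z : R => - z^-1) x _ _ (is_derive_expR _)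
      (is_deriveN dinv).
    by rewrite opprK.
  have dP : is_derive x (1 : R) (fun z : R => P.[z^-1]) (P^`().[x^-1] * - x ^- 2).
    exact: (@is_derive1_comp R (horner P) (fun z : R => z^-1) x _ _ (is_derive_poly _ _) dinv).
  have dM := is_deriveM dP dexp.
  apply: (near_eq_is_derive (f := fun z : R => P.[z^-1] * expR (- z^-1))).
    near=> z; rewrite /flat [0 < z](_ : _ = true)//.
    by near: z; exact: lt_nbhsr.
  apply: (is_derive_eq dM); rewrite /flat x0 /GRing.scale/=.
  rewrite hornerM hornerXn hornerD hornerN -exprVn; ring.
have -> : flat ('X^2 * (P - P^`())) 0 = 0 by rewrite /flat ltxx.
have [A A0 hA] := flat_bound ('X * P).
have lim0 : (fun h : R => h^-1 *: ((flat P \o shift 0) (h *: 1) - flat P 0)) @ 0^' --> (0 : R).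
  apply/cvgrPdist_le => e e0; near=> h.
  have hn0 : h != 0 by near: h; exact: nbhs_dnbhs_neq.
  have he : `|h| <= e / (A + 1).
    by near: h; apply: dnbhs0_le; rewrite divr_gt0// ltr_wpDl.
  rewrite sub0r normrN /= addr0 /GRing.scale/= mulr1 {2}/flat ltxx subr0 /flat.
  case: ifPn => [h0|_]; last by rewrite mulr0 normr0 ltW.
  have := hA _ h0; rewrite hornerM hornerX -mulrA => /le_trans; apply.
  move: he; rewrite gtr0_norm// ler_pdivlMr; last by rewrite ltr_wpDl.
  by apply: le_trans; rewrite mulrC ler_pM2l// lerDl.
apply: DeriveDef; first by apply/cvg_ex; exists 0.
exact: cvg_lim lim0.
Unshelve. all: by end_near. Qed.

Lemma Ck_of_is_derive k (h dh : R -> R) :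
  (forall x, is_derive x (1 : R) h (dh x)) -> Ck k setT (dh : R^o -> R^o) ->
  Ck k.+1 setT (h : R^o -> R^o).
Proof.
move=> hd dk; split=> [x _|v].
  by have [dx _] := hd x; exact/differentiable_continuous/derivable1_diffP.
have der x : is_derive x (v : R^o) (h : R^o -> R^o) (v * dh x).
  have [dx <-] := hd x.
  have := @is_derive_scale_dir R R^o h x (1 : R^o) v dx.
  by have -> : v *: (1 : R^o) = v by exact: mulr1.
split=> [x _|]; first by have [] := der x.
rewrite (_ : 'D_v _ = fun x => v * dh x); last first.
  by apply/funext => x; have [_ <-] := der x.
by apply: CkM; [exact: openT|exact: Ck_cst|].
Qed.

Lemma Ck_flat k P : Ck k setT (flat P : R^o -> R^o).
Proof.
elim: k P => [|k ih] P.
  by apply: Ck_pred; apply: Ck_of_is_derive (is_derive_flat P) _; split => // x _;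
  have [dx _] := is_derive_flat ('X^2 * (P - P^`())) x;
  exact/differentiable_continuous/derivable1_diffP.
exact: Ck_of_is_derive (is_derive_flat P) (ih _).
Qed.

Lemma flat1_ge0 x : 0 <= flat 1 x.
Proof. by rewrite /flat; case: ifP => // _; rewrite hornerC mul1r expR_ge0. Qed.

Lemma flat1_gt0 x : 0 < x -> 0 < flat 1 x.
Proof. by move=> x0; rewrite /flat x0 hornerC mul1r expR_gt0. Qed.

Lemma flat1_le0 x : x <= 0 -> flat 1 x = 0.
Proof. by move=> x0; rewrite /flat ltNge x0. Qed.

Lemma flat1_homo x y : x <= y -> flat 1 x <= flat 1 y.
Proof.
move=> xy; have [x0|x0] := leP x 0; first by rewrite flat1_le0// flat1_ge0.
have y0 := lt_le_trans x0 xy.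
by rewrite /flat x0 y0 !hornerC !mul1r ler_expR lerN2 lef_pV2.
Qed.

Definition smooth_step x : R := flat 1 x / (flat 1 x + flat 1 (1 - x)).

Let den_gt0 x : 0 < flat 1 x + flat 1 (1 - x).
Proof.
have [x0|x0] := ltP 0 x; first by rewrite ltr_pwDl ?flat1_gt0 ?flat1_ge0.
by rewrite ltr_wpDl ?flat1_ge0// flat1_gt0//; lra.
Qed.

Lemma smooth_step_le0 x : x <= 0 -> smooth_step x = 0.
Proof. by move=> x0; rewrite /smooth_step flat1_le0 ?mul0r. Qed.

Lemma smooth_step_ge1 x : 1 <= x -> smooth_step x = 1.
Proof.
move=> x1; rewrite /smooth_step [X in _ + X]flat1_le0 ?subr_le0// addr0 divff//.
by rewrite gt_eqF// flat1_gt0//; lra.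
Qed.

Lemma smooth_step_homo x y : x <= y -> smooth_step x <= smooth_step y.
Proof.
move=> xy; rewrite /smooth_step ler_pdivrMr// mulrAC ler_pdivlMr//.
have h1 : flat 1 x <= flat 1 y := flat1_homo xy.
have h2 : flat 1 (1 - y) <= flat 1 (1 - x) by apply: flat1_homo; rewrite lerB.
have := flat1_ge0 x; have := flat1_ge0 (1 - y).
move: (flat 1 x) (flat 1 y) (flat 1 (1 - x)) (flat 1 (1 - y)) h1 h2.
by move=> a b a' b' *; nra.
Qed.

Lemma smooth_step_itv x : 0 <= smooth_step x <= 1.
Proof.
rewrite /smooth_step divr_ge0 ?flat1_ge0 ?(ltW (den_gt0 _))//=.
by rewrite ler_pdivrMr// mul1r lerDl flat1_ge0.
Qed.

Lemma Ck_smooth_step k : Ck k setT (smooth_step : R^o -> R^o).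
Proof.
have c1 : Ck k setT (fun x : R^o => flat 1 (1 - x) : R^o).
  apply: (@Ck_affine R R^o R^o (fun x => 1 - x : R^o) (fun v => - v : R^o) _ _
    k setT (flat 1)).
  - by move=> x; apply: continuousB; [exact: cst_continuous|exact: cvg_id].
  - by move=> t v x; rewrite scalerN opprD addrCA.
  - exact: Ck_flat.
apply: CkM; [exact: openT|exact: Ck_flat|].
apply: CkV; [exact: openT|by move=> x _; rewrite gt_eqF|].
by apply: CkD; [exact: openT|exact: Ck_flat|exact: c1].
Qed.

(** Defined as a derivative so that its integral is known, and so that the
    difference of two rescaled bumps has the difference of two steps, which has
    compact support, as a primitive. *)
Definition bump : R^o -> R^o := 'D_(1 : R^o) (smooth_step : R^o -> R^o).

Lemma is_derive_smooth_step x : is_derive x (1 : R) smooth_step (bump x).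
Proof. by apply: derivableP; exact: (Ck_derivable (Ck_smooth_step 1) I). Qed.

Lemma Ck_bump k : Ck k setT bump.
Proof. exact: Ck_derive (Ck_smooth_step k.+1). Qed.

Lemma bump_ge0 x : 0 <= bump x.
Proof.
have [dx _] := is_derive_smooth_step x.
have dx' := cvg_dnbhs_at_right dx.
apply: (cvgr_to_ge dx'); near=> h.
have h0 : 0 < h by near: h; exact: nbhs_right_gt.
rewrite /GRing.scale/= mulr_ge0 ?invr_ge0 ?(ltW h0)// subr_ge0 smooth_step_homo//.
by rewrite /GRing.scale/= mulr1 lerDr ltW.
Unshelve. all: by end_near. Qed.

Lemma bump_outside x : x < 0 \/ 1 < x -> bump x = 0.
Proof.
move=> x01; have [_ <-] := is_derive_smooth_step x.
case: x01 => hx.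
  rewrite (@near_eq_derive _ _ _ _ (cst 0)) ?derive_cst//.
  near=> z; apply: smooth_step_le0.
  by apply: ltW; near: z; exact: lt_nbhsl.
rewrite (@near_eq_derive _ _ _ _ (cst (1 : R^o))) ?derive_cst//.
near=> z; apply: smooth_step_ge1.
by apply: ltW; near: z; exact: lt_nbhsr.
Unshelve. all: by end_near. Qed.

Lemma bump_bounded : exists2 A : R, 1 <= A & forall x, bump x <= A.
Proof.
have bc : continuous bump by move=> x; exact: (Ck_continuous (Ck_bump 0) I).
have [c _ hc] := @EVT_max R bump 0 1 ler01 (continuous_subspaceT bc).
exists (maxr 1 (bump c)); first by rewrite le_max lexx.
move=> x; rewrite le_max; have [x01|] := boolP (x \in `[0, 1]%R).
  by rewrite hc// orbT.
rewrite in_itv/= negb_and -!ltNge => /orP x01.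
by rewrite bump_outside// ler01.
Qed.

End FlatFunctions.

(** * Integrals of products over tuples *)

Section TensorIntegral.
Context {disp : measure_display} {T : measurableType disp} {R : realType}.
Variable mu1 : {sigma_finite_measure set T -> \bar R}.

Lemma measurable_fun_tensor m (F : 'I_m -> T -> R) :
  (forall i, measurable_fun setT (F i)) ->
  measurable_fun setT (fun t : m.-tuple T => \prod_i F i (tnth t i)).
Proof.
move=> mF; apply: measurable_prod => i _.
apply: (measurableT_comp (mF i)); exact: measurable_tnth.
Qed.

Lemma integral_tensor m (F : 'I_m -> T -> R) (c : 'I_m -> R) :
  (forall i, measurable_fun setT (F i)) -> (forall i s, 0 <= F i s) ->
  (forall i, (\int[mu1]_s (F i s)%:E = (c i)%:E)%E) ->
  (\int[tuple_measure mu1 m]_t (\prod_i F i (tnth t i))%:E = (\prod_i c i)%:E)%E.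
Proof.
elim: m F c => [|m ih] F c mF F0 cE.
  rewrite /=.
  under eq_integral do rewrite big_ord0.
  by rewrite integral_cst//= diracT mul1e big_ord0.
have mP := measurable_fun_tensor mF.
pose G (x : T * m.-tuple T) : \bar R :=
  (F ord0 x.1 * \prod_i F (lift ord0 i) (tnth x.2 i))%:E.
have mtail : measurable_fun setT (fun t : m.-tuple T => \prod_i F (lift ord0 i) (tnth t i)).
  exact: (measurable_fun_tensor (fun i => mF (lift ord0 i))).
have mG0 : measurable_fun setT (fun x : T * m.-tuple T =>
    F ord0 x.1 * \prod_i F (lift ord0 i) (tnth x.2 i)).
  apply: measurable_funM.
    exact: (measurableT_comp (mF ord0) measurable_fst).
  exact: (measurableT_comp mtail measurable_snd).
have tail0 (t : m.-tuple T) : 0 <= \prod_i F (lift ord0 i) (tnth t i).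
  by apply: prodr_ge0 => i _.
transitivity (\int[mu1 \x tuple_measure mu1 m]_x G x)%E.
  rewrite /= ge0_integral_pushforward//=.
  - apply: eq_integral => x _; rewrite /G big_ord_recl /=.
    by congr ((_ * _)%:E); apply: eq_bigr => i _; rewrite tnthS.
  - exact: measurable_cons_pair.
  - exact/measurable_EFinP.
  - by move=> t _; rewrite lee_fin prodr_ge0.
rewrite fubini_tonelli1//=; last 2 first.
- exact/measurable_EFinP.
- by move=> x; rewrite lee_fin mulr_ge0.
rewrite /fubini_F big_ord_recl.
transitivity (\int[mu1]_x ((F ord0 x)%:E * (\prod_i c (lift ord0 i))%:E))%E.
  apply: eq_integral => x _ /=.
  under eq_integral do rewrite /G/= EFinM.
  rewrite ge0_integralZl//=; last 3 first.
  - exact/measurable_EFinP.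
  - by move=> t _; rewrite lee_fin.
  - by rewrite lee_fin.
  by rewrite (ih (fun i => F (lift ord0 i)) (fun i => c (lift ord0 i))).
have cprod0 : 0 <= \prod_i c (lift ord0 i).
  apply: prodr_ge0 => i _; rewrite -lee_fin -cE.
  by apply: integral_ge0 => x _; rewrite lee_fin.
rewrite ge0_integralZr//=.
- by rewrite cE EFinM.
- exact/measurable_EFinP.
- by move=> x _; rewrite lee_fin.
Qed.

End TensorIntegral.

Section YoungSplitting.
Context {disp : measure_display} {T : measurableType disp} {R : realType}.
Variable mu : {measure set T -> \bar R}.
Implicit Types (H phi Phi : T -> R).

(** Below [K] the first term dominates; above [K], x = x^(1-p) x^p is at most
    K^(1-p) x^p. *)
Lemma young_split (p K x : R) : 1 <= p -> 0 < K -> 0 <= x ->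
  x <= K + K `^ (1 - p) * x `^ p.
Proof.
move=> p1 K0 x0; have [xK|Kx] := leP x K.
  by apply: le_trans xK _; rewrite lerDl mulr_ge0 ?powR_ge0.
have xp : 0 < x := lt_trans K0 Kx.
apply: (@le_trans _ _ (K `^ (1 - p) * x `^ p)); last by rewrite lerDr ltW.
have -> : x `^ p = x * x `^ (p - 1).
  by rewrite mulr_powRB1 ?ltW//; exact: lt_le_trans p1.
rewrite mulrCA ler_peMr//.
rewrite (_ : 1 - p = - (p - 1)); last by rewrite opprB.
rewrite powRN ler_pdivlMl ?powR_gt0// mulr1.
apply: ge0_ler_powR; rewrite ?nnegrE ?subr_ge0 ?(ltW K0) ?(ltW Kx)//.
Qed.

(** The linear form of Hoelder's inequality: for the best [K] the right-hand
    side is a multiple of a^(1-1/p) c^(1/p) L^(1/p). *)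
Lemma integral_young H phi Phi (p K a c L : R) :
  1 <= p -> 0 < K -> 0 <= c ->
  measurable_fun setT H -> measurable_fun setT phi -> measurable_fun setT Phi ->
  (forall x, `|phi x| <= Phi x) -> (forall x, Phi x <= c) ->
  (\int[mu]_x (Phi x)%:E <= a%:E)%E ->
  (\int[mu]_x (`|H x| `^ p)%:E <= L%:E)%E ->
  mu.-integrable setT (EFin \o (fun x => H x * phi x)) /\
  `|\int[mu]_x (H x * phi x)| <= K * a + K `^ (1 - p) * c * L.
Proof.
move=> p1 K0 c0 mH mphi mPhi hphi hPhi ha hL.
have Phi0 x : 0 <= Phi x by exact: le_trans (hphi x).
have mHp : measurable_fun setT (fun x => `|H x| `^ p).
  by apply: (measurableT_comp (measurable_powR p)); exact: measurableT_comp.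
have mHphi : measurable_fun setT (fun x => H x * phi x) by exact: measurable_funM.
pose g x : R := K * Phi x + K `^ (1 - p) * c * `|H x| `^ p.
have Kc0 : 0 <= K `^ (1 - p) * c by rewrite mulr_ge0// powR_ge0.
have le_g x : `|H x * phi x| <= g x.
  rewrite normrM; apply: le_trans (ler_wpM2l _ (hphi x)) _ => //.
  have := ler_wpM2r (Phi0 x) (young_split p1 K0 (normr_ge0 (H x))).
  move=> /le_trans; apply; rewrite mulrDl lerD2l -mulrA -mulrA.
  by rewrite ler_wpM2l ?powR_ge0// mulrC ler_wpM2r ?powR_ge0.
have int_g : (\int[mu]_x (g x)%:E <= (K * a + K `^ (1 - p) * c * L)%:E)%E.
  rewrite (eq_integral (fun x => (K%:E * (Phi x)%:E +
      (K `^ (1 - p) * c)%:E * (`|H x| `^ p)%:E)%E)); last first.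
    by move=> x _; rewrite EFinD !EFinM.
  rewrite ge0_integralD//=; last 4 first.
  - by move=> x _; rewrite mule_ge0 ?lee_fin// ltW.
  - by apply: emeasurable_funM => //; exact/measurable_EFinP.
  - by move=> x _; rewrite mule_ge0 ?lee_fin// powR_ge0.
  - by apply: emeasurable_funM => //; exact/measurable_EFinP.
  rewrite ge0_integralZl//=; last 3 first.
  - exact/measurable_EFinP.
  - by move=> x _; rewrite lee_fin.
  - by rewrite lee_fin ltW.
  rewrite ge0_integralZl//=; last exact/measurable_EFinP.
  by rewrite EFinD !EFinM; apply: leeD; apply: lee_wpmul2l; rewrite ?lee_fin// ltW.
have abs_le : (\int[mu]_x (`|H x * phi x|)%:E <= (K * a + K `^ (1 - p) * c * L)%:E)%E.
  apply: le_trans int_g; apply: ge0_le_integral => //=.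
  - by apply/measurable_EFinP; exact: measurableT_comp.
  - apply/measurable_EFinP; apply: measurable_funD; apply: measurable_funM => //.
  - by move=> x _; rewrite lee_fin.
have intHphi : mu.-integrable setT (EFin \o (fun x => H x * phi x)).
  apply/integrableP; split; first exact/measurable_EFinP.
  by apply: le_lt_trans abs_le _; rewrite ltry.
split=> //; apply: le_trans (le_normr_Rintegral _ intHphi) _ => //.
rewrite -lee_fin /Rintegral fineK//.
rewrite ge0_fin_numE; last by apply: integral_ge0 => x _; rewrite lee_fin.
by apply: le_lt_trans abs_le _; rewrite ltry.
Qed.

End YoungSplitting.

Section ScaledBump.
Context {R : realType}.
Local Notation mu := (@lebesgue_measure R).
Implicit Types (l a s : R).

Definition scaled_bump l a s : R := l * bump (l * (s - a)).

Definition scaled_step l a s : R := smooth_step (l * (s - a)).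

Lemma is_derive_scaled_step l a s :
  is_derive s (1 : R) (scaled_step l a) (scaled_bump l a s).
Proof.
have d1 : is_derive s (1 : R) (fun s => l * (s - a)) l.
  have dB := is_deriveB (@is_derive_id R R s 1) (is_derive_cst (a : R^o) s (1 : R)).
  apply: (is_derive_eq (is_deriveZ l dB)).
  by rewrite subr0 /GRing.scale/= mulr1.
apply: (is_derive_eq (@is_derive1_comp R smooth_step (fun s => l * (s - a)) s _ _
  (is_derive_smooth_step _) d1)).
by rewrite mulrC.
Qed.

Lemma Ck_scale k (h : R^o -> R^o) l a : Ck k setT h ->
  Ck k setT (fun s : R^o => h (l * (s - a)) : R^o).
Proof.
move=> hk; apply: (@Ck_affine R R^o R^o (fun s => l * (s - a) : R^o)
  (fun v => l * v : R^o) _ _ k setT h hk).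
  move=> s; apply: (@continuousM R R^o (fun=> l) (fun s : R^o => s - a)).
    exact: cst_continuous.
  by apply: continuousB; [exact: cvg_id|exact: cst_continuous].
by move=> t v s; rewrite /GRing.scale/=; ring.
Qed.

Lemma Ck_scaled_bump k l a : Ck k setT (scaled_bump l a : R^o -> R^o).
Proof.
apply: CkM; [exact: openT|exact: Ck_cst|].
exact: Ck_scale (Ck_bump k).
Qed.

Lemma Ck_scaled_step k l a : Ck k setT (scaled_step l a : R^o -> R^o).
Proof. exact: Ck_scale (Ck_smooth_step k). Qed.

Lemma Ck_continuousR k (h : R^o -> R^o) : Ck k setT h -> continuous (h : R -> R).
Proof. by move=> hk x; exact: (Ck_continuous hk I). Qed.

Lemma measurable_scaled_bump l a : measurable_fun setT (scaled_bump l a).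
Proof.
apply: continuous_measurable_fun; exact: (Ck_continuousR (Ck_scaled_bump 0 l a)).
Qed.

Lemma scaled_bump_ge0 l a s : 0 < l -> 0 <= scaled_bump l a s.
Proof. by move=> l0; rewrite mulr_ge0 ?bump_ge0// ltW. Qed.

Lemma scaled_bump_neq0 l a s : 0 < l -> scaled_bump l a s != 0 ->
  0 <= s - a <= l^-1.
Proof.
move=> l0; apply: contraNT => h; rewrite /scaled_bump bump_outside ?mulr0//.
move: h; rewrite negb_and -!ltNge => /orP[h|h]; [left|right].
  by rewrite pmulr_rlt0.
by rewrite mulrC -ltr_pdivrMr// mul1r.
Qed.

Lemma scaled_step_diff_neq0 l a s : 0 < l ->
  scaled_step l a s - scaled_step (2 * l) a s != 0 -> 0 <= s - a <= l^-1.
Proof.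
move=> l0; apply: contraNT => h; rewrite /scaled_step subr_eq0.
move: h; rewrite negb_and -!ltNge => /orP[h|h].
  by rewrite !smooth_step_le0// nmulr_lle0// ?ltW// mulr_gt0.
have h1 : 1 <= l * (s - a) by rewrite mulrC -ler_pdivrMr// mul1r ltW.
by rewrite !smooth_step_ge1// -mulrA; lra.
Qed.

Lemma integral_scaled_bump l a : 0 < l ->
  (\int[mu]_s (scaled_bump l a s)%:E = 1)%E.
Proof.
move=> l0; pose u := a - 1; pose v := a + l^-1 + 1.
have li : 0 < l^-1 by rewrite invr_gt0.
have uv : u < v by rewrite /u /v; lra.
have cb : continuous (scaled_bump l a) := Ck_continuousR (Ck_scaled_bump 0 l a).
have cs : continuous (scaled_step l a) := Ck_continuousR (Ck_scaled_step 0 l a).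
transitivity (\int[mu]_(s in `[u, v]) (scaled_bump l a s)%:E)%E.
  rewrite [RHS]integral_mkcond; apply: eq_integral => s _.
  rewrite patchE; case: ifPn => // suv; apply/eqP; rewrite eqe; apply: contraNT suv.
  move=> /(scaled_bump_neq0 l0) sa; rewrite inE /= in_itv /= /u /v; lra.
rewrite (@continuous_FTC2 R (scaled_bump l a) (scaled_step l a) u v uv).
- rewrite /scaled_step smooth_step_ge1; last first.
    rewrite /v (_ : _ - a = l^-1 + 1); last by ring.
    by rewrite mulrDr mulr1 divff ?gt_eqF// lerDl ltW.
  rewrite smooth_step_le0 ?sube0// /u (_ : _ - a = -1); last by ring.
  by rewrite mulrN1 oppr_le0 ltW.
- exact: continuous_subspaceT.
- split.
  + by move=> s _; have [] := is_derive_scaled_step l a s.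
  + by apply: cvg_at_right_filter; exact: cs.
  + by apply: cvg_at_left_filter; exact: cs.
- by move=> s _; rewrite derive1E; have [_ ->] := is_derive_scaled_step l a s.
Qed.

Lemma integral_itv_indicator a l : 0 < l ->
  (\int[mu]_s (\1_(`[a, (a + l^-1)]%classic) s : R)%:E = (l^-1)%:E)%E.
Proof.
move=> l0; rewrite integral_indic//= setIT lebesgue_measure_itv/= lte_fin.
by rewrite ltrDl invr_gt0 l0 -EFinD addrAC subrr add0r.
Qed.

End ScaledBump.

(** * Differences of weighted averages *)

Ltac integral_side := try solve
  [ exact/measurable_EFinP
  | by move=> ? _; rewrite lee_fin ?mulr_ge0
  | by rewrite lee_fin ?mulr_ge0 // ltW ].

Section WeightedAverages.
Context {disp : measure_display} {T : measurableType disp} {R : realType}.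
Variable mu : {sigma_finite_measure set T -> \bar R}.
Variables (H E E' : T -> R) (quot : T * T -> R) (p : R).
Hypothesis p1 : 1 <= p.
Hypotheses (mH : measurable_fun setT H) (mE : measurable_fun setT E)
  (mE' : measurable_fun setT E') (mq : measurable_fun setT quot).
Hypotheses (E0 : forall t, 0 <= E t) (E'0 : forall t, 0 <= E' t)
  (q0 : forall z, 0 <= quot z).
Hypotheses (iE : (\int[mu]_t (E t)%:E = 1)%E) (iE' : (\int[mu]_t (E' t)%:E = 1)%E).

Lemma integrable_weight (w : T -> R) : measurable_fun setT w ->
  (forall t, 0 <= w t) -> (\int[mu]_t (w t)%:E = 1)%E ->
  mu.-integrable setT (EFin \o w).
Proof.
move=> mw w0 iw; apply/integrableP; split; first exact/measurable_EFinP.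
rewrite (eq_integral (fun t => (w t)%:E)) ?iw ?ltry//.
by move=> t _; rewrite /= ger0_norm.
Qed.

Lemma integrable_scale (w : T -> R) (c : R) : mu.-integrable setT (EFin \o w) ->
  mu.-integrable setT (EFin \o (fun t => c * w t)).
Proof.
move=> iw; have -> : EFin \o (fun t => c * w t) = (fun t => c%:E * (EFin \o w) t)%E.
  by apply/funext => t; rewrite /= EFinM.
exact: integrableZl.
Qed.

Lemma Rintegral_weight (w : T -> R) (c : R) : mu.-integrable setT (EFin \o w) ->
  (\int[mu]_t (w t)%:E = 1)%E -> \int[mu]_t (c * w t) = c.
Proof. by move=> iw w1; rewrite RintegralZl// /Rintegral w1 mulr1. Qed.

Lemma average_minus (w : T -> R) (c : R) :
  mu.-integrable setT (EFin \o w) -> (\int[mu]_t (w t)%:E = 1)%E ->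
  mu.-integrable setT (EFin \o (fun t => H t * w t)) ->
  mu.-integrable setT (EFin \o (fun t => (H t - c) * w t)) /\
  \int[mu]_t (H t * w t) - c = \int[mu]_t ((H t - c) * w t).
Proof.
move=> iw w1 iHw; have icw := integrable_scale c iw.
have e : (fun t => (H t - c) * w t) = (fun t => H t * w t - c * w t).
  by apply/funext => t; rewrite mulrBl.
split.
  have := integrableB measurableT iHw icw.
  by rewrite e; congr (integrable _ _ _); apply/funext => t; rewrite /= EFinB.
by rewrite e RintegralB// (Rintegral_weight _ iw w1).
Qed.

Lemma abs_Rintegral_le (w : T -> R) : mu.-integrable setT (EFin \o w) ->
  ((`|\int[mu]_t w t|)%:E <= \int[mu]_t (`|w t|)%:E)%E.
Proof.
move=> iw; have inw : mu.-integrable setT (EFin \o (fun t => `|w t|)).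
  exact: (integrable_norm iw).
apply: (@le_trans _ _ (\int[mu]_t `|w t|)%:E).
  by rewrite lee_fin le_normr_Rintegral.
by rewrite /Rintegral fineK// integrable_fin_num.
Qed.

(** The difference of two averages of [H] is the average of H t - H t' over
    the product of the weights; [young_split] turns it into the integral of the
    p-th power, which the weights compare with [quot]. *)
Lemma average_diff_bound (K C L : R) :
  0 < K -> 0 <= C ->
  mu.-integrable setT (EFin \o (fun t => H t * E t)) ->
  mu.-integrable setT (EFin \o (fun t => H t * E' t)) ->
  (forall t t', E t * E' t' * `|H t - H t'| `^ p <= C * quot (t, t')) ->
  (\int[mu]_t \int[mu]_t' (quot (t, t'))%:E <= L%:E)%E ->
  `|\int[mu]_t (H t * E t) - \int[mu]_t (H t * E' t)| <=
  K + K `^ (1 - p) * C * L.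
Proof.
move=> K0 C0 iHE iHE' hq hL.
have intE := integrable_weight mE E0 iE.
have intE' := integrable_weight mE' E'0 iE'.
set a' := \int[mu]_t (H t * E' t).
have K10 : 0 <= K `^ (1 - p) by exact: powR_ge0.
have K1C : 0 <= K `^ (1 - p) * C by rewrite mulr_ge0.
have pw t t' : E t * (`|H t - H t'| * E' t') <=
    K * E t * E' t' + K `^ (1 - p) * C * quot (t, t').
  have EE0 : 0 <= E t * E' t' by rewrite mulr_ge0.
  have := ler_wpM2l EE0 (young_split p1 K0 (normr_ge0 (H t - H t'))).
  have := ler_wpM2l K10 (hq t t').
  lra.
have mqt t : measurable_fun setT (fun t' => quot (t, t')).
  by apply: measurableT_comp.
have inner t : ((`|(H t - a') * E t|)%:E <= (K * E t)%:E +
    (K `^ (1 - p) * C)%:E * \int[mu]_t' (quot (t, t'))%:E)%E.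
  have [iHt eHt] := average_minus (H t) intE' iE' iHE'.
  have mHt : measurable_fun setT (fun t' => `|H t - H t'| * E' t').
    apply: measurable_funM => //; apply: measurableT_comp => //.
    by apply: measurable_funB.
  apply: (@le_trans _ _ (\int[mu]_t' (E t * (`|H t - H t'| * E' t'))%:E)%E).
    under eq_integral do rewrite EFinM.
    rewrite ge0_integralZl//=; integral_side.
    rewrite normrM (ger0_norm (E0 t)) mulrC EFinM.
    apply: lee_wpmul2l; first by rewrite lee_fin.
    rewrite distrC eHt; apply: le_trans (abs_Rintegral_le iHt) _.
    rewrite le_eqVlt; apply/orP; left; apply/eqP.
    by apply: eq_integral => t' _; rewrite normrM distrC (ger0_norm (E'0 _)).
  apply: (@le_trans _ _ (\int[mu]_t' ((K * E t)%:E * (E' t')%:E +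
      (K `^ (1 - p) * C)%:E * (quot (t, t'))%:E))%E).
    apply: ge0_le_integral => //=.
    - by move=> t' _; rewrite lee_fin !mulr_ge0.
    - by apply/measurable_EFinP; exact: measurable_funM.
    - by apply: emeasurable_funD; apply: emeasurable_funM => //; exact/measurable_EFinP.
    - by move=> t' _; rewrite -!EFinM -EFinD lee_fin pw.
  have KE : 0 <= K * E t by rewrite mulr_ge0// ltW.
  rewrite ge0_integralD//=; last 4 first.
  - by move=> t' _; rewrite -EFinM lee_fin mulr_ge0.
  - by apply: emeasurable_funM => //; exact/measurable_EFinP.
  - by move=> t' _; rewrite -EFinM lee_fin mulr_ge0.
  - by apply: emeasurable_funM => //; exact/measurable_EFinP.
  rewrite ge0_integralZl//=; integral_side.
  rewrite ge0_integralZl//=; integral_side.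
  by rewrite iE' mule1.
have mouter : measurable_fun setT (fun t => \int[mu]_t' (quot (t, t'))%:E)%E.
  apply: (@measurable_fun_fubini_tonelli_F _ _ T T R mu (EFin \o quot)).
    exact/measurable_EFinP.
  by move=> z; rewrite lee_fin.
have outer0 t : (0 <= \int[mu]_t' (quot (t, t'))%:E)%E.
  by apply: integral_ge0 => t' _; rewrite lee_fin.
have [iHa eHa] := average_minus a' intE iE iHE.
rewrite eHa -lee_fin; apply: le_trans (abs_Rintegral_le iHa) _.
apply: (@le_trans _ _ (\int[mu]_t ((K * E t)%:E +
    (K `^ (1 - p) * C)%:E * \int[mu]_t' (quot (t, t'))%:E))%E).
  apply: ge0_le_integral => //=.
  - apply/measurable_EFinP; apply: measurableT_comp => //.
    by apply: measurable_funM => //; exact: measurable_funB.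
  - apply: emeasurable_funD; first by apply/measurable_EFinP; exact: measurable_funM.
    exact: emeasurable_funM.
rewrite ge0_integralD//=; last 4 first.
- by move=> t _; rewrite lee_fin mulr_ge0// ltW.
- by apply/measurable_EFinP; exact: measurable_funM.
- by move=> t _; rewrite mule_ge0// lee_fin.
- exact: emeasurable_funM.
rewrite (ge0_integralZl _ _ mouter)//=; integral_side.
rewrite EFinD; apply: leeD.
  under eq_integral do rewrite EFinM.
  rewrite ge0_integralZl//=; integral_side.
  by rewrite iE mule1.
by rewrite [in leRHS]EFinM; apply: lee_wpmul2l; rewrite ?lee_fin.
Qed.

End WeightedAverages.

(** * Averages and the Slobodetskij seminorm *)

Section Mollifier.
Context {R : realType} {m : nat}.
Local Notation T := (m.-tuple (measurableTypeR R)).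
Local Notation mu := (leb R m).
Implicit Types (h : 'rV[R]_m -> R^o) (y : 'rV[R]_m) (l : R) (t : T).

(** A mollifier supported in the cube with lower corner [y] and side [l^-1]. *)
Definition eta l y t : R := \prod_i scaled_bump l (y ord0 i) (tnth t i).


Lemma measurable_eta l y : measurable_fun setT (eta l y).
Proof.
exact: (measurable_fun_tensor (fun i => measurable_scaled_bump l (y ord0 i))).
Qed.

Lemma eta_ge0 l y t : 0 < l -> 0 <= eta l y t.
Proof. by move=> l0; apply: prodr_ge0 => i _; exact: scaled_bump_ge0. Qed.

Lemma integral_eta l y : 0 < l -> (\int[mu]_t (eta l y t)%:E = 1)%E.
Proof.
move=> l0; have := @integral_tensor _ (measurableTypeR R) R (@lebesgue_measure R) m
  (fun i => scaled_bump l (y ord0 i)) (fun=> 1)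
  (fun i => measurable_scaled_bump l (y ord0 i)).
rewrite big1_eq; apply.
  by move=> i s; exact: scaled_bump_ge0.
by move=> i; exact: integral_scaled_bump.
Qed.

Lemma eta_le l y t (A : R) : 0 < l -> (forall x : R, bump x <= A) ->
  eta l y t <= (l * A) ^+ m.
Proof.
move=> l0 hA; rewrite /eta -[X in _ ^+ X]card_ord -prodr_const.
apply: ler_prod => i _; rewrite scaled_bump_ge0//= /scaled_bump.
by rewrite ler_pM2l.
Qed.

Lemma eta_neq0 l y t : 0 < l -> eta l y t != 0 ->
  forall i, 0 <= tnth t i - y ord0 i <= l^-1.
Proof.
move=> l0 /prodf_neq0 h i; apply: scaled_bump_neq0 => //.
exact: h.
Qed.

Lemma measurable_rowt_dist : measurable_fun setT
  (fun z : T * T => enorm (rowt z.1 - rowt z.2)).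
Proof.
apply: (measurableT_comp (continuous_measurable_fun (@sqrt_continuous R))).
apply: measurable_sum => i.
have mi : measurable_fun setT
    (fun z : T * T => (rowt z.1 - rowt z.2) ord0 i : R).
  rewrite (_ : (fun _ => _) = (fun z : T * T => tnth z.1 i - tnth z.2 i)); last first.
    by apply/funext => z; rewrite !mxE.
  apply: measurable_funB.
    exact: (measurableT_comp (measurable_tnth i) measurable_fst).
  exact: (measurableT_comp (measurable_tnth i) measurable_snd).
exact: measurable_funM.
Qed.

Lemma Lp_norm_integral p h (N : R) : 1 <= p -> 0 <= N ->
  (Lp_norm p h <= N%:E)%E ->
  (\int[mu]_t (`|h (rowt t)| `^ p)%:E <= (N `^ p)%:E)%E.
Proof.
move=> p1 N0 hN; have p0 : p != 0 by rewrite gt_eqF// (lt_le_trans ltr01).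
have -> : (\int[mu]_t (`|h (rowt t)| `^ p)%:E = Lp_norm p h `^ p)%E.
  by rewrite /Lp_norm powR_Lnorm//; apply: eq_integral => t _; rewrite -poweR_EFin.
rewrite -poweR_EFin.
apply: gt0_ler_poweR => //; rewrite ?in_itv/= ?leey ?andbT ?Lnorm_ge0 ?lee_fin//.
by apply: le_trans p1.
Qed.

Lemma diff_of_close (a b c k : R) : 0 <= a - c -> a - c <= k -> 0 <= b - c ->
  b - c <= k -> - k <= a - b <= k.
Proof. by move=> *; apply/andP; split; lra. Qed.

Lemma enorm_eq0 y : enorm y = 0 -> y = 0.
Proof.
by move=> y0; apply: dotp_eq0; rewrite -[LHS]sqr_sqrtr ?dotp_ge0// -/(enorm y) y0 expr0n.
Qed.

Lemma enorm_le_cube (a : R) y : 0 <= a -> (forall i, `|y ord0 i| <= a) ->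
  enorm y <= Num.sqrt m%:R * a.
Proof.
move=> a0 ya; rewrite -[X in _ * X](ger0_norm a0) -sqrtr_sqr -sqrtrM//.
rewrite ler_wsqrtr//.
have -> : m%:R * a ^+ 2 = \sum_(i < m) a ^+ 2.
  by rewrite sumr_const card_ord mulr_natl.
apply: ler_sum => i _; rewrite -expr2 -(real_normK (num_real (y ord0 i))).
by rewrite ler_pXn2r// nnegrE.
Qed.

(** The estimates use only the integrals of products under the measure, so they
    hold for every measure that integrates the mollifiers to 1. *)
Section AbstractMeasure.
Variable nu : {sigma_finite_measure set T -> \bar R}.
Hypothesis nu_eta : forall l y, 0 < l -> (\int[nu]_t (eta l y t)%:E = 1)%E.

Definition slob_quot (p e : R) (h : 'rV[R]_m -> R^o) (z : T * T) : R :=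
  `|h (rowt z.1) - h (rowt z.2)| `^ p / enorm (rowt z.1 - rowt z.2) `^ e.

Lemma measurable_slob_quot (p e : R) h :
  measurable_fun setT (h \o rowt : T -> R) -> measurable_fun setT (slob_quot p e h).
Proof.
move=> mh; have -> : slob_quot p e h = (fun z =>
    `|h (rowt z.1) - h (rowt z.2)| `^ p * enorm (rowt z.1 - rowt z.2) `^ (- e)).
  by apply/funext => z; rewrite powRN.
apply: measurable_funM.
  apply: (measurableT_comp (measurable_powR p)); apply: measurableT_comp => //.
  apply: measurable_funB.
    exact: (measurableT_comp mh measurable_fst).
  exact: (measurableT_comp mh measurable_snd).
exact: (measurableT_comp (measurable_powR (- e)) measurable_rowt_dist).
Qed.

Lemma slob_quot_ge0 (p e : R) h z : 0 <= slob_quot p e h z.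
Proof. by rewrite /slob_quot mulr_ge0 ?invr_ge0 ?powR_ge0. Qed.

(** On the supports of the two mollifiers the points are within sqrt m / l of
    each other, which bounds the numerator of the Slobodetskij quotient by
    a power of 1/l times the quotient. *)
Lemma eta_slob_quot (A l p e : R) h y t t' :
  0 < l -> 0 <= A -> 0 < p -> 0 <= e -> (forall x : R, bump x <= A) ->
  eta l y t * eta (2 * l) y t' * `|h (rowt t) - h (rowt t')| `^ p <=
  (l * A) ^+ m * (2 * l * A) ^+ m * (Num.sqrt m%:R * l^-1) `^ e *
  slob_quot p e h (t, t').
Proof.
move=> l0 A0 p0 e0 hA; have l20 : 0 < 2 * l by rewrite mulr_gt0.
have E0 := eta_ge0 y t l0; have E'0 := eta_ge0 y t' l20.
have c1 : 0 <= (l * A) ^+ m by rewrite exprn_ge0// mulr_ge0// ltW.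
have c2 : 0 <= (2 * l * A) ^+ m by rewrite exprn_ge0// mulr_ge0// ltW.
have C0 := mulr_ge0 (mulr_ge0 (mulr_ge0 c1 c2)
  (powR_ge0 (Num.sqrt m%:R * l^-1) e)) (slob_quot_ge0 p e h (t, t')).
have [Et|Et] := eqVneq (eta l y t) 0; first by rewrite Et !mul0r.
have [Et'|Et'] := eqVneq (eta (2 * l) y t') 0; first by rewrite Et' mulr0 mul0r.
have [tt'|tt'] := eqVneq (enorm (rowt t - rowt t')) 0.
  have -> : rowt t = rowt t' by apply/eqP; rewrite -subr_eq0; exact/eqP/enorm_eq0.
  by rewrite subrr normr0 powR0 ?gt_eqF// mulr0.
have en0 : 0 < enorm (rowt t - rowt t') by rewrite lt_neqAle eq_sym tt' sqrtr_ge0.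
have li0 : 0 <= l^-1 by rewrite invr_ge0 ltW.
have en_le : enorm (rowt t - rowt t') <= Num.sqrt m%:R * l^-1.
  apply: enorm_le_cube => // i; rewrite !mxE ler_norml.
  have := eta_neq0 l0 Et i; have := eta_neq0 l20 Et' i.
  rewrite invfM => /andP[h1 h2] /andP[h3 h4].
  have h5 : 2^-1 * l^-1 <= l^-1 by rewrite ler_piMl// invf_le1// ler1n.
  exact: (diff_of_close h3 h4 h1 (le_trans h2 h5)).
have -> : `|h (rowt t) - h (rowt t')| `^ p =
    enorm (rowt t - rowt t') `^ e * slob_quot p e h (t, t').
  by rewrite /slob_quot /= mulrC divfK// gt_eqF// powR_gt0.
have s0 : 0 <= Num.sqrt (m%:R : R) * l^-1 by rewrite mulr_ge0 ?sqrtr_ge0.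
rewrite mulrA; apply: (ler_wpM2r (slob_quot_ge0 p e h (t, t'))).
apply: (ler_pM (mulr_ge0 E0 E'0) (powR_ge0 _ _)).
  exact: (ler_pM E0 E'0 (eta_le y t l0 hA) (eta_le y t' l20 hA)).
by apply: (ge0_ler_powR e0); rewrite ?nnegrE ?sqrtr_ge0.
Qed.

Lemma integrable_mul_eta (A l p L0 : R) h y : 1 <= p -> 0 < l -> 0 <= A ->
  (forall x : R, bump x <= A) -> measurable_fun setT (h \o rowt : T -> R) ->
  (\int[nu]_t (`|h (rowt t)| `^ p)%:E <= L0%:E)%E ->
  nu.-integrable setT (EFin \o (fun t => h (rowt t) * eta l y t)) /\
  forall K : R, 0 < K -> `|\int[nu]_t (h (rowt t) * eta l y t)| <=
    K + K `^ (1 - p) * (l * A) ^+ m * L0.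
Proof.
move=> p1 l0 A0 hA mh hL.
have c0 : 0 <= (l * A) ^+ m by rewrite exprn_ge0// mulr_ge0// ltW.
have me := measurable_eta l y.
have abs_eta t : `|eta l y t| <= eta l y t by rewrite ger0_norm// eta_ge0.
have le_eta t : eta l y t <= (l * A) ^+ m by exact: eta_le.
have ie : (\int[nu]_t (eta l y t)%:E <= 1%:E)%E by rewrite nu_eta.
have young K (K0 : 0 < K) := integral_young p1 K0 c0 mh me me abs_eta le_eta ie hL.
split; first by have [] := young 1 ltr01.
by move=> K K0; have [_] := young K K0; rewrite mulr1.
Qed.

Lemma mollify_increment_slob (A l K p e L0 L : R) h y :
  1 <= p -> 0 < l -> 0 < K -> 0 <= A -> 0 <= e -> (forall x : R, bump x <= A) ->
  measurable_fun setT (h \o rowt : T -> R) ->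
  (\int[nu]_t (`|h (rowt t)| `^ p)%:E <= L0%:E)%E ->
  (\int[nu]_t \int[nu]_t' (slob_quot p e h (t, t'))%:E <= L%:E)%E ->
  `|\int[nu]_t (h (rowt t) * eta l y t) - \int[nu]_t (h (rowt t) * eta (2 * l) y t)| <=
  K + K `^ (1 - p) * ((l * A) ^+ m * (2 * l * A) ^+ m *
    (Num.sqrt m%:R * l^-1) `^ e) * L.
Proof.
move=> p1 l0 K0 A0 e0 hA mh hL0 hL; have l20 : 0 < 2 * l by rewrite mulr_gt0.
have p0 : 0 < p := lt_le_trans ltr01 p1.
have [iE _] := integrable_mul_eta y p1 l0 A0 hA mh hL0.
have [iE' _] := integrable_mul_eta y p1 l20 A0 hA mh hL0.
have C0 : 0 <= (l * A) ^+ m * (2 * l * A) ^+ m * (Num.sqrt m%:R * l^-1) `^ e.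
  have c1 : 0 <= (l * A) ^+ m by rewrite exprn_ge0// mulr_ge0// ltW.
  have c2 : 0 <= (2 * l * A) ^+ m by rewrite exprn_ge0// mulr_ge0// ltW.
  by rewrite mulr_ge0 ?powR_ge0 ?mulr_ge0.
have eq_le t t' := @eta_slob_quot A l p e h y t t' l0 A0 p0 e0 hA.
exact: (average_diff_bound p1 mh (measurable_eta l y) (measurable_eta (2 * l) y)
  (measurable_slob_quot p e mh) (fun t => eta_ge0 y t l0)
  (fun t => eta_ge0 y t l20) (slob_quot_ge0 p e h) (nu_eta y l0) (nu_eta y l20)
  K0 C0 iE iE' eq_le hL).
Qed.

End AbstractMeasure.

End Mollifier.

(** * Averages and weak derivatives *)

Section TensorTestFunctions.
Context {R : realType} {m : nat}.
Local Notation T := (m.-tuple (measurableTypeR R)).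
Implicit Types (y : 'rV[R]_m) (g : 'I_m -> R -> R).

Definition tensor g y : R^o := \prod_j g j (y ord0 j).

Lemma Ck_tensor k g : (forall j, Ck k setT (g j : R^o -> R^o)) ->
  Ck k setT (tensor g).
Proof.
move=> gk; apply: Ck_prod => [|j]; first exact: openT.
apply: (@Ck_affine R 'rV[R]_m R^o (fun y => y ord0 j : R^o)
  (fun y => y ord0 j : R^o) _ _ k setT (g j) (gk j)).
- by move=> y; exact: (@coord_continuous R 1 m ord0 j y).
- by move=> t v y; rewrite !mxE.
Qed.

Lemma partial_tensor g dg i y : (forall j, Ck 1 setT (g j : R^o -> R^o)) ->
  (forall s, is_derive s (1 : R) (g i) (dg s)) ->
  partial i (tensor g) y = tensor (fun j => if j == i then dg else g j) y.
Proof.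
move=> gk hg; rewrite /partial.
pose c := \prod_(j | j != i) g j (y ord0 j).
have line (a : R) : tensor g (y + a *: ebasis i) = g i (y ord0 i + a) * c.
  rewrite /tensor (bigD1 i)//= !mxE !eqxx mulr1; congr (_ * _).
  by apply: eq_bigr => j ji; rewrite !mxE eqxx (negPf ji) mulr0 addr0.
have d1 : is_derive (0 : R) (1 : R) (fun a => y ord0 i + a) 1.
  have := is_deriveD (is_derive_cst (y ord0 i : R^o) (0 : R) (1 : R)) (@is_derive_id R R 0 1).
  by rewrite add0r.
have d2 := @is_derive1_comp R (g i) (fun a => y ord0 i + a) 0 _ _ (hg _) d1.
have d3 : is_derive (0 : R) (1 : R) (fun a : R => tensor g (y + a *: ebasis i))
    (dg (y ord0 i) * c).
  have -> : (fun a : R => tensor g (y + a *: ebasis i)) =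
      c \*: (g i \o (fun a => y ord0 i + a)).
    by apply/funext => a; rewrite line mulrC.
  apply: (is_derive_eq (is_deriveZ c d2)).
  by rewrite addr0 mulr1 /GRing.scale/= mulrC.
have [_ ->] := @is_derive_line0 R 'rV[R]_m R^o (tensor g) y (ebasis i) _ d3.
rewrite /tensor [RHS](bigD1 i)//= eqxx; congr (_ * _).
by apply: eq_bigr => j ji; rewrite (negPf ji).
Qed.

Lemma tensor_neq0 g y : tensor g y != 0 -> forall j, g j (y ord0 j) != 0.
Proof. by move=> /prodf_neq0 h j; exact: h. Qed.

Lemma test_fun_tensor g y (a : R) :
  (forall k j, Ck k setT (g j : R^o -> R^o)) ->
  (forall j s, g j s != 0 -> 0 <= s - y ord0 j <= a) ->
  test_fun (tensor g).
Proof.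
move=> gk supp; split; first by move=> k; exact: Ck_tensor.
exists (`|y| + `|a|) => x; rewrite ltNge; apply: contraNeq => /tensor_neq0 gx.
apply: normr_row_le; first by rewrite addr_ge0.
move=> j; have := supp _ _ (gx j) => /andP[h1 h2].
have -> : x ord0 j = y ord0 j + (x ord0 j - y ord0 j) by ring.
apply: le_trans (ler_normD _ _) _; apply: lerD; first exact: normr_coord_le.
by rewrite ger0_norm//; apply: le_trans h2 (ler_norm _).
Qed.

Lemma tensor_rowt g (t : T) : tensor g (rowt t) = \prod_j g j (tnth t j).
Proof. by apply: eq_bigr => j _; rewrite mxE. Qed.

End TensorTestFunctions.

Section WeakIncrement.
Context {R : realType} {m : nat}.
Local Notation T := (m.-tuple (measurableTypeR R)).
Variable nu : {sigma_finite_measure set T -> \bar R}.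
Hypothesis nu_tensor : forall (F : 'I_m -> R -> R) (c : 'I_m -> R),
  (forall i, measurable_fun setT (F i)) -> (forall i s, 0 <= F i s) ->
  (forall i, (\int[@lebesgue_measure R]_s (F i s)%:E = (c i)%:E)%E) ->
  (\int[nu]_t (\prod_i F i (tnth t i))%:E = (\prod_i c i)%:E)%E.
Variables (p A l L0 L : R) (h : 'rV[R]_m -> R^o) (w : 'I_m -> 'rV[R]_m -> R^o)
  (y : 'rV[R]_m).
Hypotheses (p1 : 1 <= p) (l0 : 0 < l) (A1 : 1 <= A)
  (hA : forall x : R, bump x <= A).
Hypothesis mh : measurable_fun setT (h \o rowt : T -> R).
Hypothesis mw : forall i, measurable_fun setT (w i \o rowt : T -> R).
Hypothesis h_Lp : (\int[nu]_t (`|h (rowt t)| `^ p)%:E <= L0%:E)%E.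
Hypothesis w_Lp : forall i, (\int[nu]_t (`|w i (rowt t)| `^ p)%:E <= L%:E)%E.
Hypothesis weak : forall i phi, test_fun phi ->
  \int[nu]_t (h (rowt t) * partial i phi (rowt t)) =
  - \int[nu]_t (w i (rowt t) * phi (rowt t)).

Let l20 : 0 < 2 * l. Proof. by rewrite mulr_gt0. Qed.

Let l_le : l <= 2 * l.
Proof. by rewrite ler_peMl ?ler1n// ltW. Qed.

Let A0 : 0 < A. Proof. exact: lt_le_trans ltr01 A1. Qed.

(** Interpolates between the mollifiers at the two scales, changing one
    coordinate at a time. *)
Definition hybrid (k : nat) (j : 'I_m) : R -> R :=
  if (j < k)%N then scaled_bump l (y ord0 j) else scaled_bump (2 * l) (y ord0 j).

(** Its i-th factor is a primitive of the difference of the bumps at the two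
    scales, hence its i-th partial derivative is the difference of consecutive
    hybrids, and the factor is bounded by 1 with support of length 1/l. *)
Definition hybrid_primitive (i j : 'I_m) : R -> R :=
  if j == i then
    (fun s => scaled_step l (y ord0 j) s - scaled_step (2 * l) (y ord0 j) s)
  else hybrid i j.

Let hybrid_ge0 k j s : 0 <= hybrid k j s.
Proof. by rewrite /hybrid; case: ifP => _; exact: scaled_bump_ge0. Qed.

Let hybrid_le k j s : hybrid k j s <= 2 * l * A.
Proof.
have b0 x : 0 <= bump (x : R) := bump_ge0 x.
rewrite /hybrid /scaled_bump; case: ifP => _; last by rewrite ler_pM2l.
apply: ler_pM => //; exact: ltW.
Qed.

Let measurable_hybrid k j : measurable_fun setT (hybrid k j).
Proof. by rewrite /hybrid; case: ifP => _; exact: measurable_scaled_bump. Qed.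

Let Ck_hybrid n k j : Ck n setT (hybrid k j : R^o -> R^o).
Proof. by rewrite /hybrid; case: ifP => _; exact: Ck_scaled_bump. Qed.

Let hybrid_neq0 k j s : hybrid k j s != 0 -> 0 <= s - y ord0 j <= l^-1.
Proof.
rewrite /hybrid; case: ifP => _; first exact: scaled_bump_neq0.
move=> /(scaled_bump_neq0 l20)/andP[-> h2]; apply: le_trans h2 _.
by rewrite lef_pV2 ?posrE.
Qed.

Let integral_hybrid k j : (\int[@lebesgue_measure R]_s (hybrid k j s)%:E = 1)%E.
Proof. by rewrite /hybrid; case: ifP => _; exact: integral_scaled_bump. Qed.

Let Ck_primitive n i j : Ck n setT (hybrid_primitive i j : R^o -> R^o).
Proof.
rewrite /hybrid_primitive; case: ifP => _; last exact: Ck_hybrid.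
apply: CkD; [exact: openT|exact: Ck_scaled_step|].
have -> : (fun s : R^o => - scaled_step (2 * l) (y ord0 j) s : R^o) =
  (fun s => (-1) * scaled_step (2 * l) (y ord0 j) s).
  by apply/funext => s; rewrite mulN1r.
by apply: CkM; [exact: openT|exact: Ck_cst|exact: Ck_scaled_step].
Qed.

Let primitive_neq0 i j s : hybrid_primitive i j s != 0 -> 0 <= s - y ord0 j <= l^-1.
Proof.
rewrite /hybrid_primitive; case: ifP => _; last exact: hybrid_neq0.
exact: scaled_step_diff_neq0.
Qed.

Let test_primitive i : test_fun (tensor (hybrid_primitive i)).
Proof.
apply: (@test_fun_tensor R m _ y l^-1); first by move=> k j; exact: Ck_primitive.
by move=> j s; exact: primitive_neq0.
Qed.

Let partial_primitive (i : 'I_m) t :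
  partial i (tensor (hybrid_primitive i)) (rowt t) =
  tensor (hybrid i.+1) (rowt t) - tensor (hybrid i) (rowt t).
Proof.
have dprim (s : R) : is_derive s (1 : R) (hybrid_primitive i i)
    (scaled_bump l (y ord0 i) s - scaled_bump (2 * l) (y ord0 i) s).
  rewrite /hybrid_primitive eqxx.
  exact: is_deriveB (is_derive_scaled_step _ _ _) (is_derive_scaled_step _ _ _).
rewrite (partial_tensor (g := hybrid_primitive i) (rowt t)
  (fun j => Ck_primitive 1 i j) dprim).
rewrite /tensor (bigD1 i)//= eqxx [in RHS](bigD1 i)//=.
rewrite [X in _ = _ - X](bigD1 i)//= /hybrid ltnSn ltnn mulrBl.
congr (_ * _ - _ * _); apply: eq_bigr => j ji.
  rewrite (negPf ji) /hybrid_primitive (negPf ji) /hybrid.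
  by rewrite ltnS (leq_eqVlt (nat_of_ord j)) -[(_ == _ :> nat)]/(j == i) (negPf ji).
by rewrite (negPf ji) /hybrid_primitive (negPf ji).
Qed.

Let dominating (i j : 'I_m) : R -> R :=
  if j == i then \1_(`[y ord0 j, (y ord0 j + l^-1)]%classic) else hybrid i j.

Let abs_primitive_le i j s : `|hybrid_primitive i j s| <= dominating i j s.
Proof.
rewrite /hybrid_primitive /dominating; case: ifP => _; last by rewrite ger0_norm.
have [->|ne] := eqVneq (scaled_step l (y ord0 j) s - scaled_step (2 * l) (y ord0 j) s) 0.
  by rewrite normr0 indicE.
have /andP[h1 h2] := scaled_step_diff_neq0 l0 ne.
rewrite indicE mem_set /=; last by rewrite in_itv/= -subr_ge0 h1 -lerBlDl.
have /andP[a0 a1] := smooth_step_itv (l * (s - y ord0 j)).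
have /andP[b0 b1] := smooth_step_itv (2 * l * (s - y ord0 j)).
by rewrite /scaled_step ler_norml; apply/andP; split; lra.
Qed.

Lemma integrable_hybrid k : nu.-integrable setT
  (EFin \o (fun t : T => h (rowt t) * tensor (hybrid k) (rowt t))).
Proof.
have c0 : 0 <= (2 * l * A) ^+ m by rewrite exprn_ge0// mulr_ge0// ltW.
have mt : measurable_fun setT (fun t : T => tensor (hybrid k) (rowt t) : R).
  rewrite (_ : (fun _ => _) = (fun t : T => \prod_j hybrid k j (tnth t j))).
    exact: (measurable_fun_tensor (measurable_hybrid k)).
  by apply/funext => t; rewrite tensor_rowt.
have abst t : `|tensor (hybrid k) (rowt t)| <= tensor (hybrid k) (rowt t).
  by rewrite ger0_norm// prodr_ge0.
have le_t t : tensor (hybrid k) (rowt t) <= (2 * l * A) ^+ m.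
  rewrite /tensor -[X in _ ^+ X]card_ord -prodr_const.
  by apply: ler_prod => j _; rewrite hybrid_ge0 hybrid_le.
have it : (\int[nu]_t (tensor (hybrid k) (rowt t))%:E <= 1%:E)%E.
  under eq_integral do rewrite tensor_rowt.
  have := nu_tensor (measurable_hybrid k) (hybrid_ge0 k) (integral_hybrid k).
  by rewrite big1_eq => ->.
by have [] := integral_young p1 ltr01 c0 mh mt mt abst le_t it h_Lp.
Qed.

(** Integrating by parts moves the derivative to [h].  The gain of a factor
    1/l over the mollifier comes from the i-th factor of the primitive. *)
Lemma hybrid_increment (i : 'I_m) (K : R) : 0 < K ->
  `|\int[nu]_t (h (rowt t) * tensor (hybrid i.+1) (rowt t)) -
    \int[nu]_t (h (rowt t) * tensor (hybrid i) (rowt t))| <=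
  K * l^-1 + K `^ (1 - p) * (2 * l * A) ^+ m.-1 * L.
Proof.
move=> K0; rewrite -RintegralB//; [|exact: integrable_hybrid|exact: integrable_hybrid].
have -> : \int[nu]_t (h (rowt t) * tensor (hybrid i.+1) (rowt t) -
    h (rowt t) * tensor (hybrid i) (rowt t)) =
    \int[nu]_t (h (rowt t) * partial i (tensor (hybrid_primitive i)) (rowt t)).
  by apply: eq_Rintegral => t _; rewrite partial_primitive mulrBr.
rewrite weak// normrN.
have c0 : 0 <= (2 * l * A) ^+ m.-1 by rewrite exprn_ge0// mulr_ge0// ltW.
have dom0 j s : 0 <= dominating i j s.
  exact: le_trans (normr_ge0 _) (abs_primitive_le i j s).
have mdom j : measurable_fun setT (dominating i j).
  rewrite /dominating; case: ifP => _; last exact: measurable_hybrid.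
  by apply: measurable_indic; exact: measurable_itv.
have mt : measurable_fun setT
    (fun t : T => tensor (hybrid_primitive i) (rowt t) : R).
  rewrite (_ : (fun _ => _) = (fun t : T => \prod_j hybrid_primitive i j (tnth t j))).
    apply: measurable_fun_tensor => j.
    apply: continuous_measurable_fun.
    exact: (Ck_continuousR (Ck_primitive 0 i j)).
  by apply/funext => t; rewrite tensor_rowt.
have abst t : `|tensor (hybrid_primitive i) (rowt t)| <=
    \prod_j dominating i j (tnth t j).
  rewrite tensor_rowt normr_prod; apply: ler_prod => j _.
  by rewrite normr_ge0 abs_primitive_le.
have le_t (t : T) : \prod_j dominating i j (tnth t j) <= (2 * l * A) ^+ m.-1.
  rewrite (bigD1 i)//= -[leRHS]mul1r.
  apply: ler_pM; [exact: dom0|by apply: prodr_ge0|  |].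
    by rewrite /dominating eqxx indicE; case: (_ \in _).
  have -> : (2 * l * A) ^+ m.-1 = \prod_(j < m | j != i) (2 * l * A).
    by rewrite prodr_const cardC1 card_ord.
  apply: ler_prod => j ji; rewrite dom0 /dominating (negPf ji).
  exact: hybrid_le.
have it : (\int[nu]_t (\prod_j dominating i j (tnth t j))%:E <= (l^-1)%:E)%E.
  rewrite (nu_tensor (c := fun j => if j == i then l^-1 else 1) mdom dom0).
    by rewrite (bigD1 i)//= eqxx big1 ?mulr1// => j /negPf ->.
  move=> j; rewrite /dominating; case: ifP => _; last exact: integral_hybrid.
  exact: integral_itv_indicator.
have mPhi := measurable_fun_tensor mdom.
by have [_] := integral_young p1 K0 c0 (mw i) mt mPhi abst le_t it (w_Lp i).
Qed.

Lemma mollify_increment_weak (K : R) : 0 < K ->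
  `|\int[nu]_t (h (rowt t) * eta l y t) - \int[nu]_t (h (rowt t) * eta (2 * l) y t)| <=
  m%:R * (K * l^-1 + K `^ (1 - p) * (2 * l * A) ^+ m.-1 * L).
Proof.
move=> K0; pose I k := \int[nu]_t (h (rowt t) * tensor (hybrid k) (rowt t)).
have -> : \int[nu]_t (h (rowt t) * eta l y t) = I m.
  apply: eq_Rintegral => t _; rewrite tensor_rowt; congr (_ * _).
  by apply: eq_bigr => j _; rewrite /hybrid ltn_ord.
have -> : \int[nu]_t (h (rowt t) * eta (2 * l) y t) = I 0%N.
  by apply: eq_Rintegral => t _; rewrite tensor_rowt.
have -> : I m - I 0%N = \sum_(i < m) (I i.+1 - I i).
  by rewrite -(big_mkord xpredT (fun i => I i.+1 - I i)) telescope_sumr.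
apply: le_trans (ler_norm_sum _ _ _) _.
apply: le_trans (ler_sum _ (fun i _ => hybrid_increment i K0)) _.
by rewrite sumr_const card_ord -[leLHS]mulr_natl.
Qed.

End WeakIncrement.

(** * Test functions and differences *)

Section TestFunctions.
Context {R : realType} {m : nat}.
Local Notation T := (m.-tuple (measurableTypeR R)).
Implicit Types (phi : 'rV[R]_m -> R^o) (h w : 'rV[R]_m -> R^o).

(** The superlevel sets are open, hence countable unions of cubes with rational
    centres and half-sides 1/(k+1). *)
Lemma measurable_continuous_rowt phi : continuous phi ->
  measurable_fun setT (phi \o rowt : T -> R).
Proof.
move=> cphi mT; apply: (measurability _ (RGenOInfty.measurableE R)) => //.
move=> /= _ [_ [a ->] <-]; rewrite preimage_itvoy.
pose box (z : nat * m.-tuple rat) : set T :=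
  [set t | forall i, `|tnth t i - ratr (tnth z.2 i)| < z.1.+1%:R^-1].
pose good z := forall t, box z t -> a < phi (rowt t).
have -> : setT `&` [set x | a < (phi \o rowt) x] =
    \bigcup_z (if pselect (good z) then box z else set0).
  rewrite setTI; apply/seteqP; split => t /=; last first.
    by move=> [z _]; case: pselect => // gz; exact: gz.
  move=> ta; have ta0 : 0 < phi (rowt t) - a by rewrite subr_gt0.
  have /cvgrPdist_lt/(_ _ ta0)/nbhs_ballP[e /= e0 he] := cphi (rowt t).
  have e40 : 0 < e / 4 by rewrite divr_gt0.
  have [k ke] : exists k : nat, k.+1%:R^-1 < e / 4.
    have [k _ /(_ _ (leqnn k)) hk] := near_infty_natSinv_lt (PosNum e40).
    by exists k.
  have qP i : exists q : rat, `|tnth t i - ratr q| < k.+1%:R^-1.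
    have k0 : (0 : R) < k.+1%:R^-1 by rewrite invr_gt0.
    have /rat_in_itvoo[q] : tnth t i < tnth t i + k.+1%:R^-1 by rewrite ltrDl.
    rewrite in_itv /= => /andP[q1 q2]; exists q.
    by rewrite distrC ger0_norm ?subr_ge0 ?(ltW q1)// ltrBlDl.
  have [q hq] := choice qP.
  exists (k, [tuple q i | i < m]) => //.
  have tb : box (k, [tuple q i | i < m]) t.
    by move=> i /=; rewrite tnth_mktuple; exact: hq.
  case: pselect => // -[] t' t'b.
  have : `|phi (rowt t) - phi (rowt t')| < phi (rowt t) - a.
    apply: he; rewrite -ball_normE /=; apply: (@le_lt_trans _ _ (e / 4 + e / 4)).
      apply: normr_row_le; first by rewrite addr_ge0// ltW.
      move=> i; rewrite !mxE -(subrKA (ratr (q i))).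
      apply: le_trans (ler_normD _ _) _; apply: lerD; apply: ltW.
        exact: lt_trans (hq i) ke.
      by have := t'b i; rewrite /= tnth_mktuple distrC => h; exact: lt_trans h ke.
    by rewrite -mulrDr; lra.
  by move=> /ltr_normlW; rewrite ltrD2l ltrN2.
apply: countable_bigcupT_measurable => [|z]; first exact: countableP.
case: pselect => /= _; last exact: measurable0.
rewrite (_ : box z = \bigcap_(i : 'I_m)
   ((fun t : T => `|tnth t i - ratr (tnth z.2 i)|) @^-1` `]-oo, z.1.+1%:R^-1[%classic)).
  apply: fin_bigcap_measurable => [|i _]; first exact: finite_finset.
  rewrite -[X in measurable X]setTI.
  have mi : measurable_fun setT (fun t : T => `|tnth t i - ratr (tnth z.2 i)|).
    apply: measurableT_comp => //; apply: measurable_funB => //.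
    exact: measurable_tnth.
  by apply: mi => //; exact: measurable_itv.
apply/seteqP; split => t /= h i.
  by move=> _ /=; rewrite in_itv /=; exact: h.
by have := h i I; rewrite /= in_itv.
Qed.

Lemma continuous_test_fun phi : test_fun phi -> continuous phi.
Proof. by move=> [hk _] x; exact: (Ck_continuous (hk 0%N)). Qed.

Lemma test_fun_partial i phi : test_fun phi -> test_fun (partial i phi).
Proof.
move=> [hk [r hr]]; split=> [k|]; first by have [_ /(_ (ebasis i))[]] := hk k.+1.
exists r => x rx; rewrite /partial.
have -> : 0 = 'D_(ebasis i) (cst (0 : R^o) : 'rV[R]_m -> R^o) x by rewrite derive_cst.
apply: near_eq_derive.
have : \forall y \near x, r < `|y|.
  exact: (@norm_continuous _ _ x _ (lt_nbhsr rx)).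
by apply: filterS => y /hr ->.
Qed.

Lemma test_fun_bounded phi : test_fun phi ->
  exists2 r : R, 0 < r & exists2 B : R, 0 <= B &
    (forall x, `|phi x| <= B) /\ forall x, phi x != 0 -> `|x| <= r.
Proof.
move=> tphi; have [_ [r0 hr0]] := tphi.
pose r := Num.max 1 r0.
have r_gt0 : 0 < r by rewrite lt_max ltr01.
have hr x : r < `|x| -> phi x = 0 by rewrite gt_max => /andP[_]; exact: hr0.
pose K := [set x : 'rV[R]_m | `|x| <= r].
have cK : compact K.
  apply: bounded_closed_compact.
    by exists r; split => [|k rk x /le_trans]; [exact: num_real|apply; exact: ltW].
  apply: (@closed_comp _ _ (fun x : 'rV[R]_m => `|x|) [set s : R | s <= r]).
    by move=> x _; exact: norm_continuous.
  exact: closed_le.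
have cphi : {within K, continuous phi}.
  exact: continuous_subspaceT (continuous_test_fun tphi).
have [M [Mr hM]] := compact_bounded (continuous_compact cphi cK).
exists r => //; exists `|M + 1| => //; split => x.
  have [xr|rx] := leP `|x| r; last by rewrite hr// normr0.
  apply: le_trans (ler_norm _); apply: (hM (M + 1)); first by rewrite ltrDl.
  by exists x.
by move=> px; rewrite leNgt; apply/negP => /hr px0; rewrite px0 eqxx in px.
Qed.

End TestFunctions.

Section IntegrableTest.
Context {R : realType} {m : nat}.
Local Notation T := (m.-tuple (measurableTypeR R)).
Variable nu : {sigma_finite_measure set T -> \bar R}.
Hypothesis nu_tensor : forall (F : 'I_m -> R -> R) (c : 'I_m -> R),
  (forall i, measurable_fun setT (F i)) -> (forall i s, 0 <= F i s) ->
  (forall i, (\int[@lebesgue_measure R]_s (F i s)%:E = (c i)%:E)%E) ->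
  (\int[nu]_t (\prod_i F i (tnth t i))%:E = (\prod_i c i)%:E)%E.

Lemma integrable_test_fun (p L : R) h (phi : 'rV[R]_m -> R^o) :
  1 <= p -> test_fun phi -> measurable_fun setT (h \o rowt : T -> R) ->
  (\int[nu]_t (`|h (rowt t)| `^ p)%:E <= L%:E)%E ->
  nu.-integrable setT (EFin \o (fun t : T => h (rowt t) * phi (rowt t))).
Proof.
move=> p1 tphi mh hL; have [r r0 [B B0 [hB hr]]] := test_fun_bounded tphi.
pose F (i : 'I_m) : R -> R := \1_(`[- r, (- r + 2 * r)]%classic).
have mF i : measurable_fun setT (F i).
  by apply: measurable_indic; exact: measurable_itv.
have F0 i s : 0 <= F i s by rewrite /F indicE.
have r20 : 0 < (2 * r)^-1 by rewrite invr_gt0 mulr_gt0.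
have iF i : (\int[@lebesgue_measure R]_s (F i s)%:E = (2 * r)%:E)%E.
  by have := integral_itv_indicator (- r) r20; rewrite invrK.
have mprod := measurable_fun_tensor mF.
have mPhi : measurable_fun setT (fun t : T => B * \prod_i F i (tnth t i)).
  exact: measurable_funM.
have mphi := measurable_continuous_rowt (continuous_test_fun tphi).
have prod_ge0 (t : T) : 0 <= \prod_i F i (tnth t i) by apply: prodr_ge0.
have prod_le1 (t : T) : \prod_i F i (tnth t i) <= 1.
  by apply: prodr_ile1 => i _; rewrite F0 /F indicE lern1 leq_b1.
have abs_le (t : T) : `|phi (rowt t)| <= B * \prod_i F i (tnth t i).
  have [->|ne] := eqVneq (phi (rowt t)) 0; first by rewrite normr0 mulr_ge0.
  rewrite big1 ?mulr1// => i _; rewrite /F indicE mem_set//=.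
  have := le_trans (normr_coord_le (rowt t) i) (hr _ ne).
  rewrite mxE ler_norml in_itv/= => /andP[-> h2] /=.
  by apply: le_trans h2 _; lra.
have le_B (t : T) : B * \prod_i F i (tnth t i) <= B by rewrite ler_piMr.
have iPhi : (\int[nu]_t (B * \prod_i F i (tnth t i))%:E <= (B * \prod_(i < m) (2 * r))%:E)%E.
  under eq_integral do rewrite EFinM.
  rewrite ge0_integralZl//=.
  - by rewrite (nu_tensor mF F0 iF) -EFinM.
  - exact/measurable_EFinP.
  - by move=> t _; rewrite lee_fin.
by have [] := integral_young p1 ltr01 B0 mh mphi mPhi abs_le le_B iPhi hL.
Qed.

End IntegrableTest.

Section WeakPartialDifference.
Context {R : realType} {m : nat}.
Local Notation T := (m.-tuple (measurableTypeR R)).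
Implicit Types (h w : 'rV[R]_m -> R^o).

Lemma in_Lp_integral p h : 1 <= p -> in_Lp p h ->
  exists L : R, (\int[leb R m]_t (`|h (rowt t)| `^ p)%:E <= L%:E)%E.
Proof.
move=> p1 [mh fh]; have n0 : (0 <= Lp_norm p h)%E by exact: Lnorm_ge0.
exists (fine (Lp_norm p h) `^ p).
apply: Lp_norm_integral => //; first exact: fine_ge0.
by rewrite fineK// ge0_fin_numE.
Qed.

Lemma in_LpB p h1 h2 : 1 <= p -> in_Lp p h1 -> in_Lp p h2 ->
  in_Lp p (fun x => h1 x - h2 x).
Proof.
move=> p1 [m1 f1] [m2 f2]; split; first exact: measurable_funB.
apply: (@le_lt_trans _ _ (Lp_norm p h1 + Lp_norm p h2)%E); last exact: lte_add_pinfty.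
rewrite /Lp_norm -[X in (_ <= _ + X)%E]oppe_Lnorm.
have m2' : measurable_fun setT (\- (h2 \o rowt) : T -> R) by exact: measurable_funN.
exact: (minkowski_EFin (leb R m) m1 m2' p1).
Qed.

Lemma weak_partialB p i h1 h2 w1 w2 : 1 <= p -> in_Lp p h1 -> in_Lp p h2 ->
  weak_partial p [:: i] h1 w1 -> weak_partial p [:: i] h2 w2 ->
  weak_partial p [:: i] (fun x => h1 x - h2 x) (fun x => w1 x - w2 x).
Proof.
move=> p1 H1 H2 [W1 d1] [W2 d2]; split; first exact: in_LpB.
move=> phi tphi.
have tensor_leb (F : 'I_m -> R -> R) c := @integral_tensor _ _ R (@lebesgue_measure R) m F c.
have int h psi : in_Lp p h -> test_fun psi ->
    (leb R m).-integrable setT (EFin \o (fun t : T => h (rowt t) * psi (rowt t))).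
  move=> Hh tpsi; have [L hL] := in_Lp_integral p1 Hh.
  exact: (integrable_test_fun tensor_leb p1 tpsi (proj1 Hh) hL).
have diff h h' psi : in_Lp p h -> in_Lp p h' -> test_fun psi ->
    \int[leb R m]_t ((h (rowt t) - h' (rowt t)) * psi (rowt t)) =
    \int[leb R m]_t (h (rowt t) * psi (rowt t)) -
    \int[leb R m]_t (h' (rowt t) * psi (rowt t)).
  move=> Hh Hh' tpsi.
  rewrite -RintegralB//; [|exact: int|exact: int].
  by apply: eq_Rintegral => t _; rewrite mulrBl.
rewrite diff//; last exact: test_fun_partial.
by rewrite diff// d1// d2// mulrBr.
Qed.

End WeakPartialDifference.

(** * Geometric decay of dyadic averages *)

Section Scaling.
Context {R : realType}.
Implicit Types (l A S p e L : R) (m : nat).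

Lemma powRD_gt0 l (a b : R) : 0 < l -> l `^ a * l `^ b = l `^ (a + b).
Proof. by move=> l0; rewrite powRD//; apply/implyP => _; rewrite gt_eqF. Qed.

(** With K = l^(-gam) both terms of [mollify_increment_slob] scale alike; the
    exponent is gam = s - m/p when e = m + s p. *)
Lemma slob_scaling m l A S p e L : 0 < l -> 0 < p -> 0 <= S ->
  let gam := (e - m%:R - m%:R) / p in
  l `^ (- gam) + (l `^ (- gam)) `^ (1 - p) *
    ((l * A) ^+ m * (2 * l * A) ^+ m * (S * l^-1) `^ e) * L =
  (1 + A ^+ m * (2 * A) ^+ m * S `^ e * L) * l `^ (- gam).
Proof.
move=> l0 p0 S0 gam; have l0' := ltW l0.
have gp : gam * p = e - m%:R - m%:R by rewrite divfK// gt_eqF.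
have -> : (2 * l * A) ^+ m = l ^+ m * (2 * A) ^+ m by rewrite -exprMn; congr (_ ^+ _); ring.
have -> : (S * l^-1) `^ e = S `^ e * l `^ (- e).
  by rewrite powRM ?invr_ge0// -powR_inv1// -powRrM mulN1r.
rewrite exprMn -powRrM -(powR_mulrn m l0').
have -> : l `^ (- gam * (1 - p)) * (l `^ m%:R * A ^+ m * (l `^ m%:R * (2 * A) ^+ m) *
    (S `^ e * l `^ (- e))) * L =
    (l `^ (- gam * (1 - p)) * l `^ m%:R * l `^ m%:R * l `^ (- e)) *
    (A ^+ m * (2 * A) ^+ m * S `^ e * L) by ring.
rewrite !powRD_gt0//.
have -> : - gam * (1 - p) + m%:R + m%:R - e = - gam by rewrite mulrBr mulr1 mulNr gp; ring.
ring.
Qed.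

(** The same balance for [mollify_increment_weak] in dimension m + 1, where
    K = l^((m+1)/p) and the exponent is 1 - (m+1)/p. *)
Lemma weak_scaling m l A p L : 0 < l -> 0 < p ->
  m.+1%:R * (l `^ (m.+1%:R / p) * l^-1 +
    (l `^ (m.+1%:R / p)) `^ (1 - p) * (2 * l * A) ^+ m * L) =
  m.+1%:R * (1 + (2 * A) ^+ m * L) * l `^ (- (1 - m.+1%:R / p)).
Proof.
move=> l0 p0; have l0' := ltW l0.
have gp : m.+1%:R / p * p = m.+1%:R by rewrite divfK// gt_eqF.
set gam := m.+1%:R / p in gp *.
have -> : (2 * l * A) ^+ m = l `^ m%:R * (2 * A) ^+ m.
  by rewrite powR_mulrn// -exprMn; congr (_ ^+ _); ring.
rewrite -powR_inv1// -powRrM powRD_gt0//.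
have -> : l `^ (gam * (1 - p)) * (l `^ m%:R * (2 * A) ^+ m) * L =
  (l `^ (gam * (1 - p)) * l `^ m%:R) * ((2 * A) ^+ m * L) by ring.
rewrite powRD_gt0//.
have -> : gam * (1 - p) + m%:R = - (1 - gam) by rewrite mulrBr mulr1 gp -natr1; ring.
have -> : gam - 1 = - (1 - gam) by ring.
ring.
Qed.

Lemma powR_dyadic k (gam : R) : (2 ^+ k) `^ (- gam) = (2 `^ (- gam)) ^+ k.
Proof.
have two0 : (0 : R) <= 2 by [].
by rewrite -(powR_mulrn k two0) -powRrM mulrC powRrM powR_mulrn// powR_ge0.
Qed.

Lemma powR2N_lt1 (gam : R) : 0 < gam -> 0 < (2 : R) `^ (- gam) < 1.
Proof.
move=> g0; rewrite powR_gt0//= powRN invf_lt1 ?powR_gt0//.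
have : (1 : R) `^ gam < 2 `^ gam by rewrite gt0_ltr_powR ?nnegrE ?ltr1n.
by rewrite powR1.
Qed.

End Scaling.

Section WspNorm.
Context {R : realType} {m : nat}.
Local Notation T := (m.-tuple (measurableTypeR R)).
Implicit Types (h w : 'rV[R]_m -> R^o) (p s N : R).

Lemma lee_sum_term (I : finType) (F : I -> \bar R) i :
  (forall j, (0 <= F j)%E) -> (F i <= \sum_j F j)%E.
Proof. by move=> F0; rewrite (bigD1 i)//= leeDl// sume_ge0. Qed.

Lemma Lp_norm_ge0 p h : (0 <= Lp_norm p h)%E.
Proof. exact: Lnorm_ge0. Qed.

Lemma slobodetskij_ge0 (sigma : R) p h : (0 <= slobodetskij_seminorm sigma p h)%E.
Proof. exact: poweR_ge0. Qed.

Lemma Wsp_norm_Lp s p h (a : seq 'I_m) :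
  (size a <= Num.truncn s)%N -> (Lp_norm p (wpartial p a h) <= Wsp_norm s p h)%E.
Proof.
move=> sa; rewrite /Wsp_norm.
have slob0 : (0 <= (if s == (Num.truncn s)%:R then 0 else
    \sum_(b : (Num.truncn s).-tuple 'I_m)
      slobodetskij_seminorm (s - (Num.truncn s)%:R) p (wpartial p b h)))%E.
  by case: ifP => // _; apply: sume_ge0 => b _; exact: slobodetskij_ge0.
apply: le_trans (leeDl _ slob0); have sa' : (size a < (Num.truncn s).+1)%N by [].
apply: le_trans (@lee_sum_term _ (fun j : 'I_(Num.truncn s).+1 =>
  \sum_(b : j.-tuple 'I_m) Lp_norm p (wpartial p b h))%E (Ordinal sa') _); last first.
  by move=> j; apply: sume_ge0 => b _; exact: Lp_norm_ge0.
apply: (@lee_sum_term _ (fun b : (size a).-tuple 'I_m => Lp_norm p (wpartial p b h))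
  (in_tuple a)).
by move=> b; exact: Lp_norm_ge0.
Qed.

Lemma Wsp_norm_slob s p h : 0 < s < 1 ->
  (slobodetskij_seminorm s p h <= Wsp_norm s p h)%E.
Proof.
move=> /andP[s0 s1]; rewrite /Wsp_norm.
have -> : Num.truncn s = 0%N by apply: truncn_def; rewrite ltW.
rewrite gt_eqF// subr0.
have L0 : (0 <= \sum_(j < 1) \sum_(a : j.-tuple 'I_m) Lp_norm p (wpartial p a h))%E.
  by apply: sume_ge0 => j _; apply: sume_ge0 => a _; exact: Lp_norm_ge0.
apply: le_trans (leeDr _ L0).
apply: (@lee_sum_term _ (fun a : 0.-tuple 'I_m =>
  slobodetskij_seminorm s p (wpartial p a h)) [tuple]).
by move=> a; exact: slobodetskij_ge0.
Qed.

Lemma slobodetskij_integral s p h N : 1 <= p -> 0 <= N ->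
  (slobodetskij_seminorm s p h <= N%:E)%E ->
  (\int[leb R m]_t \int[leb R m]_t' (slob_quot p (m%:R + s * p) h (t, t'))%:E <=
   (N `^ p)%:E)%E.
Proof.
move=> p1 N0; rewrite /slobodetskij_seminorm.
set I := (\int[leb R m]_t \int[leb R m]_t' (slob_quot p (m%:R + s * p) h (t, t'))%:E)%E.
have p0 : 0 < p := lt_le_trans ltr01 p1.
rewrite -[X in (X `^ _)%E]/I => hI.
have -> : I = ((I `^ p^-1) `^ p)%E.
  by rewrite -poweRrM mulVf ?gt_eqF// poweRe1//; apply: integral_ge0 => t _;
    apply: integral_ge0 => t' _; rewrite lee_fin slob_quot_ge0.
rewrite -poweR_EFin.
by apply: gt0_ler_poweR => //; rewrite ?in_itv/= ?leey ?andbT ?poweR_ge0 ?lee_fin// ltW.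
Qed.

Lemma wpartial_weak p i h : (exists w, weak_partial p [:: i] h w) ->
  weak_partial p [:: i] h (wpartial p [:: i] h).
Proof. by move=> [w hw]; exact: (@xgetPex _ (fun=> 0) _ (ex_intro _ w hw)). Qed.

End WspNorm.

Section DyadicAverages.
Context {R : realType} {m : nat}.
Local Notation T := (m.-tuple (measurableTypeR R)).
Implicit Types (h w : 'rV[R]_m -> R^o) (y : 'rV[R]_m) (delta p s N : R).

Definition dyadic_average h y k : R :=
  \int[leb R m]_t (h (rowt t) * eta (2 ^+ k) y t).

Let nu_eta y (l : R) := @integral_eta R m l y.

Lemma dyadic_decay_slob s p : 1 <= p -> 0 < s < 1 -> m%:R < s * p ->
  exists2 theta : R, 0 < theta < 1 &
  forall N, 0 <= N -> exists D : R, forall h, in_Lp p h ->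
    (Wsp_norm s p h <= N%:E)%E -> forall y k,
    `|dyadic_average h y k - dyadic_average h y k.+1| <= D * theta ^+ k.
Proof.
move=> p1 s01 hsp; have p0 : 0 < p := lt_le_trans ltr01 p1.
pose e := m%:R + s * p; pose gam := (e - m%:R - m%:R) / p.
have gam0 : 0 < gam by rewrite divr_gt0//; rewrite /e; lra.
have [A A1 hA] := @bump_bounded R; have A0 : 0 <= A := le_trans ler01 A1.
exists (2 `^ (- gam)) => [|N N0]; first exact: powR2N_lt1.
exists (1 + A ^+ m * (2 * A) ^+ m * (Num.sqrt m%:R) `^ e * N `^ p).
move=> h [mh _] hN y k.
have l0 : (0 : R) < 2 ^+ k by rewrite exprn_gt0.
have e0 : 0 <= e by rewrite /e addr_ge0// (le_trans _ (ltW hsp)).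
have hL : (Lp_norm p h <= N%:E)%E.
  by apply: le_trans hN; exact: (@Wsp_norm_Lp R m s p h [::]).
have hI := Lp_norm_integral p1 N0 hL.
have hS := slobodetskij_integral p1 N0 (le_trans (Wsp_norm_slob p h s01) hN).
have nu_eta' l y' : 0 < l -> (\int[leb R m]_t (eta l y' t)%:E = 1)%E := @integral_eta R m l y'.
have K0 : 0 < (2 ^+ k : R) `^ (- gam) by exact: powR_gt0.
have := mollify_increment_slob nu_eta' y p1 l0 K0 A0 e0 hA mh hI hS.
rewrite slob_scaling ?sqrtr_ge0// powR_dyadic /dyadic_average [in eta (2 ^+ k.+1)]exprS.
exact.
Qed.

End DyadicAverages.

Lemma dyadic_decay_weak (R : realType) m (s p : R) : m.+1%:R < p -> 1 <= s < 2 ->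
  exists2 theta : R, 0 < theta < 1 &
  forall N, 0 <= N -> exists D : R, forall h : 'rV[R]_m.+1 -> R^o, in_Wsp s p h ->
    (Wsp_norm s p h <= N%:E)%E -> forall y k,
    `|dyadic_average h y k - dyadic_average h y k.+1| <= D * theta ^+ k.
Proof.
move=> mp s12; have p1 : 1 <= p by apply: le_trans (ltW mp); rewrite ler1n.
have p0 : 0 < p := lt_le_trans ltr01 p1.
have ts : Num.truncn s = 1%N by apply: truncn_def.
pose gam := 1 - m.+1%:R / p.
have gam0 : 0 < gam by rewrite subr_gt0 ltr_pdivrMr// mul1r.
have [A A1 hA] := @bump_bounded R.
exists (2 `^ (- gam)) => [|N N0]; first exact: powR2N_lt1.
exists (m.+1%:R * (1 + (2 * A) ^+ m * N `^ p)).
move=> h [[mh _] hweak _] hN y k.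
have l0 : (0 : R) < 2 ^+ k by rewrite exprn_gt0.
have bound a : (size a <= 1)%N ->
    (\int[leb R m.+1]_t (`|wpartial p a h (rowt t)| `^ p)%:E <= (N `^ p)%:E)%E.
  move=> sa; apply: (Lp_norm_integral p1 N0); apply: le_trans hN.
  by apply: Wsp_norm_Lp; rewrite ts.
have hI := bound [::] isT.
have wP i : weak_partial p [:: i] h (wpartial p [:: i] h).
  by apply: wpartial_weak; apply: hweak; rewrite ts.
pose w i := wpartial p [:: i] h.
have mw i : measurable_fun setT (w i \o rowt) by have [[]] := wP i.
have weak i phi : test_fun phi ->
    \int[leb R m.+1]_t (h (rowt t) * partial i phi (rowt t)) =
    - \int[leb R m.+1]_t (w i (rowt t) * phi (rowt t)).
  by move=> tphi; have [_ /(_ _ tphi) ->] := wP i; rewrite /= expr1 mulN1r.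
have tensor_leb (F : 'I_m.+1 -> R -> R) c :=
  @integral_tensor _ _ R (@lebesgue_measure R) m.+1 F c.
have K0 : 0 < (2 ^+ k : R) `^ (m.+1%:R / p) by exact: powR_gt0.
have hw i := bound [:: i] isT.
have := mollify_increment_weak tensor_leb y p1 l0 A1 hA mh mw hI hw weak K0.
rewrite weak_scaling// powR_dyadic /dyadic_average [in eta (2 ^+ k.+1)]exprS.
exact.
Qed.

Section DyadicDecay.
Context {R : realType} {m : nat}.
Implicit Types (h w : 'rV[R]_m -> R^o) (y : 'rV[R]_m) (delta p N : R).

Lemma phase_exponent_lt2 delta p : 1 < p -> phase_exponent delta p < 2.
Proof.
move=> p1; have p0 : 0 < p := lt_trans ltr01 p1.
have pi : 0 < p^-1 by rewrite invr_gt0.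
by rewrite /phase_exponent; case: ifP => _; lra.
Qed.

(** For delta = 0 the exponent 1 - 1/p is fractional and s p = p - 1 exceeds
    the dimension.  For delta > 0 one weak derivative in L^p suffices, as p
    exceeds the dimension; in dimension 0 all averages coincide. *)
Lemma dyadic_decay delta p : m.+1%:R < p ->
  exists2 theta : R, 0 < theta < 1 &
  forall N, 0 <= N -> exists D : R, forall h, in_Wsp (phase_exponent delta p) p h ->
    (Wsp_norm (phase_exponent delta p) p h <= N%:E)%E -> forall y k,
    `|dyadic_average h y k - dyadic_average h y k.+1| <= D * theta ^+ k.
Proof.
move=> mp; have p1 : 1 < p by apply: le_lt_trans mp; rewrite ler1n.
have p0 : 0 < p := lt_trans ltr01 p1.
have pi0 : 0 < p^-1 by rewrite invr_gt0.
have pi1 : p^-1 < 1 by rewrite invf_lt1.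
case: m mp => [|m'] mp.
  exists 2^-1 => [|N N0]; first by apply/andP; split; lra.
  exists 0 => h _ _ y k; rewrite mul0r /dyadic_average.
  have -> : eta (2 ^+ k) y = eta (2 ^+ k.+1) y.
    by apply/funext => t; rewrite /eta !big_ord0.
  by rewrite subrr normr0.
have p2 : 2 < p by apply: le_lt_trans mp; rewrite ler_nat.
have pV : p * p^-1 = 1 by rewrite mulfV// gt_eqF.
rewrite /phase_exponent; case: ifP => _.
  apply: dyadic_decay_weak; first by apply: lt_trans mp; rewrite ltr_nat.
  apply/andP; split; last lra.
  have : 2 / p <= 1 by rewrite ler_pdivrMr// mul1r ltW.
  lra.
have s01 : 0 < 1 - 1 / p < 1 by rewrite mul1r; apply/andP; split; lra.
have ms : m'.+1%:R < (1 - 1 / p) * p.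
  by rewrite mulrBl !mul1r mulVf ?gt_eqF// ltrBrDr natr1.
have [theta th01 H] := @dyadic_decay_slob R m'.+1 _ p (ltW p1) s01 ms.
exists theta => // N N0; have [D hD] := H N N0; exists D => h [hLp _ _].
exact: hD.
Qed.

End DyadicDecay.

(** * Bounds on dyadic averages *)

Section AverageBounds.
Context {disp : measure_display} {T : measurableType disp} {R : realType}.
Variable mu : {sigma_finite_measure set T -> \bar R}.

Lemma Rintegral_ae_ge0 (f : T -> R) : measurable_fun setT f ->
  {ae mu, forall t, 0 <= f t} -> 0 <= \int[mu]_t f t.
Proof.
move=> mf f0; have -> : \int[mu]_t f t = \int[mu]_t `|f t|; last exact: Rintegral_ge0.
congr fine; apply: ae_eq_integral => //; try exact/measurable_EFinP.
  by apply/measurable_EFinP; exact: measurableT_comp.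
by apply: filterS f0 => t ft _; rewrite ger0_norm.
Qed.

Variables (H E : T -> R) (c : R).
Hypotheses (mH : measurable_fun setT H) (mE : measurable_fun setT E).
Hypotheses (E0 : forall t, 0 <= E t) (iE : (\int[mu]_t (E t)%:E = 1)%E).
Hypothesis iHE : mu.-integrable setT (EFin \o (fun t => H t * E t)).

(** An almost everywhere bound, because the initial value of the solution is
    controlled in this sense. *)
Lemma average_ge : {ae mu, forall t, E t != 0 -> c <= H t} ->
  c <= \int[mu]_t (H t * E t).
Proof.
move=> cH; have intE := integrable_weight mE E0 iE.
have [_ eq_avg] := average_minus c intE iE iHE.
rewrite -subr_ge0 eq_avg; apply: Rintegral_ae_ge0.
  by apply: measurable_funM => //; exact: measurable_funB.
apply: filterS cH => t ct; have [->|Et] := eqVneq (E t) 0; first by rewrite mulr0.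
by rewrite mulr_ge0// subr_ge0 ct.
Qed.

Lemma average_le : (forall t, E t != 0 -> H t <= c) ->
  \int[mu]_t (H t * E t) <= c.
Proof.
move=> cH; have intE := integrable_weight mE E0 iE.
rewrite -[leRHS](Rintegral_weight c intE iE).
apply: le_Rintegral => //; first exact: integrable_scale.
move=> t _; have [->|Et] := eqVneq (E t) 0; first by rewrite !mulr0.
by rewrite ler_wpM2r// cH.
Qed.

End AverageBounds.

Section DyadicLimits.
Context {R : realType} {m : nat}.
Local Notation T := (m.-tuple (measurableTypeR R)).
Local Notation mu := (leb R m).
Implicit Types (h w : 'rV[R]_m -> R^o) (y : 'rV[R]_m) (p s N : R).

Let pow0 k : (0 : R) < 2 ^+ k. Proof. exact: exprn_gt0. Qed.

Let nu_eta l y : 0 < l -> (\int[mu]_t (eta l y t)%:E = 1)%E := @integral_eta R m l y.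

Lemma integrable_dyadic p h y k : 1 <= p -> in_Lp p h ->
  mu.-integrable setT (EFin \o (fun t : T => h (rowt t) * eta (2 ^+ k) y t)).
Proof.
move=> p1 Hh; have [A A1 hA] := @bump_bounded R.
have [L hL] := in_Lp_integral p1 Hh.
by have [] := integrable_mul_eta nu_eta y p1 (pow0 k) (le_trans ler01 A1) hA
  (proj1 Hh) hL.
Qed.

Lemma dyadic_averageB p h1 h2 y k : 1 <= p -> in_Lp p h1 -> in_Lp p h2 ->
  dyadic_average (fun x => h1 x - h2 x) y k =
  dyadic_average h1 y k - dyadic_average h2 y k.
Proof.
move=> p1 H1 H2; rewrite /dyadic_average -RintegralB//;
  [|exact: integrable_dyadic p1 H1|exact: integrable_dyadic p1 H2].
by apply: eq_Rintegral => t _; rewrite mulrBl.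
Qed.

Lemma dyadic_average_ge p h y k (a : R) : 1 <= p -> in_Lp p h ->
  {ae mu, forall t : T, eta (2 ^+ k) y t != 0 -> a <= h (rowt t)} ->
  a <= dyadic_average h y k.
Proof.
move=> p1 Hh; exact: (average_ge (proj1 Hh) (measurable_eta _ _)
  (fun t => eta_ge0 y t (pow0 k)) (nu_eta y (pow0 k)) (integrable_dyadic y k p1 Hh)).
Qed.

Lemma dyadic_average_le p h y k (a : R) : 1 <= p -> in_Lp p h ->
  (forall t : T, eta (2 ^+ k) y t != 0 -> h (rowt t) <= a) ->
  dyadic_average h y k <= a.
Proof.
move=> p1 Hh; exact: (average_le (measurable_eta _ _)
  (fun t => eta_ge0 y t (pow0 k)) (nu_eta y (pow0 k)) (integrable_dyadic y k p1 Hh)).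
Qed.

Lemma eta_dyadic_neq0 y k (t : T) : eta (2 ^+ k) y t != 0 ->
  `|rowt t - y| <= (2 ^+ k)^-1.
Proof.
move=> /(eta_neq0 (pow0 k)) h; apply: normr_row_le; first by rewrite invr_ge0 ltW.
by move=> i; rewrite !mxE; have /andP[h1 h2] := h i; rewrite ger0_norm.
Qed.

Lemma dyadic_radius_small (rho : R) : 0 < rho ->
  exists k0 : nat, forall k, (k0 <= k)%N -> (2 ^+ k)^-1 < rho.
Proof.
move=> rho0; have : (2^-1 : R) ^+ k @[k --> \oo] --> (0 : R).
  by apply: cvg_expr; rewrite ger0_norm; lra.
move=> /cvgr0Pnorm_lt/(_ _ rho0)[k0 _ hk0]; exists k0 => k /hk0.
by rewrite /= ger0_norm ?exprn_ge0 ?invr_ge0// exprVn.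
Qed.

Lemma small_dyadic_average p k (e : R) : 1 <= p -> 0 < e ->
  exists2 N : R, 0 < N & forall h, in_Lp p h -> (Lp_norm p h <= N%:E)%E ->
    forall y, `|dyadic_average h y k| <= e.
Proof.
move=> p1 e0; have p0 : 0 < p := lt_le_trans ltr01 p1.
have [A A1 hA] := @bump_bounded R; have A0 : 0 < A := lt_le_trans ltr01 A1.
have e20 : 0 < e / 2 by rewrite divr_gt0.
pose c := (e / 2) `^ (1 - p) * (2 ^+ k * A) ^+ m.
have c0 : 0 < c by rewrite mulr_gt0 ?powR_gt0// exprn_gt0// mulr_gt0.
have b0 : 0 < e / 2 / c by rewrite divr_gt0.
exists ((e / 2 / c) `^ p^-1) => [|h Hh hN y]; first exact: powR_gt0.
have hI := Lp_norm_integral p1 (powR_ge0 _ _) hN.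
have [_ /(_ _ e20)] := integrable_mul_eta nu_eta y p1 (pow0 k) (ltW A0) hA
  (proj1 Hh) hI.
rewrite -powRrM mulVf ?gt_eqF// powRr1 ?(ltW b0)// -/c => /le_trans; apply.
by rewrite [c * _]mulrC divfK ?gt_eqF// -splitr.
Qed.

End DyadicLimits.

Lemma geometric_increments (R : realFieldType) (a : nat -> R) (D theta : R) :
  0 < theta < 1 -> (forall k, `|a k - a k.+1| <= D * theta ^+ k) ->
  forall k j, `|a k - a (k + j)%N| <= D / (1 - theta) * theta ^+ k.
Proof.
move=> /andP[th0 th1] ha k j.
have q0 : 0 < 1 - theta by rewrite subr_gt0.
have D0 : 0 <= D by have := le_trans (normr_ge0 _) (ha 0%N); rewrite expr0 mulr1.
have : `|a k - a (k + j)%N| <= D / (1 - theta) * (theta ^+ k - theta ^+ (k + j)).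
  elim: j => [|j ih]; first by rewrite addn0 !subrr normr0 mulr0.
  rewrite addnS -(subrKA (a (k + j)%N)).
  apply: le_trans (ler_normD _ _) _.
  apply: le_trans (lerD ih (ha _)) _.
  rewrite exprS le_eqVlt; apply/orP; left; apply/eqP; field.
  by rewrite gt_eqF.
move=> /le_trans; apply; apply: ler_wpM2l; first by rewrite divr_ge0// ltW.
by rewrite gerBl exprn_ge0// ltW.
Qed.

Section WspDifference.
Context {R : realType} {m : nat}.
Implicit Types (h : 'rV[R]_m -> R^o) (p s : R).

Lemma in_WspB s p h1 h2 : 1 <= p -> s < 2 -> in_Wsp s p h1 -> in_Wsp s p h2 ->
  (Wsp_norm s p (fun x => h1 x - h2 x)%R < +oo)%E ->
  in_Wsp s p (fun x => h1 x - h2 x).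
Proof.
move=> p1 s2 [L1 W1 _] [L2 W2 _] fin; split=> //; first exact: in_LpB.
have ts : (Num.truncn s <= 1)%N by rewrite truncn_le_nat.
move=> [|i [|j a]] sa.
- exists (fun x => h1 x - h2 x); split; first exact: in_LpB.
  by move=> phi _; rewrite expr0 mul1r.
- have [w1 hw1] := W1 _ sa; have [w2 hw2] := W2 _ sa.
  by exists (fun x => w1 x - w2 x); exact: weak_partialB.
- by have := leq_trans sa ts.
Qed.

End WspDifference.

(** * The initial layer *)

Section Plateau.
Context {R : realType}.

Definition plateau (a e s : R) : R :=
  smooth_step (2 + (s - a) / e) * smooth_step (2 - (s - a) / e).

Lemma plateau_eq1 a e s : 0 < e -> `|s - a| <= e -> plateau a e s = 1.
Proof.
move=> e0; rewrite ler_norml -lerNl -(ler_pM2r (_ : 0 < e^-1)) ?invr_gt0//.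
rewrite -[X in _ && X](ler_pM2r (_ : 0 < e^-1)) ?invr_gt0// mulfV ?gt_eqF// mulNr.
by move=> /andP[h1 h2]; rewrite /plateau !smooth_step_ge1 ?mulr1//; lra.
Qed.

Lemma plateau_neq0 a e s : 0 < e -> plateau a e s != 0 -> `|s - a| <= 2 * e.
Proof.
move=> e0; rewrite /plateau mulf_eq0 negb_or => /andP[n1 n2].
have h1 : 0 <= 2 + (s - a) / e.
  by rewrite leNgt; apply: contraNN n1 => /ltW/smooth_step_le0 ->.
have h2 : 0 <= 2 - (s - a) / e.
  by rewrite leNgt; apply: contraNN n2 => /ltW/smooth_step_le0 ->.
have : `|(s - a) / e| <= 2 by rewrite ler_norml; apply/andP; split; lra.
by rewrite normrM normfV (gtr0_norm e0) ler_pdivrMr.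
Qed.

Lemma Ck_plateau k (a e : R) : Ck k setT (plateau a e : R^o -> R^o).
Proof.
have Cstep (b c : R) : Ck k setT (fun s : R^o => smooth_step (b + c * s) : R^o).
  apply: (@Ck_affine R R^o R^o (fun s => b + c * s : R^o) (fun s => c * s : R^o)
    _ _ k setT smooth_step (Ck_smooth_step k)).
  - move=> s; apply: (@continuousD R R^o R^o); first exact: cvg_cst.
    by apply: continuousM; [exact: cvg_cst|exact: cvg_id].
  - by move=> t v s; rewrite /GRing.scale /=; ring.
have -> : plateau a e = (fun s => smooth_step ((2 - a / e) + e^-1 * s) *
    smooth_step ((2 + a / e) + (- e^-1) * s)).
  by apply/funext => s; rewrite /plateau; congr (smooth_step _ * smooth_step _); ring.
by apply: CkM; [exact: openT|exact: Cstep|exact: Cstep].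
Qed.

Lemma cutoff_exists m (c : chart R m) (x : 'rV[R]_m.+1) : open (dom c) -> dom c x ->
  exists2 chi, cutoff c chi & exists2 e : R, 0 < e &
    forall z, `|z - x| <= e -> dom c z /\ chi z = 1.
Proof.
move=> odom cx; have /nbhs_ballP[e /= e0 he] : nbhs x (dom c) by exact: open_nbhs_nbhs.
have e30 : 0 < e / 3 by rewrite divr_gt0.
have dom_le z : `|z - x| <= 2 * (e / 3) -> dom c z.
  move=> zx; apply: he; rewrite -ball_normE /= distrC; apply: le_lt_trans zx _; lra.
exists (tensor (fun j => plateau (x ord0 j) (e / 3))).
  split=> [k|]; first by apply: Ck_tensor => j; exact: Ck_plateau.
  exists [set z | `|z - x| <= 2 * (e / 3)]; split => [| |z nz].
  - apply: bounded_closed_compact.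
      exists (`|x| + 2 * (e / 3)); split => [|k ek z /= zx]; first exact: num_real.
      rewrite -(subrK x z); apply: le_trans (ler_normD _ _) _.
      by apply: le_trans (ltW ek); rewrite addrC lerD2l.
    apply: (@closed_comp _ _ (fun z : 'rV[R]_m.+1 => `|z - x|) [set s : R | s <= 2 * (e / 3)]).
      by move=> z _; exact: cvg_norm (cvgB (@cvg_id _ (nbhs z)) (cvg_cst x)).
    exact: closed_le.
  - by move=> z; exact: dom_le.
  - apply/eqP; apply: contraPT isT => /tensor_neq0 hz _; apply: nz => /=.
    apply: normr_row_le; first by rewrite mulr_ge0// ltW.
    by move=> j; rewrite !mxE; exact: plateau_neq0 e30 (hz j).
exists (e / 3) => // z zx; split.
  by apply: dom_le; apply: le_trans zx _; lra.
rewrite /tensor big1// => j _; apply: plateau_eq1 => //.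
by apply: le_trans zx; have := normr_coord_le (z - x) j; rewrite !mxE.
Qed.

End Plateau.

Lemma continuous_close (R : realType) (V W : normedModType R) (F : V -> W) (x : V) (e : R) :
  {for x, continuous F} -> 0 < e ->
  exists2 rho : R, 0 < rho & forall z, `|z - x| < rho -> `|F z - F x| < e.
Proof.
move=> /cvgrPdist_lt cF e0; have /nbhs_ballP[rho /= rho0 hrho] := cF _ e0.
exists rho => // z zx; rewrite distrC; apply: hrho.
by rewrite -ball_normE /= distrC.
Qed.

Lemma geometric_small (R : realType) (D theta e : R) (k0 : nat) :
  0 < theta < 1 -> 0 < e -> exists2 k, (k0 <= k)%N & D * theta ^+ k < e.
Proof.
move=> /andP[th0 th1] e0; have D0 : 0 < `|D| + 1 by rewrite ltr_wpDl.
have ed0 : 0 < e / (`|D| + 1) by rewrite divr_gt0.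
have : theta ^+ k @[k --> \oo] --> (0 : R) by apply: cvg_expr; rewrite ger0_norm// ltW.
move=> /cvgr0Pnorm_lt/(_ _ ed0)[k1 _ hk1].
exists (maxn k0 k1); first exact: leq_maxl.
have := hk1 _ (leq_maxr k0 k1); have th := exprn_ge0 (maxn k0 k1) (ltW th0).
rewrite /= ger0_norm// ltr_pdivlMr// mulrC; apply: le_lt_trans.
by apply: ler_wpM2r => //; apply: le_trans (ler_norm D) _; rewrite lerDl.
Qed.

Lemma increment_of_diff (R : realType) (a a' b b' c c' x y : R) :
  c = a - b -> c' = a' - b' -> `|b - b'| <= x -> `|c - c'| <= y -> `|a - a'| <= x + y.
Proof.
move=> -> -> hb hc; have -> : a - a' = (b - b') + (a - b - (a' - b')) by ring.
by apply: le_trans (ler_normD _ _) _; exact: lerD.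
Qed.

Lemma initial_value_bound (R : realType) (C a b c a' x : R) : C <= b ->
  `|c| <= 4^-1 -> c = a - b -> `|a - a'| < 4^-1 -> a' <= x + 4^-1 -> C - 1 < x.
Proof.
by move=> Cb /ler_normlP[h1 h2] cE /ltr_normlP[h3 h4] ax; lra.
Qed.

Section InitialLayer.
Context {R : realType} {m : nat}.
Variables (Om : set 'rV[R]_m.+1) (d delta p lambda C : R) (f g : R -> R).
Variables (u0 : 'rV[R]_m.+1 -> R^o) (u : R -> 'rV[R]_m.+1 -> R^o).
Hypotheses (oOm : open Om) (hp : m.+1%:R < p).
Hypothesis hu : is_solution Om d delta p f g lambda u0 +oo%E u.
Hypothesis hC : ae_boundary Om [set x | C <= u0 x].

Let p1 : 1 <= p.
Proof. by apply: le_trans (ltW hp); rewrite ler1n. Qed.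

Let p_gt1 : 1 < p.
Proof. by apply: le_lt_trans hp; rewrite ler1n. Qed.

Let us : smooth_on [set z : R^o * 'rV[R]_m.+1 |
  [/\ 0 < z.1, (z.1%:E < +oo)%E & closure Om z.2]] (fun z => u z.1 z.2).
Proof. by case: hu. Qed.

Let s := phase_exponent delta p.

Lemma near_initial_Wsp c chi (e : R) : is_chart Om c -> cutoff c chi -> 0 < e ->
  \forall t \near (0 : R)^'+,
    (Wsp_norm s p (localize c chi (fun x => u t x - u 0 x)%R) < e%:E)%E.
Proof.
move=> hc cchi e0; have [_ _ _ _ [[_ cvg_u] _]] := hu.
have J0 : [set t : R | 0 <= t /\ (t%:E < +oo)%E] 0 by split => //; rewrite ltry.
have nbe : nbhs (0%E : \bar R) [set x | (x < e%:E)%E].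
  by apply: (@open_ereal_lt_ereal R e%:E) => /=; rewrite lte_fin.
have := cvg_u 0 J0 c chi hc cchi _ nbe.
rewrite /nbhs /= /within /=; apply: filterS => t ht t0; apply: ht.
by split; [exact: ltW|rewrite ltry].
Qed.

Lemma localize_diff c chi t : localize c chi (fun x => u t x - u 0 x) =
  (fun y => localize c chi (u t) y - localize c chi (u 0) y).
Proof. by apply/funext => y; rewrite /localize mulrBr. Qed.

(** In a chart, v t is the localized solution and w = v t - v 0.  The averages
    of v t converge to its values, because v t is continuous, with a rate that
    is uniform in t near 0: the increments are controlled for v 0 and for w
    separately.  The k-th average of v 0 is at least C, and that of w is small
    once w is small in L^p. *)
Lemma initial_layer_locally c xb : is_chart Om c -> dom c xb -> boundary Om xb ->
  exists2 e : R, 0 < e & \forall t \near (0 : R)^'+, forall x, `|x - xb| < e ->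
    boundary Om x -> C - 1 < u t x.
Proof.
move=> hc cxb bxb; have [odom cF hh _] := hc.
have [_ _ _ _ [[inW _] u_init]] := hu.
have [chi cchi [e e0 he]] := cutoff_exists odom cxb.
pose v t := localize c chi (u t).
have Wv t : 0 <= t -> in_Wsp s p (v t).
  by move=> t0; apply: inW => //; split; rewrite ?ltry.
have [Lv0 _ Nv0] := Wv 0 (lexx 0).
pose yb := chart_base c xb.
have pyb : param c yb = xb := param_chart_base oOm hc bxb cxb.
have pc := continuous_param hh.
have [rho rho0 hrho] := continuous_close (pc yb) e0.
have rho20 : 0 < rho / 2 by rewrite divr_gt0.
have [e1 e10 he1] := continuous_close (@continuous_chart_base R m c xb) rho20.
have [k0 hk0] := dyadic_radius_small rho20.
have [theta th01 decay] := dyadic_decay delta hp.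
have Wv0_ge0 : (0 <= Wsp_norm s p (v 0%R))%E.
  exact: le_trans (Lp_norm_ge0 p (v 0)) (@Wsp_norm_Lp R m s p (v 0) [::] isT).
have [D0 hD0] := decay _ (fine_ge0 Wv0_ge0).
have [D1 hD1] := decay 1 ler01.
have q0 : (0 : R) < 4^-1 by rewrite invr_gt0.
have [k kk0 hk] := geometric_small ((D0 + D1) / (1 - theta)) k0 th01 q0.
have [N N0 hN] := @small_dyadic_average R m p k _ p1 q0.
exists (Num.min e1 e); first by rewrite lt_min e10.
near=> t => x; rewrite lt_min => /andP[xe1 xe] bx.
have t0 : 0 < t by near: t; exact: nbhs_right_gt.
have [cx chix] := he x (ltW xe).
pose y := chart_base c x; have pxy : param c y = x := param_chart_base oOm hc bx cx.
have y_near : `|y - yb| < rho / 2 := he1 x xe1.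
(* Cubes with lower corner y and side less than rho / 2 stay where the cutoff
   is 1, for every x close to xb. *)
have near_supp y' : `|y' - y| < rho / 2 ->
    chart_params c y' /\ chi (param c y') = 1.
  move=> y'y; apply: he; rewrite -pyb; apply/ltW/hrho.
  rewrite -(subrKA y); apply: le_lt_trans (ler_normD _ _) _.
  by rewrite [ltRHS](splitr rho); exact: ltrD.
have supp k' z : (k0 <= k')%N -> eta (2 ^+ k') y z != 0 ->
    chart_params c (rowt z) /\ chi (param c (rowt z)) = 1.
  by move=> kk' /eta_dyadic_neq0 h; apply/near_supp/(le_lt_trans h)/hk0.
pose w y' := v t y' - v 0 y'.
have Nw1 : (Wsp_norm s p w < 1%:E)%E.
  by rewrite /w -localize_diff; near: t; exact: near_initial_Wsp.
have NwN : (Wsp_norm s p w < N%:E)%E.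
  by rewrite /w -localize_diff; near: t; exact: near_initial_Wsp.
have Ww : in_Wsp s p w.
  apply: (in_WspB p1 (phase_exponent_lt2 delta p_gt1) (Wv t (ltW t0)) (Wv 0 (lexx 0))).
  by apply: lt_trans Nw1 _; rewrite ltry.
have [Lvt _ _] := Wv t (ltW t0).
have avg_w k' : dyadic_average w y k' = dyadic_average (v t) y k' - dyadic_average (v 0) y k'.
  exact: (dyadic_averageB y k' p1 Lvt Lv0).
have lower : C <= dyadic_average (v 0) y k.
  apply: (dyadic_average_ge p1 Lv0).
  apply: filterS (hC hc) => z hz /(supp _ _ kk0)[cz chiz].
  rewrite /v /localize chiz mul1r u_init; first exact: hz.
  exact: (boundary_param oOm hc cz).
have w_small : `|dyadic_average w y k| <= 4^-1.
  apply: hN; first by case: Ww.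
  by apply: le_trans (ltW NwN); exact: (@Wsp_norm_Lp R m s p w [::]).
have inc k' : `|dyadic_average (v t) y k' - dyadic_average (v t) y k'.+1| <=
    (D0 + D1) * theta ^+ k'.
  have i1 := hD1 w Ww (ltW Nw1) y k'.
  have i0 : `|dyadic_average (v 0) y k' - dyadic_average (v 0) y k'.+1| <= D0 * theta ^+ k'.
    apply: hD0; first exact: Wv.
    by rewrite fineK// ge0_fin_numE.
  by rewrite mulrDl; apply: increment_of_diff (avg_w k') (avg_w k'.+1) i0 i1.
have clx : closure Om x by have [] := bx.
have [rho2 rho20' hrho2] : exists2 rho2 : R, 0 < rho2 & forall y', `|y' - y| < rho2 ->
    closure Om (param c y') -> u t (param c y') < u t x + 4^-1.
  have near_x : \forall z \near x, 0 < t -> closure Om z -> `|u t z - u t x| < 4^-1.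
    exact: (@continuous_space_slice R 'rV[R]_m.+1 t x _ (near_space_time us t0 clx q0)).
  rewrite -pxy in near_x.
  have /nbhs_ballP[r /= r0 hr] := pc y _ near_x.
  exists r => // y' y'y cy'.
  have /ltr_normlW : `|u t (param c y') - u t (param c y)| < 4^-1.
    by apply: hr => //; rewrite -ball_normE /= distrC.
  by rewrite pxy ltrBlDl.
(* The continuity radius rho2 depends on t and x, hence so does k2; the bound
   on the sum of the increments from k on does not involve it. *)
have [k2 hk2] := dyadic_radius_small rho20'.
have upper : dyadic_average (v t) y (k + k2) <= u t x + 4^-1.
  apply: (dyadic_average_le p1 Lvt) => z ez.
  have [cz chiz] := supp _ _ (leq_trans kk0 (leq_addr k2 k)) ez.
  rewrite /v /localize chiz mul1r; apply/ltW/hrho2.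
    by apply: (le_lt_trans (eta_dyadic_neq0 ez)); apply: hk2; exact: leq_addl.
  by have [] := boundary_param oOm hc cz.
have far := le_lt_trans (geometric_increments th01 inc k k2) hk.
exact: (initial_value_bound lower w_small (avg_w k) far upper).
Unshelve. all: by end_near. Qed.

End InitialLayer.

Lemma initial_layer (R : realType) m (Om : set 'rV[R]_m.+1) (d delta p lambda C : R)
    (f g : R -> R) u0 u :
  bounded_smooth_domain Om -> m.+1%:R < p ->
  is_solution Om d delta p f g lambda u0 +oo%E u ->
  ae_boundary Om [set x | C <= u0 x] ->
  exists2 t1 : R, 0 < t1 & forall x, boundary Om x -> C - 1 < u t1 x.
Proof.
move=> [oOm _ _ bOm charts] hp hu hC.
have /compact_near_coveringP cov := compact_boundary oOm bOm.
have : \forall t \near (0 : R)^'+, boundary Om `<=` (fun x => boundary Om x ->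
    C - 1 < u t x).
  apply: (cov R (0 : R)^'+ (fun t x => boundary Om x -> C - 1 < u t x)).
  move=> xb bxb; have [c hc cxb] := charts _ bxb.
  have [e e0 he] := initial_layer_locally oOm hp hu hC hc cxb bxb.
  near=> x t => bx.
  have ht : forall x, `|x - xb| < e -> boundary Om x -> C - 1 < u t x by near: t.
  have xe : `|x - xb| < e.
    near: x; have := @nbhsx_ballx _ 'rV[R]_m.+1 xb e e0.
    by apply: filterS => x; rewrite -ball_normE /= distrC.
  exact: ht xe bx.
move=> hr; near (0 : R)^'+ => t.
have ht : boundary Om `<=` (fun x => boundary Om x -> C - 1 < u t x) by near: t.
exists t; first by near: t; exact: nbhs_right_gt.
by move=> x bx; exact: ht.
Unshelve. all: by end_near. Qed.

(** * Blow-up *)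

Lemma superlinear_threshold (R : realType) (g : R -> R) (q B K : R) : 1 < q ->
  0 <= B -> 0 <= K -> (g xi / (xi `^ q)) @[xi --> +oo] --> +oo ->
  exists2 M0 : R, 0 < M0 & forall M, M0 <= M -> M `^ q < g M - B * (M + K).
Proof.
(* One M^q is the strict margin; as 1 and M are at most M^q for M >= 1,
   the factor B (1 + K) pays for B (M + K). *)
move=> q1 B0 K0 /cvgryPge /(_ (2 + B * (1 + K))) [M1 [_ hM1]].
exists (Num.max 1 (M1 + 1)); first by rewrite lt_max ltr01.
move=> M; rewrite ge_max => /andP[M_ge1 M1M].
have M0 : 0 < M by apply: lt_le_trans M_ge1.
have Mq1 : 1 <= M `^ q by rewrite -(powRr0 M) ler_powR// (le_trans ler01 (ltW q1)).
have MMq : M <= M `^ q by rewrite -[leLHS](powRr1 (ltW M0)) ler_powR// ltW.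
have gM : (2 + B * (1 + K)) * M `^ q <= g M.
  rewrite -ler_pdivlMr ?powR_gt0//; apply: hM1.
  by apply: lt_le_trans M1M; rewrite ltrDl.
have BM := ler_wpM2l B0 MMq.
have BKM : B * K <= B * K * M `^ q by rewrite ler_peMr// mulr_ge0.
lra.
Qed.

(** Otherwise the domain would be compact and open, but a point with the largest
    first coordinate cannot be interior. *)
Lemma boundary_nonempty (R : realType) m (Om : set 'rV[R]_m.+1) :
  open Om -> bounded_set Om -> Om !=set0 -> boundary Om !=set0.
Proof.
move=> oOm bOm [x0 Ox0]; apply: contrapT => nb.
have cl_sub : closure Om `<=` Om.
  move=> x cx; apply: contrapT => nOx; apply: nb; exists x; split => //.
  by move/interior_subset.
have cOm : compact Om.
  have -> : Om = closure Om by apply/seteqP; split=> //; exact: subset_closure.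
  exact: compact_closure.
have coord : {within Om, continuous (fun x : 'rV[R]_m.+1 => x ord0 ord0 : R)}.
  by apply: continuous_subspaceT => x; exact: coord_continuous.
have [x /set_mem Ox xmax] := compact_EVT_max (ex_intro _ _ Ox0) cOm coord.
have /nbhs_norm0P[e /= e0 he] := near_line (ebasis ord0) (open_nbhs_nbhs (conj oOm Ox)).
have e20 : 0 < e / 2 by rewrite divr_gt0.
have Ox' : Om (x + (e / 2) *: ebasis ord0).
  by apply: he; rewrite /= gtr0_norm// ltr_pdivrMr// ltr_pMr// ltr1n.
have := xmax _ (mem_set Ox'); rewrite !mxE !eqxx mulr1.
by rewrite gerDl leNgt e20.
Qed.

Theorem proposition5p4 (R : realType) (m : nat) (Om : set 'rV[R]_m.+1)
    (d delta p : R) (f : R -> R)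
    (hOm : bounded_smooth_domain Om)
    (hd : 0 < d) (hdelta : 0 <= delta)
    (hp : m.+1%:R < p)
    (hf : Cinfty setT (f : R^o -> R^o))
    (hf' : exists cf : R, forall x : R, `|derive1 (f : R -> R^o) x| <= cf) :
  exists lambda_star : R,
    forall (lambda : R) (g : R -> R) (q : R),
      lambda_star <= lambda ->
      Cinfty setT (g : R^o -> R^o) ->
      1 < q ->
      (g xi / (xi `^ q)) @[xi --> +oo] --> +oo ->
      exists2 C : R, 0 < C &
        forall u0 : 'rV[R]_m.+1 -> R^o,
          phase_space Om delta p u0 ->
          ae_boundary Om [set x | C <= u0 x] ->
          blows_up_in_finite_time Om d delta p f g lambda u0.
Proof.
have [oOm _ nOm bOm _] := hOm; have [cf hcf] := hf'.
have flip := lipschitz_of_derive1_bound (hf 1%N) hcf.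
have cf0 : 0 <= cf := le_trans (normr_ge0 _) (hcf 0).
exists (cf + 1) => lambda g q hl hg q1 hgq.
have cfl : cf < lambda by apply: lt_le_trans hl; rewrite ltrDl.
have [r r0 balls] := exterior_ball_uniform hOm.
have lcf : 0 <= lambda + cf by rewrite addr_ge0// (le_trans cf0 (ltW cfl)).
have [kappa k0 hkappa] := @barrier_rate_exists R m d lambda cf r hd r0 lcf.
have lcf0 : 0 < lambda - cf by rewrite subr_gt0.
pose K := `|f 0| / (lambda - cf).
have K0 : 0 <= K by rewrite divr_ge0// ltW.
have hK : `|f 0| <= (lambda - cf) * K by rewrite mulrC divfK// gt_eqF.
have B0 : 0 <= d * (2 * kappa * r).
  by rewrite mulr_ge0 ?(ltW hd)// mulr_ge0 ?(ltW r0)// mulr_ge0.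
have [M0 M00 hM0] := superlinear_threshold q1 B0 K0 hgq.
exists (M0 + 1) => [|u0 _ hu0 T u [hu _]]; first by rewrite addr_gt0.
rewrite ltey; apply/eqP => Ty; rewrite {}Ty in hu.
have [t1 t10 init] := initial_layer hOm hp hu hu0; rewrite addrK in init.
have [_ us _ _ _] := hu.
apply: (@comparison_blowup R m.+1 (boundary Om) u
  (fun t x => derive1 (fun tau : R => u tau x : R^o) t) q M0 t1
  (compact_boundary oOm bOm) (boundary_nonempty oOm bOm nOm) q1 M00 t10 _ _ _ init).
- move=> t x t0 [clx _] e e0.
  apply: filterS (near_space_time us t0 clx e0) => z hz z0 [cz _].
  exact: hz.
- by move=> t x t0 [clx _]; exact: (time_slice_derivable (Om := Om) us).
- move=> t x t0 bx xmin Mu; have [c [hc cx eb]] := balls x bx.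
  have MK : 0 <= u t x + K by rewrite addr_ge0// (le_trans (ltW M00)).
  have := boundary_minimum_rate oOm bOm hd hdelta cf0 cfl flip hu k0 hK hkappa t0
    hc cx eb bx xmin MK.
  apply: lt_le_trans; have := hM0 _ Mu.
  by rewrite [d * (2 * kappa * r * _)]mulrA.
Qed.
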